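(* For every integer $n \ge 0$, $$\|Y_n - Y\|_2^2 = (n+1)^{-1}\left(2H_n + 1 + \frac{6}{n+1}\right) - 4\sum_{k=n+1}^\infty k^{-2},$$ and, as $n\to\infty$, $$\|Y_n - Y\|_2^2 = 2\,\frac{\ln n}{n} + O\left(\frac1n\right).$$ Here $H_n := \sum_{j=1}^n j^{-1}$ is the $n$th harmonic number and $\|X\|_2 := (\mathbf{E}\,|X|^2)^{1/2}$.
   Context: Let $U_1, U_2, \dots$ be independent random variables, each uniform on $(0,1)$, defined on a common probability space. QuickSort: applied to a finite list of distinct keys, it does nothing (uses $0$ comparisons) if the list has size $0$ or $1$; otherwise it takes the first key of the list as pivot, compares each of the other keys to it, and recursively sorts the list of keys smaller than the pivot and the list of keys larger than the pivot, each kept in its original order. Let $K_n$ be the (random) number of key comparisons QuickSort uses on the list $U_1,\dots,U_n$, let $\mu_n := \mathbf{E}\,K_n$, and let $$Y_n := \frac{K_n-\mu_n}{n+1},\qquad n\ge 0.$$ Infinite binary search tree: insert $U_1,U_2,\dots$ successively into a binary search tree (smaller keys to the left, larger keys to the right). Nodes are labeled by $\Theta := \bigcup_{0\le k<\infty}\{0,1\}^k$: the root has the empty label $\varepsilon$, and node $\theta$ has left child $\theta 0$ and right child $\theta 1$; $|\theta|$ denotes the length of $\theta$. Almost surely every node eventually receives a key; let $V_\theta$ be the key at node $\theta$. Let $L_\theta$ be the largest key smaller than $V_\theta$ inserted at an ancestor of $\theta$ (with $L_\theta:=0$ if there is none), and $R_\theta$ the smallest key larger than $V_\theta$ inserted at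 an ancestor of $\theta$ (with $R_\theta:=1$ if there is none). Put $\phi_\theta := R_\theta-L_\theta$ and, with $C(x) := 1+2x\ln x+2(1-x)\ln(1-x)$ for $0<x<1$, $$G_\theta := \phi_\theta\, C(\phi_{\theta 0}/\phi_\theta) = \phi_\theta - 2\phi_\theta\ln\phi_\theta + 2\phi_{\theta0}\ln\phi_{\theta0}+2\phi_{\theta1}\ln\phi_{\theta1}.$$ Finally $Y := \sum_{j=0}^\infty\sum_{|\theta|=j}G_\theta$, where the series (over $j$) is known to converge in $L^p$ for every finite $p\geq 1$ (Rösler); $Y$ is its limit in $L^2$. *)

(* Defs.v *)
From HB Require Import structures.
From mathcomp Require Import all_boot all_order all_algebra.
From mathcomp Require Import all_classical all_reals all_analysis.

Set Implicit Arguments.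
Unset Strict Implicit.
Unset Printing Implicit Defensive.

Import Order.TTheory GRing.Theory Num.Theory.
Import numFieldNormedType.Exports.

Local Open Scope classical_set_scope.
Local Open Scope ring_scope.

Section Independence.
Context {d : measure_display} {T : measurableType d} {R : realType}.

Definition mutually_independent (P : probability T R) (X : nat -> {RV P >-> R}) : Prop :=
  forall (J : seq nat) (A : nat -> set R), uniq J -> (forall i, measurable (A i)) ->
    P (\big[setI/setT]_(i <- J) (X i @^-1` A i)) = (\prod_(i <- J) P (X i @^-1` A i))%E.

(* The library's [uniform_prob] lives on the closed interval; the endpoints
   have probability 0, so this is also the uniform law on the open one. *)
Definition iid_uniform01 (P : probability T R) (X : nat -> {RV P >-> R}) : Prop :=
  mutually_independent X /\
  forall (i : nat) (A : set R), measurable A ->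
    distribution P (X i) A = uniform_prob (ltr01 : (0 : R) < 1) A.

End Independence.

Section QuickSort.
Context {R : realType}.
Implicit Types (s : seq R) (x y : R).

(* The recursive calls are on strictly shorter lists, so [size s] units of fuel
   suffice for [s]; [qs_comps_cons] is the fuel-free recursion. *)
Fixpoint qs_comps_rec (fuel : nat) s : nat :=
  match fuel, s with
  | fuel'.+1, x :: s' =>
      (size s' + qs_comps_rec fuel' [seq y <- s' | (y < x)%R]
               + qs_comps_rec fuel' [seq y <- s' | (x < y)%R])%N
  | _, _ => 0%N
  end.

Definition qs_comps s : nat := qs_comps_rec (size s) s.

Lemma qs_comps_rec_fuel (m n : nat) s :
  (size s <= m)%N -> (size s <= n)%N -> qs_comps_rec m s = qs_comps_rec n s.
Proof.
elim: m n s => [|m IH] [|n] [|x s] //= sm sn.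
have le_filter (p : pred R) k : (size s <= k)%N -> (size [seq y <- s | p y] <= k)%N.
  by move=> sk; rewrite size_filter (leq_trans (count_size _ _) sk).
by congr (_ + _ + _)%N; apply: IH; apply: le_filter.
Qed.

Lemma qs_comps_cons x s :
  qs_comps (x :: s) = (size s + qs_comps [seq y <- s | (y < x)%R]
                              + qs_comps [seq y <- s | (x < y)%R])%N.
Proof.
by congr (_ + _ + _)%N; apply: qs_comps_rec_fuel => //; rewrite size_filter count_size.
Qed.

End QuickSort.

Section BinarySearchTree.
Context {R : realType}.

Inductive bst : Type := Leaf | Node of bst & R & bst.

Fixpoint bst_insert (t : bst) (x : R) : bst :=
  match t with
  | Leaf => Node Leaf x Leaf
  | Node l y r => if x < y then Node (bst_insert l x) y r
                  else Node l y (bst_insert r x)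
  end.

(* A label is read from the root; [false] is 0 (left), [true] is 1 (right). *)
Fixpoint bst_key (t : bst) (theta : seq bool) : option R :=
  match t, theta with
  | Leaf, _ => None
  | Node _ y _, [::] => Some y
  | Node l _ r, b :: theta' => bst_key (if b then r else l) theta'
  end.

(* Below, [u] is a sequence of keys; [u 0] is the first one inserted. *)
Definition bst_of (u : nat -> R) (n : nat) : bst :=
  foldl bst_insert Leaf (mkseq u n).

(* Keys never move once inserted, so the set below has at most one element; the
   default 0 is used only if the node never receives a key. *)
Definition node_key (u : nat -> R) (theta : seq bool) : R :=
  xget 0 [set v | exists n, bst_key (bst_of u n) theta = Some v].

(* The proper ancestors of [theta] are [take k theta] for [k < size theta].
   For keys in (0,1), the neutral values 0 and 1 are used exactly when no
   ancestor qualifies. *)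
Definition node_left (u : nat -> R) (theta : seq bool) : R :=
  \big[Num.max/0]_(k < size theta | node_key u (take k theta) < node_key u theta)
     node_key u (take k theta).

Definition node_right (u : nat -> R) (theta : seq bool) : R :=
  \big[Num.min/1]_(k < size theta | node_key u theta < node_key u (take k theta))
     node_key u (take k theta).

Definition node_phi (u : nat -> R) (theta : seq bool) : R :=
  node_right u theta - node_left u theta.

Definition Cfun (x : R) : R := 1 + 2 * x * ln x + 2 * (1 - x) * ln (1 - x).

Definition node_G (u : nat -> R) (theta : seq bool) : R :=
  node_phi u theta * Cfun (node_phi u (rcons theta false) / node_phi u theta).

Definition G_partial_sum (u : nat -> R) (J : nat) : R :=
  \sum_(0 <= j < J) \sum_(theta : j.-tuple bool) node_G u theta.

End BinarySearchTree.

Section Normalization.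
Context {d : measure_display} {T : measurableType d} {R : realType}.
Variables (P : probability T R) (U : nat -> {RV P >-> R}).

(* The key called U_{i+1} in the usual 1-based indexing is [U i]. *)
Definition K (n : nat) (w : T) : nat := qs_comps (mkseq (fun i => U i w) n).

Definition mu (n : nat) : R := fine 'E_P[(fun w => (K n w)%:R : R)].

Definition Yn (n : nat) (w : T) : R := ((K n w)%:R - mu n) / n.+1%:R.

Definition L2norm (X : T -> R) : \bar R := 'N[P]_(2%:E)[EFin \o X].

Definition is_L2_limit_of_G_series (Y : {RV P >-> R}) : Prop :=
  L2norm (fun w => G_partial_sum (fun i => U i w) J - Y w) @[J --> \oo] --> 0%E.

End Normalization.

Definition harmonic_number {R : realType} (n : nat) : R :=
  \sum_(1 <= j < n.+1) j%:R^-1.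

(* Main.v *)
Require Import Defs.
From HB Require Import structures.
From mathcomp Require Import all_boot all_order all_algebra.
From mathcomp Require Import all_classical all_reals all_analysis.
From mathcomp Require Import measurable_realfun ring lra zify.

Set Implicit Arguments.
Unset Strict Implicit.
Unset Printing Implicit Defensive.

Import Order.TTheory GRing.Theory Num.Theory.
Import numFieldNormedType.Exports.

Local Open Scope classical_set_scope.
Local Open Scope ring_scope.

(** Record a binary search tree by the chain of gaps that its keys cut out of the
    unit interval, each gap carrying the depth at which it hangs: a profile. A new
    key falls into a gap of length g and depth k and splits it into two gaps of
    depth k + 1. Uniformity of the keys has two consequences.

    - Depths and lengths are independent, and the lengths are jointly Dirichlet
      ([mean_depths_gap_monomial]): integrating out the last key merges two gaps
      by a Beta integral, whatever the depths are.
    - Inserting a key at relative position x in a gap of length g adds g C(x) to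
      the sum of G over the occupied nodes. Since C has integral 0, these
      increments are orthogonal in L2 to the past, and their second moments are
      the integral c of C^2 times the mean of the sum of cubes of the gaps, which
      is 6/((n+2)(n+3)) and sums to 3 ([mean_add_incr_sqr], [mean_gap_cubes]).

    Let X_n be the sum of G over the first n nodes and D_n the sum of the depths
    of the n + 1 gaps. On the one hand K_n = D_n - 2n, because a key is compared
    with its ancestors ([qs_comps_ext_length]), so that Y_n is a centred function
    of the depths. On the other hand C is such that X_n is the sum over the gaps
    of k g + 2 g ln g ([gap_pot_insert]). By independence the entropy part is
    orthogonal to Y_n, and as every gap has mean length 1/(n+1), the other part
    gives <Y_n, X_n> = <Y_n, D_n>/(n+1) = ||Y_n||^2 ([mean_Yrank_pot]). All later
    increments being orthogonal to Y_n and X_n, the limit Y satisfies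

      ||Y_n - Y||^2 = ||Y||^2 - ||Y_n||^2 = 3 c - Var(K_n)/(n+1)^2

    ([L2norm_sqr_Yn]). The variance follows from recurrences for the moments of
    the depths ([depth_mean_dsum_sqr]), and 3 c = 7 - 4 zeta(2) from the
    logarithmic series ([int_Cfun_sqr_approx]); the closed formula results, and
    the asymptotics follow from elementary bounds on harmonic numbers.

    What is left is that Y is given as a limit of sums over levels of the tree,
    not over times. Hence all increments are truncated at a level J. Almost
    surely the keys are distinct and dense, every node is eventually filled
    ([generic_filled]), and the truncated sums are eventually equal to the sum
    over the levels below J ([G_partial_sumE]). They are bounded, so their
    distance to Y_n passes to the limit by dominated convergence
    ([integral_Yn_G_sum]), and then J tends to infinity. *)

(** * Independence of the last key from the past *)

Section LastKey.
Context {R : realType} {d : measure_display} {T : measurableType d}.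
Variables (P : probability T R) (U : nat -> {RV P >-> R}).

Definition past_cylinders (n : nat) : set (set T) :=
  [set B | exists2 A : nat -> set R, (forall i, measurable (A i)) &
     B = \big[setI/setT]_(i <- iota 0 n) (U i @^-1` A i)].

(** A copy of the sample space: measurability on [past n] means dependence on the
    first n keys alone. *)
Definition past (n : nat) : measurableType (past_cylinders n).-sigma :=
  g_sigma_algebraType (past_cylinders n).

Lemma measurable_preimage_RV i (A : set R) : measurable A -> measurable (U i @^-1` A).
Proof. by move=> mA; rewrite -[X in measurable X]setTI; exact: measurable_funP. Qed.

Lemma past_cylinders_measurable n : past_cylinders n `<=` measurable.
Proof.
move=> B [A mA ->]; apply: big_ind => //.
- exact: measurableI.
- by move=> i _; exact: measurable_preimage_RV.
Qed.

Lemma past_measurable n (B : set T) : measurable (B : set (past n)) -> measurable B.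
Proof. exact: (smallest_sub (@sigma_algebra_measurable _ T) (@past_cylinders_measurable n)). Qed.

Lemma past_cylinders_setI n : setI_closed (past_cylinders n).
Proof.
move=> B C [A mA ->] [A' mA' ->]; exists (fun i => A i `&` A' i).
  by move=> i; exact: measurableI.
by rewrite -big_split; apply: eq_bigr => i _; rewrite preimage_setI.
Qed.

Lemma measurable_past_RV n i : (i < n)%N -> measurable_fun setT (U i : past n -> R).
Proof.
move=> ltin _ A mA; rewrite setTI; apply: sub_sigma_algebra.
exists (fun j => if j == i then A else setT) => [j|]; first by case: ifP.
rewrite (bigD1_seq i) ?mem_iota ?iota_uniq//= eqxx big1 ?setIT// => j /negbTE ->.
exact: preimage_setT.
Qed.

Lemma measurable_past_id n : measurable_fun setT (id : T -> past n).
Proof. by move=> _ B mB; rewrite setTI; exact: past_measurable mB. Qed.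

Hypothesis iid : iid_uniform01 U.

(** Both sides are finite measures in B, and they agree on the cylinders, which
    form a pi-system generating the past. *)
Lemma past_independent n (B : set T) (A : set R) :
  measurable (B : set (past n)) -> measurable A ->
  P (B `&` U n @^-1` A) = (P B * P (U n @^-1` A))%E.
Proof.
move=> mB mA; have [indep _] := iid.
have mC := measurable_preimage_RV n mA.
have Pfin : P (U n @^-1` A) \is a fin_num by exact: fin_num_measure.
have r0 : 0 <= fine (P (U n @^-1` A)) by exact/fine_ge0/measure_ge0.
pose m1 : {measure set T -> \bar R} := mrestr P mC.
pose m2 : {measure set T -> \bar R} := mscale (NngNum r0) P.
suff : m1 B = m2 B by rewrite /m1 /m2 /mrestr/= /mscale/= fineK// muleC.
apply: (g_sigma_algebra_measure_unique (past_cylinders n) (@past_cylinders_measurable n)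
   (fun=> setT)) => //.
- by move=> _; exists (fun=> setT) => //; rewrite big1.
- by rewrite bigcup_const//; exists 0%N.
- exact: past_cylinders_setI.
- move=> _ [A' mA' ->]; rewrite /m1 /m2 /mrestr/= /mscale/= fineK// muleC.
  pose A'' i := if i == n then A else A' i.
  have mA'' i : measurable (A'' i) by rewrite /A''; case: ifP.
  have eA : forall i, i \in iota 0 n -> U i @^-1` A'' i = U i @^-1` A' i.
    by move=> i; rewrite mem_iota /A'' => /andP[_ /=]; rewrite add0n => /ltn_eqF ->.
  have := indep (iota 0 n.+1) A'' (iota_uniq _ _) mA''.
  rewrite -addn1 iotaD !big_cat/= !big_seq1 add0n {2 4}/A'' eqxx.
  rewrite !(eq_big_seq _ eA) => E; apply: (eq_trans E).
  congr (_ * _)%E.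
  rewrite (indep _ _ (iota_uniq _ _) mA').
  apply: eq_big_seq => i /eA; by rewrite /A'' => ->.
- move=> _; rewrite /m1/= /mrestr/=; apply: le_lt_trans (ltry 1);
    exact: probability_le1 (measurableI _ _ measurableT mC).
Qed.

Lemma ge0_integral_uniform_RV n (h : R -> \bar R) :
  measurable_fun setT h -> (forall x, 0 <= h x)%E ->
  (\int[P]_w h (U n w) = \int[lebesgue_measure]_(x in `[0%R, 1%R]) h x)%E.
Proof.
move=> mh h0.
pose V : T -> measurableTypeR R := U n.
have mV : measurable_fun setT V by move=> mT A mA; exact: (measurable_funP (U n)).
pose VM : {mfun T >-> measurableTypeR R} := HB.pack V (isMeasurableFun.Build _ _ _ _ V mV).
transitivity (\int[distribution P VM]_x h x)%E.
  by rewrite ge0_integral_pushforward.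
transitivity (\int[uniform_prob (ltr01 : (0%R:R) < 1)%R]_x h x)%E.
  by apply: eq_measure_integral => B mB _; have [_ unif] := iid; exact: unif.
by rewrite integral_uniform// subr0 invr1 mul1e.
Qed.

(** The joint law of the past and the next key is the product of their laws, by
    independence, so that Tonelli's theorem integrates out the key. *)
Lemma ge0_integral_last_key n (f : past n * R -> \bar R) :
  measurable_fun setT f -> (forall z, 0 <= f z)%E ->
  (\int[P]_w f (w, U n w) = \int[P]_w \int[lebesgue_measure]_(x in `[0%R, 1%R]) f (w, x))%E.
Proof.
move=> mf f0.
pose g : T -> past n * R := fun w => (w : past n, U n w).
have mg : measurable_fun setT g.
  by apply: measurable_fun_pair; [exact: measurable_past_id|exact: measurable_funP].
pose gM : {mfun T >-> (past n * R)%type} := HB.pack g (isMeasurableFun.Build _ _ _ _ g mg).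
pose iM : {mfun T >-> past n} := HB.pack (id : T -> past n)
   (isMeasurableFun.Build _ _ _ _ (id : T -> past n) (@measurable_past_id n)).
pose m1 : {measure set (past n) -> \bar R} := distribution P iM.
pose m2 := distribution P (U n).
have unique : forall X, measurable X -> (m1 \x m2)%E X = (distribution P gM) X.
  apply: product_measure_unique => A B mA mB; exact: past_independent.
have -> : (\int[P]_w f (w, U n w) = \int[distribution P gM]_z f z)%E.
  by rewrite ge0_integral_pushforward.
rewrite (eq_measure_integral (m1 \x m2)%E); last by move=> A mA _; apply/esym/unique.
rewrite fubini_tonelli1// /m1 /distribution.
rewrite ge0_integral_pushforward//=.
- apply: eq_integral => w _; rewrite /fubini_F/=.
  rewrite ge0_integral_pushforward//=; last exact: measurable_fun_pair2.
  apply: (@ge0_integral_uniform_RV n (fun x => f (w, x))) => //.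
  exact: (@measurable_fun_pair2 _ _ _ (past n) R _ f w).
- exact: measurable_past_id.
- exact: measurable_fun_fubini_tonelli_F.
- by move=> w _; apply: integral_ge0 => x _.
Qed.

End LastKey.

(** * Integrals over half-open intervals *)
Section IntervalIntegral.
Context {R : realType}.
Implicit Types (f g : R -> R) (a b c v : R).
Local Notation leb := (@lebesgue_measure R).

(** Half-open intervals tile without overlap, so that integrals over a chain of
    gaps add up with no endpoint corrections. *)
Definition has_int f a b v :=
  leb.-integrable `[a, b[ (EFin \o f) /\ \int[leb]_(x in `[a, b[) f x = v.

Lemma has_int_eq f g a b v :
  (forall x, a <= x < b -> f x = g x) -> has_int g a b v -> has_int f a b v.
Proof.
move=> fg [ig vg].
have fg' : {in `[a, b[%classic, f =1 g}.
  by move=> x; rewrite inE/= in_itv/=; exact: fg.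
split; last by rewrite -vg; exact: eq_Rintegral.
by apply: eq_integrable ig => // x xab /=; rewrite fg'.
Qed.

Lemma has_int_split f a b c v w : a <= b -> b <= c ->
  has_int f a b v -> has_int f b c w -> has_int f a c (v + w).
Proof.
move=> ab bc [i1 <-] [i2 <-].
rewrite /has_int (@itv_bndbnd_setU _ _ _ (BLeft b)) ?bnd_simp//.
have d : [disjoint `[a, b[%classic & `[b, c[%classic].
  apply/disj_setPS => y [/=]; rewrite 2!in_itv/= => /andP[_ yx] /andP[].
  by rewrite leNgt yx.
have i12 : leb.-integrable (`[a, b[ `|` `[b, c[) (EFin \o f).
  have mf : measurable_fun (`[a, b[ `|` `[b, c[) (EFin \o f).
    by apply/measurable_funU => //; split; [exact: measurable_int i1|exact: measurable_int i2].
  apply/integrableP; split => //.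
  rewrite ge0_integral_setU//; last by apply: measurableT_comp.
  move/integrableP : i1 => [_ i1]; move/integrableP : i2 => [_ i2].
  exact: lte_add_pinfty.
by split => //; rewrite Rintegral_setU.
Qed.

Lemma has_int_add f g a b v w :
  has_int f a b v -> has_int g a b w -> has_int (fun x => f x + g x) a b (v + w).
Proof.
move=> [i1 <-] [i2 <-]; split; last by rewrite RintegralD.
by rewrite (_ : _ \o _ = (EFin \o f) \+ (EFin \o g))%E//; exact: integrableD.
Qed.

Lemma has_int_scale k f a b v : has_int f a b v -> has_int (fun x => k * f x) a b (k * v).
Proof.
move=> [i1 <-]; split; last by rewrite RintegralZl.
rewrite (_ : _ \o _ = (fun x => k%:E * (EFin \o f) x))%E//; exact: integrableZl.
Qed.

Lemma has_int_nil f a : has_int f a a 0.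
Proof.
rewrite /has_int set_itvco0; split; last by rewrite Rintegral_set0.
exact: integrable_set0.
Qed.

Lemma has_int_cst k a b : a <= b -> has_int (fun=> k) a b (k * (b - a)).
Proof.
move=> ab; split.
  apply: measurable_bounded_integrable => //.
    by rewrite /= lebesgue_measure_itv/=; case: ifP => _; rewrite ?ltry.
  by exists `|k|; split => // M kM x _ /=; exact: ltW.
rewrite Rintegral_cst// /= lebesgue_measure_itv/= lte_fin.
by move: ab; rewrite le_eqVlt => /orP[/eqP->|->]; rewrite ?ltxx ?subrr.
Qed.

(** Integrability on the closed interval is what the fundamental theorem and
    compactness arguments deliver. *)
Lemma has_int_closed f a b : leb.-integrable `[a, b] (EFin \o f) ->
  has_int f a b (\int[leb]_(x in `[a, b]) f x).
Proof.
move=> i1.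
have i2 : leb.-integrable `[a, b[ (EFin \o f).
  apply: integrableS i1 => // x /=; rewrite !in_itv/= => /andP[-> /ltW//].
by split => //; rewrite -Rintegral_itv_bndo_bndc.
Qed.

Lemma has_int_within_continuous f a b : {within `[a, b], continuous f} ->
  has_int f a b (\int[leb]_(x in `[a, b]) f x).
Proof.
move=> cf; apply: has_int_closed.
by apply: continuous_compact_integrable => //; exact: segment_compact.
Qed.

Lemma has_int_FTC f F a b : a < b -> {within `[a, b], continuous f} ->
  derivable_oo_LRcontinuous F a b -> {in `]a, b[, F^`()%classic =1 f} ->
  has_int f a b (F b - F a).
Proof.
move=> ab cf dF F'f.
have -> : F b - F a = \int[leb]_(x in `[a, b]) f x.
  by rewrite /Rintegral (continuous_FTC2 ab cf dF F'f).
exact: has_int_within_continuous.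
Qed.

(** For a = b the quotient is 0/0, but both sides vanish: degenerate gaps are
    harmless. *)
Lemma has_int_affine g a b : a <= b -> continuous g ->
  has_int (fun x => g ((x - a) / (b - a))) a b
    ((b - a) * \int[leb]_(x in `[0, 1]) g x).
Proof.
rewrite le_eqVlt => /orP[/eqP <-|ab] cg.
  by rewrite subrr mul0r; exact: has_int_nil.
have ba : 0 < b - a by rewrite subr_gt0.
pose F := ((fun x => (b - a)^-1 * x) \- cst ((b - a)^-1 * a)) : R -> R.
have FE x : F x = (x - a) / (b - a) by rewrite /F/= -mulrBr mulrC.
have dF (x : R) : is_derive x (1 : R) F ((b - a)^-1).
  by apply: is_derive_eq; rewrite scaler1 subr0.
have F'E : F^`()%classic = cst (b - a)^-1.
  by apply/funext => x; rewrite derive1E; exact: (@derive_val _ _ _ _ _ _ _ (dF x)).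
have cF x : {for x, continuous F}.
  by apply/differentiable_continuous/derivable1_diffP; case: (dF x).
have Fa : F a = 0 by rewrite FE subrr mul0r.
have Fb : F b = 1 by rewrite FE divff// gt_eqF.
have Fab : derivable_oo_LRcontinuous F a b.
  split; first by move=> x _; case: (dF x).
  - exact: cvg_at_right_filter (cF a).
  - exact: cvg_at_left_filter (cF b).
have cgF : {within `[a, b], continuous (fun x => g ((x - a) / (b - a)))}.
  apply: continuous_subspaceT => x; rewrite (_ : (fun _ => _) = g \o F); last first.
    by apply/funext => y /=; rewrite FE.
  by apply: continuous_comp; [exact: cF|exact: cg].
have -> : (b - a) * \int[leb]_(x in `[0, 1]) g x =
    \int[leb]_(x in `[a, b]) g ((x - a) / (b - a)).
  have := @integration_by_substitution_increasing R F g a b (ltW ab).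
  rewrite Fa Fb F'E /Rintegral => ->.
  - have -> : fine (\int[leb]_(x in `[a, b]) (((g \o F) * cst (b - a)^-1) x)%:E)%E =
        \int[leb]_(x in `[a, b]) (g ((x - a) / (b - a)) * (b - a)^-1).
      by congr fine; apply: eq_integral => x _; rewrite -FE.
    rewrite RintegralZr//; last first.
      by apply: continuous_compact_integrable => //; exact: segment_compact.
    by rewrite mulrCA mulfV ?gt_eqF// mulr1.
  - by move=> x y _ _ xy; rewrite !FE ltr_pM2r ?invr_gt0// ltrD2r.
  - by move=> x _; exact: cvg_cst.
  - exact: is_cvg_cst.
  - exact: is_cvg_cst.
  - exact: Fab.
  - exact: continuous_subspaceT.
exact: has_int_within_continuous.
Qed.

End IntervalIntegral.

(** * The function x ln x and the integrals of C and of its square *)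
Section EntropyFunction.
Context {R : realType}.
Implicit Types (x y a b : R).

Definition xlnx x := x * ln x.

Lemma xlnx0 : xlnx 0 = 0. Proof. by rewrite /xlnx mul0r. Qed.
Lemma xlnx1 : xlnx 1 = 0. Proof. by rewrite /xlnx ln1 mulr0. Qed.

Lemma xlnx_bound x : 0 <= x <= 1 -> `|xlnx x| <= 1.
Proof.
move=> /andP[x0 x1]; move: x0; rewrite le_eqVlt => /orP[/eqP<-|x0].
  by rewrite xlnx0 normr0.
have lnx0 : ln x <= 0 by exact: ln_le0.
rewrite /xlnx ler0_norm; last by rewrite mulr_ge0_le0// ltW.
rewrite -mulrN -lnV ?posrE//.
have xV : 0 < x^-1 by rewrite invr_gt0.
have := ln_sublinear xV => /ltW; rewrite -(ler_pM2l x0) => /le_trans; apply.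
by rewrite divff ?gt_eqF.
Qed.

Lemma continuous_xlnx : continuous xlnx.
Proof.
move=> x; have [x0|x0|->] := ltgtP x 0.
- rewrite /continuous_at {2}/xlnx ln0 ?mulr0 ?ltW//; apply: cvg_near_cst.
  near=> y; rewrite /xlnx ln0 ?mulr0//; apply: ltW; near: y.
  exact: lt_nbhsl.
- apply: cvgM; [exact: cvg_id|exact: continuous_ln].
rewrite /continuous_at xlnx0; apply/cvgrPdist_le => e e0.
near=> y; rewrite sub0r normrN.
have [y0|y0] := leP y 0; first by rewrite /xlnx ln0// mulr0 normr0 ltW.
have ye : y < e ^+ 2 / 4.
  by near: y; apply: lt_nbhsl; rewrite divr_gt0// exprn_gt0.
have y1 : y < 1 by near: y; exact: lt_nbhsl.
(* With s the square root of y, |y ln y| = 2 s^2 ln (1/s) <= 2 s. *)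
set s := Num.sqrt y.
have s0 : 0 < s by rewrite sqrtr_gt0.
have ys : y = s ^+ 2 by rewrite sqr_sqrtr// ltW.
have lns : ln y = - (2 * ln s^-1).
  by rewrite lnV ?posrE// ys lnXn// mulrN opprK mulr_natl.
have se : 2 * s <= e.
  rewrite -(ler_pXn2r (_ : 0 < 2)%N) ?nnegrE ?mulr_ge0 ?(ltW s0) ?(ltW e0)//.
  by rewrite exprMn -ys; lra.
have lnsV : ln s^-1 <= s^-1 by apply/ltW/ln_sublinear; rewrite invr_gt0.
have lnsV0 : 0 <= ln s^-1.
  rewrite ln_ge0// invf_ge1//.
  by rewrite -sqrtr1 ler_sqrt// ltW.
rewrite /xlnx lns mulrN normrN ger0_norm; last first.
  by rewrite mulr_ge0 ?(ltW y0)// mulr_ge0.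
rewrite (le_trans _ se)// mulrCA ler_pM2l// ys expr2 -mulrA ler_piMr ?(ltW s0)//.
by rewrite -(divff (lt0r_neq0 s0)) ler_pM2l.
Unshelve. all: by end_near. Qed.

Lemma is_derive_xlnx x : 0 < x -> is_derive x (1:R) xlnx (ln x + 1).
Proof.
move=> x0; apply: (is_derive_eq (is_deriveM (is_derive_id x (1:R)) (is_derive1_ln x0))).
by rewrite /GRing.scale/= divff ?gt_eqF// mulr1 addrC.
Qed.

Lemma derivable_oo_LR_of_continuous (f df : R -> R) a b :
  (forall x : R, x \in `]a, b[%R -> is_derive x (1:R) f (df x)) -> continuous f ->
  derivable_oo_LRcontinuous f a b.
Proof.
move=> dff cf; split.
- by move=> x /dff[].
- exact: cvg_at_right_filter (cf a).
- exact: cvg_at_left_filter (cf b).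
Qed.

Definition log_poly N x := \sum_(i < N) x ^+ i.+1 / i.+1%:R.

Lemma is_derive_log_poly N x : x != 1 ->
  is_derive x (1:R) (log_poly N) ((1 - x ^+ N) / (1 - x)).
Proof.
move=> x1; have x1' : 1 - x != 0 by rewrite subr_eq0 eq_sym.
elim: N => [|N IH].
  rewrite (_ : log_poly 0 = cst 0); last by apply/funext => y; rewrite /log_poly big_ord0.
  by rewrite expr0 subrr mul0r; exact: is_derive_cst.
have -> : log_poly N.+1 = log_poly N + (N.+1%:R^-1 \*: (id ^+ N.+1 : R -> R)).
  by apply/funext => y; rewrite /log_poly big_ord_recr/= !fctE mulrC.
have dX := is_deriveX N.+1 (is_derive_id x (1:R)).
apply: (is_derive_eq (is_deriveD IH (is_deriveZ N.+1%:R^-1 dX))).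
rewrite /GRing.scale/= mulr1 mulrA mulVf ?mul1r ?pnatr_eq0//.
by rewrite exprS; field.
Qed.

Lemma log_poly0 N : log_poly N 0 = 0.
Proof. by rewrite /log_poly big1// => i _; rewrite expr0n mul0r. Qed.

(** Both bounds compare derivatives on [0, y]: the error has derivative
    t^N / (1 - t), which lies between 0 and t^N / (1 - y). *)
Lemma log_poly_error N y : 0 <= y < 1 ->
  0 <= - ln (1 - y) - log_poly N y <= y ^+ N.+1 / (N.+1%:R * (1 - y)).
Proof.
move=> /andP[y0 y1].
pose D := fun t : R => - ln (1 - t) - log_poly N t.
have dD (t : R) : t < 1 -> is_derive t (1:R) D (t ^+ N / (1 - t)).
  move=> t1; have t1' : 0 < 1 - t by rewrite subr_gt0.
  have dl : is_derive t (1:R) (@ln R \o (cst 1 - id)) (- (1 - t)^-1).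
    have d1 : is_derive t (1:R) (cst 1 - id : R -> R) (0 - 1) by exact: is_deriveB.
    have := @is_derive1_comp _ (@ln R) (cst 1 - id) t _ _ (is_derive1_ln t1') d1.
    by rewrite sub0r mulrN1.
  have dp : is_derive t (1:R) (log_poly N) ((1 - t ^+ N) / (1 - t)).
    by apply: is_derive_log_poly; rewrite lt_eqF.
  apply: (is_derive_eq (is_deriveB (is_deriveN dl) dp)).
  by field; rewrite gt_eqF.
have D0 : D 0 = 0 by rewrite /D subr0 ln1 log_poly0 !oppr0 addr0.
have cD (f : R -> R) (df : R -> R) :
    (forall t : R, t < 1 -> is_derive t (1:R) f (df t)) -> {within `[0, y], continuous f}.
  move=> dff; apply: derivable_within_continuous => t; rewrite in_itv/= => /andP[_ ty].
  by have [] := dff t (le_lt_trans ty y1).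
have y1' : 0 < 1 - y by rewrite subr_gt0.
apply/andP; split.
  have dD' t : t \in `]0, y[%R -> is_derive t (1:R) D (t ^+ N / (1 - t)).
    by rewrite in_itv/= => /andP[_ ty]; apply: dD; exact: lt_trans y1.
  have [t t0y] := MVT_segment y0 dD' (cD _ _ dD).
  rewrite D0 !subr0 -/(D y) => ->.
  move: t0y; rewrite in_itv/= => /andP[t0 ty].
  by rewrite mulr_ge0// divr_ge0 ?exprn_ge0// subr_ge0 (le_trans ty)// ltW.
(* For t below y, the derivative of t^(N+1) / ((N+1) (1-y)) dominates that of D. *)
pose G := (((N.+1%:R * (1 - y))^-1 \*: (id ^+ N.+1 : R -> R)) - D).
have dG (t : R) : t < 1 -> is_derive t (1:R) G (t ^+ N / (1 - y) - t ^+ N / (1 - t)).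
  move=> t1; have dX := is_deriveX N.+1 (is_derive_id t (1:R)).
  apply: (is_derive_eq (is_deriveB (is_deriveZ (N.+1%:R * (1 - y))^-1 dX) (dD t t1))).
  congr (_ - _); rewrite /GRing.scale/= mulr1.
  by field; rewrite gt_eqF// addrC natr1 pnatr_eq0.
have G0 : G 0 = 0.
  by rewrite /G !fctE D0 subr0 /= expr0n; exact: scaler0.
have dG' t : t \in `]0, y[%R -> is_derive t (1:R) G (t ^+ N / (1 - y) - t ^+ N / (1 - t)).
  by rewrite in_itv/= => /andP[_ ty]; apply: dG; exact: lt_trans y1.
have [t t0y] := MVT_segment y0 dG' (cD _ _ dG).
rewrite G0 !subr0 => Gy; rewrite -subr_ge0.
have -> : y ^+ N.+1 / (N.+1%:R * (1 - y)) - (- ln (1 - y) - log_poly N y) = G y.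
  by rewrite /G !fctE mulrC.
move: t0y; rewrite in_itv/= => /andP[t0 ty].
rewrite Gy mulr_ge0// subr_ge0 ler_wpM2l ?exprn_ge0//.
by rewrite lef_pV2 ?posrE ?subr_gt0 ?(le_lt_trans ty)// lerD2l lerN2.
Qed.

(** The error of the truncated series of ln around 1 blows up near 0, but the
    factor x compensates, so the approximation of x ln x is uniform. *)
Lemma xlnx_poly_error N x : 0 <= x <= 1 ->
  `|xlnx x + x * log_poly N (1 - x)| <= N.+1%:R^-1.
Proof.
move=> /andP[x0 x1]; move: x0; rewrite le_eqVlt => /orP[/eqP<-|x0].
  by rewrite xlnx0 mul0r addr0 normr0 invr_ge0.
have y01 : 0 <= 1 - x < 1 by lra.
have := log_poly_error N y01; rewrite subKr => /andP[e0 e1].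
rewrite -normrN opprD -mulrN -mulrN -mulrDr ger0_norm; last first.
  by rewrite mulr_ge0// ltW.
rewrite -(ler_pM2l x0) in e1; apply: (le_trans e1).
have -> : x * ((1 - x) ^+ N.+1 / (N.+1%:R * x)) = (1 - x) ^+ N.+1 / N.+1%:R.
  have : N.+1%:R != 0 :> R by rewrite pnatr_eq0.
  by move: (N.+1%:R) => n n0; field; rewrite n0 gt_eqF.
rewrite ler_piMl ?invr_ge0//; apply: exprn_ile1; lra.
Qed.

Lemma CfunE x : Cfun x = 1 + 2 * xlnx x + 2 * xlnx (1 - x).
Proof. by rewrite /Cfun /xlnx !mulrA. Qed.

Lemma continuous_Cfun : continuous (@Cfun R).
Proof.
have -> : @Cfun R = (cst 1 + 2 \*: xlnx) + 2 \*: (xlnx \o (cst 1 - id)).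
  by apply/funext => x; rewrite CfunE.
move=> x; apply: cvgD; first apply: cvgD.
- exact: cvg_cst.
- by apply: cvgZr; exact: continuous_xlnx.
- apply: cvgZr; apply: continuous_comp; last exact: continuous_xlnx.
  by apply: cvgB; [exact: cvg_cst|exact: cvg_id].
Qed.

Lemma Cfun_bound x : 0 <= x <= 1 -> `|Cfun x| <= 5.
Proof.
move=> x01; have x01' : 0 <= 1 - x <= 1 by lra.
move: (xlnx_bound x01) (xlnx_bound x01'); rewrite CfunE !ler_norml => *; lra.
Qed.

Lemma is_derive_exp x n : is_derive x (1:R) (fun y : R => y ^+ n) (n%:R * x ^+ n.-1).
Proof.
have := is_deriveX n (is_derive_id x (1:R)).
by rewrite exprfctE /GRing.scale/= mulr1.
Qed.

Lemma has_int_xlnx_expr k : has_int (fun x => x ^+ k * xlnx x) 0 1 (- (k.+2%:R ^- 2)).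
Proof.
have k0 : 0 < k%:R + 2 :> R by rewrite ltr_wpDl.
have kE : k.+2%:R = k%:R + 2 :> R by rewrite -addn2 natrD.
(* The primitive x^(k+2) ln x / (k+2) - x^(k+2) / (k+2)^2, through xlnx so as to
   be continuous at 0. *)
pose F := k.+2%:R^-1 \*: ((fun y : R => y ^+ k.+1) * xlnx)
  - k.+2%:R ^- 2 \*: (fun y : R => y ^+ k.+2).
have cF : continuous F.
  move=> x; apply: cvgB; apply: cvgZr; last exact: exprn_continuous.
  by apply: cvgM; [exact: exprn_continuous|exact: continuous_xlnx].
have dF (x : R) : x \in `]0, 1[%R -> is_derive x (1:R) F (x ^+ k * xlnx x).
  rewrite in_itv/= => /andP[x0 _].
  have dx := is_derive_xlnx x0.
  have di := is_derive_id x (1:R).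
  apply: (is_derive_eq (is_deriveB (is_deriveZ k.+2%:R^-1 (is_deriveM (is_derive_exp x k.+1) dx))
     (is_deriveZ (k.+2%:R ^- 2) (is_derive_exp x k.+2)))).
  rewrite /GRing.scale/= /xlnx kE -[k.+1%:R]natr1.
  rewrite !exprS expr0 mulr1; move: (x ^+ k) k0 => z; move: (k%:R : R) (ln x) => q l q0.
  have E : (q + 2)^-1 * (x * z * (l + 1) + x * l * ((q + 1) * z)) -
      ((q + 2) * (q + 2))^-1 * ((q + 2) * (x * z)) = z * (x * l).
    by field; rewrite gt_eqF.
  exact: E.
have FE (x : R) : F x = k.+2%:R^-1 * (x ^+ k.+1 * xlnx x) - k.+2%:R ^- 2 * x ^+ k.+2 by [].
have -> : - k.+2%:R ^- 2 = F 1 - F 0.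
  by rewrite !FE xlnx0 xlnx1 !expr1n !expr0n/= !mulr0 mulr1 subrr subr0 sub0r.
apply: has_int_FTC => //.
- apply: continuous_subspaceT => x; apply: cvgM; last exact: continuous_xlnx.
  exact: exprn_continuous.
- exact: derivable_oo_LR_of_continuous dF cF.
- move=> x x01; rewrite derive1E.
  by case: (dF x x01) => _ ->.
Qed.

Lemma has_int_xlnx_sqr : has_int (fun x => xlnx x ^+ 2) 0 1 (2 / 27).
Proof.
(* The primitive x^3 (ln^2 x / 3 - 2 ln x / 9 + 2 / 27), through xlnx. *)
pose F := (3^-1 \*: ((id : R -> R) * (fun y : R => xlnx y ^+ 2))
  - (2 / 9) \*: ((fun y : R => y ^+ 2) * xlnx))
  + (2 / 27) \*: (fun y : R => y ^+ 3).
have FE (x : R) : F x = 3^-1 * (x * xlnx x ^+ 2) - (2 / 9) * (x ^+ 2 * xlnx x) + (2 / 27) * x ^+ 3.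
  by [].
have -> : 2 / 27 = F 1 - F 0 by rewrite !FE xlnx0 xlnx1; field.
have cF : continuous F.
  move=> x; apply: cvgD; first apply: cvgB; apply: cvgZr.
  - apply: cvgM; first exact: cvg_id.
    by apply: (@continuous_comp _ _ _ xlnx (fun y => y ^+ 2));
        [exact: continuous_xlnx|exact: exprn_continuous].
  - by apply: cvgM; [exact: exprn_continuous|exact: continuous_xlnx].
  - exact: exprn_continuous.
have dF (x : R) : x \in `]0, 1[%R -> is_derive x (1:R) F (xlnx x ^+ 2).
  rewrite in_itv/= => /andP[x0 _].
  have dx := is_derive_xlnx x0.
  have di := is_derive_id x (1:R).
  have dx2 := is_deriveX 2 dx.
  have dx2' : is_derive x (1:R) (fun y : R => xlnx y ^+ 2) _ := dx2.
  apply: (is_derive_eq (is_deriveD (is_deriveB (is_deriveZ 3^-1 (is_deriveM di dx2'))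
     (is_deriveZ (2/9) (is_deriveM (is_derive_exp x 2) dx)))
     (is_deriveZ (2/27) (is_derive_exp x 3)))).
  have E (l : R) : 3^-1 * (x * ((2 * (x * l)) * (l + 1)) + (x * l) ^+ 2 * 1)
     - 2 / 9 * (x ^+ 2 * (l + 1) + x * l * (2 * x)) + 2 / 27 * (3 * x ^+ 2) = (x * l) ^+ 2.
    by field.
  exact: (E (ln x)).
apply: has_int_FTC => //.
- apply: continuous_subspaceT => x.
  by apply: (@continuous_comp _ _ _ xlnx (fun y => y ^+ 2));
      [exact: continuous_xlnx|exact: exprn_continuous].
- exact: derivable_oo_LR_of_continuous dF cF.
- move=> x x01; rewrite derive1E.
  by case: (dF x x01) => _ ->.
Qed.

End EntropyFunction.

Section EntropyIntegrals.
Context {R : realType}.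
Implicit Types (f g : R -> R) (a b v w : R).
Local Notation leb := (@lebesgue_measure R).

Lemma has_int_unique f a b v w : has_int f a b v -> has_int f a b w -> v = w.
Proof. by move=> [_ <-] [_ <-]. Qed.

Lemma has_int_le f g a b v w : (forall x, a <= x < b -> f x <= g x) ->
  has_int f a b v -> has_int g a b w -> v <= w.
Proof.
move=> fg [i1 <-] [i2 <-]; apply: le_Rintegral => // x /=; rewrite in_itv/=; exact: fg.
Qed.

Lemma has_int_sum n (F : nat -> R -> R) (V : nat -> R) a b :
  (forall i, has_int (F i) a b (V i)) ->
  has_int (fun x => \sum_(i < n) F i x) a b (\sum_(i < n) V i).
Proof.
move=> FV; elim: n => [|n IH].
  rewrite big_ord0 -[0](mul0r (V 0)).
  apply: has_int_eq (has_int_scale 0 (FV 0)) => x _.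
  by rewrite big_ord0 !mul0r.
rewrite big_ord_recr/=; apply: has_int_eq (has_int_add IH (FV n)) => x _.
by rewrite big_ord_recr.
Qed.

Lemma continuous_onem f : continuous f -> continuous (fun x : R => f (1 - x)).
Proof.
move=> cf x; apply: (@continuous_comp _ _ _ (fun y : R => 1 - y) f); last exact: cf.
by apply: cvgB; [exact: cvg_cst|exact: cvg_id].
Qed.

Lemma has_int01_sym f v : continuous f -> has_int f 0 1 v -> has_int (fun x => f (1 - x)) 0 1 v.
Proof.
move=> cf fv.
have cf' : continuous (fun x : R => f (1 - x)).
  exact: continuous_onem.
have -> : v = \int[leb]_(x in `[0, 1]) f (1 - x).
  rewrite (has_int_unique fv (has_int_within_continuous (continuous_subspaceT cf))).
  rewrite Rintegration_by_substitution_onem ?lexx ?ler01//; last exact: continuous_subspaceT.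
  by rewrite unstable.onem1.
exact: has_int_within_continuous (continuous_subspaceT cf').
Qed.

Lemma has_int_Cfun : has_int (@Cfun R) 0 1 0.
Proof.
have h1 : has_int (@xlnx R) 0 1 (- (2%:R ^- 2)).
  by apply: has_int_eq (has_int_xlnx_expr 0) => x _; rewrite expr0 mul1r.
have h2 := has_int01_sym (@continuous_xlnx R) h1.
have := has_int_add (has_int_add (has_int_cst 1 ler01) (has_int_scale 2 h1)) (has_int_scale 2 h2).
rewrite (_ : _ + _ = 0); last by field.
by apply: has_int_eq => x _; rewrite CfunE.
Qed.

(** Opposite of the integral of x ln x times (1-x) times the truncated series of
    -ln (1-x): an approximation of the cross term in the square of C. *)
Definition cross_sum N : R := \sum_(i < N) i.+1%:R^-1 * (i.+3%:R ^- 2 - i.+4%:R ^- 2).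

Lemma has_int_xlnx_log_poly N :
  has_int (fun x => xlnx x * ((1 - x) * log_poly N x)) 0 1 (- cross_sum N).
Proof.
rewrite /cross_sum -sumrN.
apply: (has_int_eq (g := fun x => \sum_(i < N)
    i.+1%:R^-1 * (x ^+ i.+1 * xlnx x + (- 1) * (x ^+ i.+2 * xlnx x)))).
  move=> x _; rewrite /log_poly !mulr_sumr; apply: eq_bigr => i _.
  by rewrite (exprS x i.+1); ring.
apply: (@has_int_sum N (fun i x => i.+1%:R^-1 * (x ^+ i.+1 * xlnx x + (- 1) * (x ^+ i.+2 * xlnx x)))
  (fun i => - (i.+1%:R^-1 * (i.+3%:R ^- 2 - i.+4%:R ^- 2)))) => i.
rewrite -mulrN; apply: has_int_scale.
rewrite (_ : - (_ - _) = - i.+3%:R ^- 2 + -1 * - i.+4%:R ^- 2); last by ring.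
have := has_int_add (has_int_xlnx_expr i.+1) (has_int_scale (-1) (has_int_xlnx_expr i.+2)).
exact.
Qed.

Lemma cross_integral_approx v N :
  has_int (fun x => xlnx x * xlnx (1 - x)) 0 1 v -> `|v - cross_sum N| <= N.+1%:R^-1.
Proof.
move=> hv.
have h := has_int_add hv (has_int_xlnx_log_poly N).
have e x : 0 <= x < 1 -> `|xlnx x * xlnx (1 - x) + xlnx x * ((1 - x) * log_poly N x)| <= N.+1%:R^-1.
  move=> /andP[x0 x1]; rewrite -mulrDr normrM -[leRHS]mul1r.
  have x01 : 0 <= x <= 1 by rewrite x0 ltW.
  rewrite ler_pM// ?xlnx_bound//.
  have x01' : 0 <= 1 - x <= 1 by lra.
  by have := xlnx_poly_error N x01'; rewrite subKr.
have hc (k : R) : has_int (fun=> k) 0 1 k.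
  by have := has_int_cst k (ler01 : (0 : R) <= 1); rewrite subr0 mulr1.
rewrite ler_norml; apply/andP; split.
- by apply: (has_int_le _ (hc _) h) => x /e; rewrite ler_norml => /andP[].
- by apply: (has_int_le _ h (hc _)) => x /e; rewrite ler_norml => /andP[].
Qed.

Definition H2 N : R := \sum_(i < N) i.+1%:R ^- 2.

(** By partial fractions in k, the simple poles telescope and the double poles
    combine into -1/6 of the partial sum of zeta(2), up to the boundary terms. *)
Lemma cross_sumE N : cross_sum N = 37 / 108 - H2 N / 6
  - (1/4) * (N.+1%:R^-1 + N.+2%:R^-1) - (1/2) * (N.+1%:R ^- 2 + N.+2%:R ^- 2)
  + (1/9) * (N.+1%:R^-1 + N.+2%:R^-1 + N.+3%:R^-1)
  + (1/3) * (N.+1%:R ^- 2 + N.+2%:R ^- 2 + N.+3%:R ^- 2).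
Proof.
elim: N => [|N IH].
  by rewrite /cross_sum /H2 !big_ord0; field.
rewrite /cross_sum /H2 !big_ord_recr/= -/(cross_sum N) -/(H2 N) IH.
have N0 : 0 <= N%:R :> R by [].
rewrite -(natr1 N.+3) -(natr1 N.+2) -(natr1 N.+1) -(natr1 N).
move: (H2 N) (N%:R : R) N0 => h n n0; field.
by rewrite !gt_eqF//; lra.
Qed.

(** Expanding the square of C, only the term x ln x (1-x) ln (1-x) has no
    elementary integral; approximating it by [cross_sum] shows that 3 c is the
    limit 7 - 4 zeta(2). *)
Lemma int_Cfun_sqr_approx c N : has_int (fun x => Cfun x ^+ 2) 0 1 c ->
  `|3 * c - (7 - 4 * H2 N)| <= 100 / N.+1%:R.
Proof.
move=> hc.
have h1 : has_int (@xlnx R) 0 1 (- (2%:R ^- 2)).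
  by apply: has_int_eq (has_int_xlnx_expr 0) => x _; rewrite expr0 mul1r.
have h2 := has_int01_sym (@continuous_xlnx R) h1.
have c2 : continuous (fun x : R => xlnx x ^+ 2).
  move=> x; apply: (@continuous_comp _ _ _ xlnx (fun y => y ^+ 2)); last exact: exprn_continuous.
  exact: continuous_xlnx.
have h3 := has_int01_sym c2 has_int_xlnx_sqr.
have cc : continuous (fun x : R => xlnx x * xlnx (1 - x)).
  move=> x; apply: cvgM; first exact: continuous_xlnx.
  by apply: continuous_onem; exact: continuous_xlnx.
have h4 := has_int_within_continuous (@continuous_subspaceT _ _ `[(0:R), 1]%classic _ cc).
set v := Rintegral _ _ _ in h4.
have h0 : has_int (fun=> 1 : R) 0 1 1.
  by have := has_int_cst 1 (ler01 : (0 : R) <= 1); rewrite subr0 mulr1.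
have H := has_int_add (has_int_add (has_int_add (has_int_add (has_int_add h0
  (has_int_scale 4 h1)) (has_int_scale 4 h2)) (has_int_scale 4 has_int_xlnx_sqr))
  (has_int_scale 4 h3)) (has_int_scale 8 h4).
have cE : c = 1 + 4 * - 2%:R ^- 2 + 4 * - 2%:R ^- 2 + 4 * (2 / 27) + 4 * (2/27) + 8 * v.
  have := has_int_unique hc; apply.
  by apply: has_int_eq H => x _; rewrite CfunE; ring.
have := cross_integral_approx N h4; rewrite -/v cross_sumE cE.
have N0 : 0 <= N%:R :> R by [].
have b1 : 0 <= (N.+1%:R^-1 : R) <= 1
  by apply/andP; split; rewrite ?invr_ge0// invf_le1 ?ler1n ?ltr0n.
have b2 : 0 <= (N.+2%:R^-1 : R) <= N.+1%:R^-1
  by apply/andP; split; [rewrite invr_ge0|rewrite lef_pV2 ?posrE ?ltr0n// ler_nat; lia].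
have b3 : 0 <= (N.+3%:R^-1 : R) <= N.+1%:R^-1
  by apply/andP; split; [rewrite invr_ge0|rewrite lef_pV2 ?posrE ?ltr0n// ler_nat; lia].
rewrite -!exprVn; move: (N.+1%:R^-1 : R) (N.+2%:R^-1 : R) (N.+3%:R^-1 : R) b1 b2 b3 => x y z.
move=> /andP[x0 x1] /andP[y0 yx] /andP[z0 zx].
have xx : 0 <= x ^+ 2 <= x by rewrite exprn_ge0//= expr2 ler_piMl.
have yy : 0 <= y ^+ 2 <= x by rewrite exprn_ge0//= (le_trans _ yx)// expr2 ler_piMl// (le_trans yx).
have zz : 0 <= z ^+ 2 <= x by rewrite exprn_ge0//= (le_trans _ zx)// expr2 ler_piMl// (le_trans zx).
rewrite !ler_norml; move: (x ^+ 2) (y ^+ 2) (z ^+ 2) xx yy zz => a b d; lra.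
Qed.

End EntropyIntegrals.

(** * Profiles: gaps with depths *)
Section Profile.
Context {R : realType}.
Implicit Types (s : seq (nat * R)) (l r x : R) (b ds : seq nat).

(** A profile lists the gaps from left to right as pairs of a depth and a right
    end; the left end l of the first gap is kept outside, and each right end is
    the left end of the next gap. *)
Fixpoint insert s x : seq (nat * R) :=
  if s is (k, r) :: s' then
    if x < r then (k.+1, x) :: (k.+1, r) :: s' else (k, r) :: insert s' x
  else [::].

Definition wf l s : bool := path <=%R l (unzip2 s).
Definition right_end l s : R := last l (unzip2 s).

Fixpoint gapsum (g : nat -> R -> R -> R) l s : R :=
  if s is (k, r) :: s' then g k l r + gapsum g r s' else 0.

Fixpoint gapval (g : nat -> R -> R -> R -> R) l s x : R :=
  if s is (k, r) :: s' then if x < r then g k l r x else gapval g r s' x else 0.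

Lemma wf_cons l k r s : wf l ((k, r) :: s) = (l <= r) && wf r s.
Proof. by []. Qed.

Lemma wf_le_right_end l s : wf l s -> l <= right_end l s.
Proof.
elim: s l => [//|[k r] s IH] l; rewrite wf_cons => /andP[lr /IH].
exact: le_trans.
Qed.

Lemma insert_wf l s x : wf l s -> l <= x < right_end l s ->
  wf l (insert s x) /\ right_end l (insert s x) = right_end l s.
Proof.
elim: s l => [l _ /andP[lx xl]|[k r] s IH l]; first by have := le_lt_trans lx xl; rewrite ltxx.
rewrite wf_cons => /andP[lr ws] /andP[lx xe] /=; case: ltP => xr.
  by rewrite !wf_cons lx ltW.
have [|? ?] := IH r ws; first by rewrite xr.
by rewrite wf_cons lr.
Qed.

Lemma size_insert l s x : x < right_end l s -> l <= x -> size (insert s x) = (size s).+1.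
Proof.
elim: s l => [|[k r] s IH] l /= xe lx; first by rewrite ltNge lx in xe.
by case: ltP => //= xr; rewrite (IH r).
Qed.

(** A uniform point falls into each gap with the appropriate probability: the
    integral over all positions is the sum of the integrals over the gaps. *)
Lemma has_int_gapval (g : nat -> R -> R -> R -> R) G l s :
  (forall k l r, l <= r -> has_int (g k l r) l r (G k l r)) -> wf l s ->
  has_int (gapval g l s) l (right_end l s) (gapsum G l s).
Proof.
move=> gG; elim: s l => [|[k r] s IH] l; first by move=> _; exact: has_int_nil.
rewrite wf_cons => /andP[lr ws] /=.
apply: (has_int_split lr (wf_le_right_end ws)).
  by apply: has_int_eq (gG k l r lr) => x /andP[_ ->].
by apply: has_int_eq (IH r ws) => x /andP[rx _]; rewrite ltNge rx.
Qed.

Fixpoint insert_depth ds (i : nat) : seq nat :=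
  match ds, i with
  | k :: ds', 0%N => k.+1 :: k.+1 :: ds'
  | k :: ds', i'.+1 => k :: insert_depth ds' i'
  | [::], _ => [::]
  end.

(** Exponents that result when the i-th gap, split at a point carrying exponents
    b0 and b1 on its two sides, is integrated over that point. *)
Fixpoint merge_exps b (i : nat) : seq nat :=
  match b, i with
  | b0 :: b1 :: b', 0%N => (b0 + b1).+1 :: b'
  | b0 :: b', i'.+1 => b0 :: merge_exps b' i'
  | _, _ => [::]
  end.

Lemma size_insert_depth ds i : (i < size ds)%N -> size (insert_depth ds i) = (size ds).+1.
Proof. by elim: ds i => [//|k ds IH] [|i] //= ids; rewrite IH. Qed.

Lemma size_merge_exps b i : (i.+1 < size b)%N -> size (merge_exps b i) = (size b).-1.
Proof.
elim: b i => [//|b0 [|b1 b] IH] [|i] //= ib; rewrite IH //.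
Qed.

Lemma sumn_merge_exps b i : (i.+1 < size b)%N -> sumn (merge_exps b i) = (sumn b).+1.
Proof.
elim: b i => [//|b0 [|b1 b] IH] [|i] // ib; first by rewrite /= addSn addnA.
by rewrite [merge_exps _ _]/= [LHS]/= IH//= addnS.
Qed.

Lemma unzip1_insert l s x : l <= x < right_end l s ->
  exists2 i, (i < size s)%N & unzip1 (insert s x) = insert_depth (unzip1 s) i.
Proof.
elim: s l => [l /andP[lx xl]|[k r] s IH l]; first by have := le_lt_trans lx xl; rewrite ltxx.
move=> /andP[lx xe] /=; case: ltP => xr; first by exists 0%N.
have [|i ilt e] := IH r; first by rewrite xr.
by exists i.+1 => //=; rewrite e.
Qed.

(** Product of the powers of the gap lengths with exponents b. Dividing by the
    factorials removes the constant from the Beta integral. *)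
Fixpoint gap_monomial l s b : R :=
  match s, b with
  | (_, r) :: s', b0 :: b' => (r - l) ^+ b0 / b0`!%:R * gap_monomial r s' b'
  | _, _ => 1
  end.

Lemma has_int_beta (p q : nat) l r : l <= r ->
  has_int (fun x => (x - l) ^+ p / p`!%:R * ((r - x) ^+ q / q`!%:R)) l r
    ((r - l) ^+ (p + q).+1 / (p + q).+1`!%:R).
Proof.
rewrite le_eqVlt => /orP[/eqP<-|lr].
  by rewrite subrr expr0n mul0r; exact: has_int_nil.
have rl : 0 < r - l by rewrite subr_gt0.
pose g := XMonemX p q : R -> R.
have cg : continuous g by exact: continuous_XMonemX.
have := has_int_affine (ltW lr) cg.
have -> : \int[lebesgue_measure]_(x in `[0, 1]) g x = (p`! * q`!)%:R / (p + q).+1`!%:R.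
  by rewrite -beta_fun_fact /beta_fun -Rintegral_mkcond.
move=> /(has_int_scale ((r - l) ^+ (p + q) / p`!%:R / q`!%:R)).
have p0 : p`!%:R != 0 :> R by rewrite pnatr_eq0 -lt0n fact_gt0.
have q0 : q`!%:R != 0 :> R by rewrite pnatr_eq0 -lt0n fact_gt0.
have n0 : (p + q).+1`!%:R != 0 :> R by rewrite pnatr_eq0 -lt0n fact_gt0.
have -> : (r - l) ^+ (p + q) / p`!%:R / q`!%:R * ((r - l) * ((p`! * q`!)%:R / (p + q).+1`!%:R)) =
    (r - l) ^+ (p + q).+1 / (p + q).+1`!%:R.
  rewrite exprS natrM; set N := (p + q).+1`!%:R.
  move: p0 q0 n0; rewrite -/N; move: (p`!%:R : R) (q`!%:R : R) N => P Q N P0 Q0 N0.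
  by field; rewrite N0 Q0 P0.
apply: has_int_eq => x _.
rewrite /g /XMonemX /unstable.onem.
have -> : 1 - (x - l) / (r - l) = (r - x) / (r - l) by field; rewrite gt_eqF.
rewrite !expr_div_n exprD.
move: p0 q0; move: (p`!%:R : R) (q`!%:R : R) => P Q P0 Q0.
by field; rewrite P0 Q0 !expf_neq0 ?gt_eqF.
Qed.

(** Integrating over the position of an inserted key, weighted by a function of
    the resulting depths, reproduces an expression of the same kind. This
    recursion determines the joint law of depths and lengths. *)
Lemma has_int_gap_monomial h l s b : wf l s -> size b = (size s).+1 ->
  has_int (fun x => h (unzip1 (insert s x)) * gap_monomial l (insert s x) b) l (right_end l s)
    (\sum_(i < size s) h (insert_depth (unzip1 s) i) * gap_monomial l s (merge_exps b i)).
Proof.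
elim: s h l b => [|[k r] s IH] h l b; first by rewrite big_ord0 => _ _; exact: has_int_nil.
rewrite wf_cons => /andP[lr ws]; case: b => [//|b0 [//|b1 b]] [sb].
rewrite [size _]/= big_ord_recl.
apply: (has_int_split lr (wf_le_right_end ws)).
  have := has_int_scale (h (k.+1 :: k.+1 :: unzip1 s) * gap_monomial r s b) (has_int_beta b0 b1 lr).
  rewrite -mulrA [gap_monomial _ _ _ * _]mulrC.
  by apply: has_int_eq => x /andP[_ xr]; rewrite /= xr /=; ring.
have := has_int_scale ((r - l) ^+ b0 / b0`!%:R) (IH (fun ds => h (k :: ds)) r (b1 :: b) ws _).
rewrite /= sb => /(_ erefl).
rewrite mulr_sumr.
rewrite (_ : \sum_(i < size s) _ =
    \sum_(i < size s) h (insert_depth (unzip1 ((k, r) :: s)) (bump 0 i)) *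
        gap_monomial l ((k, r) :: s) (merge_exps (b0 :: b1 :: b) (bump 0 i))); last first.
  by apply: eq_bigr => i _; rewrite /bump/=; ring.
apply: has_int_eq => x /andP[rx _]; rewrite /= ltNge rx /=; ring.
Qed.

End Profile.

(** * Measurability and expectation *)
Section BoundedMeasurable.
Context {R : realType} {d : measure_display} {X : measurableType d}.
Implicit Types f g : X -> R.

Definition bddmeas f := measurable_fun setT f /\ exists c, forall w, `|f w| <= c.

Lemma bddmeas_cst k : bddmeas (fun=> k).
Proof. by split => //; exists `|k|. Qed.

Lemma bddmeasD f g : bddmeas f -> bddmeas g -> bddmeas (fun w => f w + g w).
Proof.
move=> [mf [c fc]] [mg [c' gc]]; split; first exact: measurable_funD.
by exists (c + c') => w; rewrite (le_trans (ler_normD _ _))// lerD.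
Qed.

Lemma bddmeasM f g : bddmeas f -> bddmeas g -> bddmeas (fun w => f w * g w).
Proof.
move=> [mf [c fc]] [mg [c' gc]]; split; first exact: measurable_funM.
by exists (c * c') => w; rewrite normrM ler_pM.
Qed.

Lemma bddmeasZ k f : bddmeas f -> bddmeas (fun w => k * f w).
Proof. exact/bddmeasM/bddmeas_cst. Qed.

Lemma bddmeasB f g : bddmeas f -> bddmeas g -> bddmeas (fun w => f w - g w).
Proof.
move=> bf bg; rewrite (_ : (fun _ => _) = fun w => f w + -1 * g w).
  exact/bddmeasD/bddmeasZ.
by apply/funext => w; rewrite mulN1r.
Qed.

Lemma bddmeas_sum n (F : nat -> X -> R) : (forall i, (i < n)%N -> bddmeas (F i)) ->
  bddmeas (fun w => \sum_(i < n) F i w).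
Proof.
elim: n => [|n IH] bF.
  by under eq_fun do rewrite big_ord0; exact: bddmeas_cst.
under eq_fun do rewrite big_ord_recr/=.
by apply: bddmeasD; [apply: IH => i ltin; apply: bF; exact: ltnW|exact: bF].
Qed.

Lemma bddmeasX f : bddmeas f -> bddmeas (fun w => f w ^+ 2).
Proof. by move=> bf; exact: bddmeasM. Qed.

End BoundedMeasurable.

Section MeasurableProfile.
Context {R : realType}.

(** Insertion branches on comparisons of keys, so a profile that depends on the
    outcome is assembled from measurable endpoints by finitely many measurable
    case distinctions; this is closed under insertion, and every structurally
    recursive functional of such a profile is measurable. *)
Inductive mprofile {d} {X : measurableType d} : (X -> seq (nat * R)) -> Prop :=
| mprofile_nil : mprofile (fun=> [::])
| mprofile_cons k (r : X -> R) s : measurable_fun setT r -> mprofile s ->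
    mprofile (fun w => (k, r w) :: s w)
| mprofile_if (p : X -> bool) s s' : measurable_fun setT p -> mprofile s -> mprofile s' ->
    mprofile (fun w => if p w then s w else s' w).

Context {d : measure_display} {X : measurableType d}.
Implicit Types (s : X -> seq (nat * R)) (l x : X -> R).

Lemma mprofile_comp d' (Y : measurableType d') (f : Y -> X) s :
  measurable_fun setT f -> mprofile s -> mprofile (s \o f).
Proof.
move=> mf; elim=> [|k r {}s mr _ IH|p {}s s' mp _ IH _ IH'].
- exact: mprofile_nil.
- exact: (mprofile_cons k (measurableT_comp mr mf) IH).
- exact: (mprofile_if (measurableT_comp mp mf) IH IH').
Qed.

Lemma mprofile_insert s x : mprofile s -> measurable_fun setT x ->
  mprofile (fun w => insert (s w) (x w)).
Proof.
move=> ms mx; elim: ms => [|k r {}s mr ms IH|p {}s s' mp _ IH _ IH'] /=.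
- exact: mprofile_nil.
- apply: mprofile_if; first exact: measurable_fun_ltr.
  + by do 2 apply: mprofile_cons => //.
  + exact: mprofile_cons.
- rewrite (_ : (fun _ => _) = fun w => if p w then insert (s w) (x w) else insert (s' w) (x w)).
    exact: mprofile_if.
  by apply/funext => w; case: (p w).
Qed.

Lemma measurable_gapsum (g : nat -> R -> R -> R) l s :
  (forall k, measurable_fun setT (fun z : R * R => g k z.1 z.2)) ->
  measurable_fun setT l -> mprofile s -> measurable_fun setT (fun w => gapsum g (l w) (s w)).
Proof.
move=> mg + ms; elim: ms l => [|k r {}s mr ms IH|p {}s s' mp _ IH _ IH'] l ml /=.
- exact: measurable_cst.
- apply: measurable_funD; last exact: IH.
  exact: (measurableT_comp (mg k) (measurable_fun_pair ml mr)).
- rewrite (_ : (fun _ => _) = fun w => if p w then gapsum g (l w) (s w) else gapsum g (l w) (s' w)).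
    by apply: measurable_fun_ifT; [exact: mp|exact: (IH l ml)|exact: (IH' l ml)].
  by apply/funext => w; case: (p w).
Qed.

Lemma measurable_gapval (g : nat -> R -> R -> R -> R) l s x :
  (forall k, measurable_fun setT (fun z : R * R * R => g k z.1.1 z.1.2 z.2)) ->
  measurable_fun setT l -> measurable_fun setT x -> mprofile s ->
  measurable_fun setT (fun w => gapval g (l w) (s w) (x w)).
Proof.
move=> mg + mx ms; elim: ms l => [|k r {}s mr ms IH|p {}s s' mp _ IH _ IH'] l ml /=.
- exact: measurable_cst.
- apply: measurable_fun_ifT; [exact: measurable_fun_ltr| |exact: IH].
  exact: (measurableT_comp (mg k) (measurable_fun_pair (measurable_fun_pair ml mr) mx)).
- rewrite (_ : (fun _ => _) = fun w => if p w then gapval g (l w) (s w) (x w)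
      else gapval g (l w) (s' w) (x w)).
    by apply: measurable_fun_ifT; [exact: mp|exact: (IH l ml)|exact: (IH' l ml)].
  by apply/funext => w; case: (p w).
Qed.

Lemma measurable_depths_gap_monomial (h : seq nat -> R) l s b :
  measurable_fun setT l -> mprofile s ->
  measurable_fun setT (fun w => h (unzip1 (s w)) * gap_monomial (l w) (s w) b).
Proof.
move=> + ms; elim: ms h l b => [|k r {}s mr ms IH|p {}s s' mp _ IH _ IH'] h l b ml /=.
- exact: measurable_cst.
- case: b => [|b0 b].
    under eq_fun do rewrite -(_ : gap_monomial 0 [::] [::] = 1)//.
    rewrite (_ : (fun _ => _) = fun w => h (k :: unzip1 (s w)) * gap_monomial (r w) (s w) [::]).
      exact: (IH (fun ds => h (k :: ds)) r [::] mr).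
    by apply/funext => w; case: (s w) => [|[]].
  rewrite (_ : (fun _ => _) = fun w => ((r w - l w) ^+ b0 / b0`!%:R) *
      (h (k :: unzip1 (s w)) * gap_monomial (r w) (s w) b)); last first.
    by apply/funext => w; ring.
  apply: measurable_funM; last exact: (IH (fun ds => h (k :: ds)) r b mr).
  apply: measurable_funM => //; apply: measurable_funX; exact: measurable_funB.
- rewrite (_ : (fun _ => _) = fun w => if p w then h (unzip1 (s w)) * gap_monomial (l w) (s w) b
     else h (unzip1 (s' w)) * gap_monomial (l w) (s' w) b).
    by apply: measurable_fun_ifT; [exact: mp|exact: (IH h l b ml)|exact: (IH' h l b ml)].
  by apply/funext => w; case: (p w).
Qed.

End MeasurableProfile.

Section Expectation.
Context {R : realType} {d : measure_display} {T : measurableType d}.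
Variable (P : probability T R).
Implicit Types f g : T -> R.

Definition mean f : R := \int[P]_w f w.

Lemma bddmeas_integrable f : bddmeas f -> P.-integrable setT (EFin \o f).
Proof.
move=> [mf [c fc]]; apply: measurable_bounded_integrable => //.
  by apply: (le_lt_trans (probability_le1 P measurableT)); exact: ltry.
exists c; split; first by rewrite num_real.
by move=> M cM w _ /=; rewrite (le_trans (fc w))// ltW.
Qed.

Lemma mean_EFin f : bddmeas f -> (mean f)%:E = (\int[P]_w (f w)%:E)%E.
Proof.
move=> bf; rewrite /mean /Rintegral fineK//.
by apply: integrable_fin_num => //; exact: bddmeas_integrable.
Qed.

Lemma eq_mean f g : (forall w, f w = g w) -> mean f = mean g.
Proof. by move=> fg; congr mean; apply/funext. Qed.

Lemma mean_cst k : mean (fun=> k) = k.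
Proof. by rewrite /mean Rintegral_cst// [X in fine X]probability_setT mulr1. Qed.

Lemma meanD f g : bddmeas f -> bddmeas g -> mean (fun w => f w + g w) = mean f + mean g.
Proof. by move=> /bddmeas_integrable ? /bddmeas_integrable ?; exact: RintegralD. Qed.

Lemma meanB f g : bddmeas f -> bddmeas g -> mean (fun w => f w - g w) = mean f - mean g.
Proof. by move=> /bddmeas_integrable ? /bddmeas_integrable ?; exact: RintegralB. Qed.

Lemma meanZ k f : bddmeas f -> mean (fun w => k * f w) = k * mean f.
Proof. by move=> /bddmeas_integrable ?; exact: RintegralZl. Qed.

Lemma mean_sum n (F : nat -> T -> R) : (forall i, (i < n)%N -> bddmeas (F i)) ->
  mean (fun w => \sum_(i < n) F i w) = \sum_(i < n) mean (F i).
Proof.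
elim: n => [|n IH] bF.
  by rewrite big_ord0 -[RHS](mean_cst 0); apply: eq_mean => w; rewrite big_ord0.
rewrite big_ord_recr/= -IH => [|i ltin]; last by apply: bF; exact: ltnW.
rewrite -meanD; [|by apply: bddmeas_sum => i ltin; apply: bF; exact: ltnW|exact: bF].
by apply: eq_mean => w; rewrite big_ord_recr.
Qed.

Lemma le_mean f g : bddmeas f -> bddmeas g -> (forall w, f w <= g w) -> mean f <= mean g.
Proof. by move=> /bddmeas_integrable ? /bddmeas_integrable ? fg; exact: le_Rintegral. Qed.

Lemma ae_eq_mean f g : measurable_fun setT f -> measurable_fun setT g ->
  {ae P, forall w, f w = g w} -> mean f = mean g.
Proof.
move=> mf mg fg; congr fine; apply: ae_eq_integral => //.
- exact/measurable_EFinP.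
- exact/measurable_EFinP.
- by apply: filterS fg => w -> _.
Qed.

Variables (U : nat -> {RV P >-> R}).
Hypothesis iid : iid_uniform01 U.

Lemma bddmeas_past n f : bddmeas (f : past U n -> R) -> bddmeas f.
Proof.
move=> [mf c]; split => //.
by move=> mT A mA; apply: (@past_measurable _ _ _ _ U n); exact: mf.
Qed.

(** Moving the null set of keys outside the half-open unit interval to 0 makes
    every statement about profiles hold at all outcomes, not just almost surely. *)
Definition half_open (x : R) : R := if 0 <= x < 1 then x else 0.

Lemma half_open01 x : 0 <= half_open x < 1.
Proof. by rewrite /half_open; case: ifPn => //; rewrite lexx ltr01. Qed.

Lemma measurable_half_open : measurable_fun setT half_open.
Proof.
apply: measurable_fun_ifT => //; apply: measurable_and.
- exact: measurable_fun_ler.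
- exact: measurable_fun_ltr.
Qed.

Definition key i w : R := half_open (U i w).

(** The next key, being uniform and independent of the past, can be integrated
    out; the integrals over its position may be computed outcome by outcome. *)
Lemma mean_last_key n (f : T -> R -> R) (V : T -> R) c :
  measurable_fun setT (fun z : past U n * R => f z.1 z.2) ->
  (forall w x, 0 <= x < 1 -> `|f w x| <= c) ->
  bddmeas V -> (forall w, has_int (f w) 0 1 (V w)) ->
  bddmeas (fun w => f w (key n w)) /\ mean (fun w => f w (key n w)) = mean V.
Proof.
move=> mf fc bV fV.
pose f' (z : past U n * R) := f z.1 (half_open z.2).
have mf' : measurable_fun setT f'.
  have : measurable_fun setT ((fun z : past U n * R => f z.1 z.2) \o
      (fun z : past U n * R => (z.1, half_open z.2))); last by [].
  apply: measurableT_comp => //; apply: measurable_fun_pair => //.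
  exact: (measurableT_comp measurable_half_open).
have mg : measurable_fun setT (fun w : T => ((w : past U n), U n w)).
  by apply: measurable_fun_pair; [exact: measurable_past_id|exact: measurable_funP].
have bf : bddmeas (fun w => f w (key n w)).
  split; last by exists c => w; apply: fc; exact: half_open01.
  have : measurable_fun setT (f' \o (fun w : T => ((w : past U n), U n w))).
    exact: measurableT_comp.
  by move=> h; exact: h.
(* Adding the bound c makes the integrand nonnegative, as Tonelli requires. *)
split => //; apply: (addIr c).
have addc g : bddmeas g -> mean g + c = mean (fun w => g w + c).
  by move=> bg; rewrite meanD ?mean_cst//; exact: bddmeas_cst.
rewrite !addc//.
apply: EFin_inj; rewrite !mean_EFin; [|by apply: bddmeasD => //; exact: bddmeas_cst..].
pose F z : \bar R := (f' z + c)%:E.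
transitivity (\int[P]_w F (w, U n w))%E; first by [].
rewrite ge0_integral_last_key//.
- apply: eq_integral => w _.
  have [i1 v1] : has_int (fun x => f' (w, x) + c) 0 1 (V w + c).
    have := has_int_add (fV w) (has_int_cst c (ler01 : (0:R) <= 1)).
    rewrite subr0 mulr1; apply: has_int_eq => x x01.
    by rewrite /f'/= /half_open x01.
  rewrite -integral_itv_bndo_bndc//.
    by rewrite -v1 /Rintegral fineK//; exact: integrable_fin_num.
  exact: measurable_int i1.
- by apply/measurable_EFinP; exact: measurable_funD.
- move=> z; rewrite /F lee_fin /f' addrC -lerBlDr sub0r lerNl.
  by have := fc z.1 _ (half_open01 z.2); rewrite ler_norml lerNl => /andP[].
Qed.

End Expectation.

(** * Moments of the depths *)
Section DepthAverage.
Context {R : realType}.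
Implicit Types (h : seq nat -> R) (ds : seq nat).

(** The mean of h over the depths after n insertions, when each of them chooses
    one of the present gaps uniformly: the permutation model of search trees. *)
Fixpoint depth_mean n h : R :=
  if n is m.+1 then m.+1%:R^-1 * \sum_(i < m.+1) depth_mean m (fun ds => h (insert_depth ds i))
  else h [:: 0%N].

Lemma eq_depth_mean n h h' : (forall ds, size ds = n.+1 -> h ds = h' ds) ->
    depth_mean n h = depth_mean n h'.
Proof.
elim: n h h' => [|n IH] h h' hh' /=; first exact: hh'.
congr (_ * _); apply: eq_bigr => i _; apply: IH => ds sds.
by apply: hh'; rewrite size_insert_depth sds.
Qed.

Lemma depth_meanD n h h' : depth_mean n (fun ds => h ds + h' ds) = depth_mean n h + depth_mean n h'.
Proof.
elim: n h h' => [//|n IH] h h' /=; rewrite (eq_bigr _ (fun i _ => IH _ _)).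
by rewrite big_split/= mulrDr.
Qed.

Lemma depth_meanZ n k h : depth_mean n (fun ds => k * h ds) = k * depth_mean n h.
Proof.
elim: n h => [//|n IH] h /=; rewrite (eq_bigr _ (fun i _ => IH _)).
by rewrite -mulr_sumr mulrCA.
Qed.

Lemma sum_ord_cst n (k : R) : \sum_(i < n) k = n%:R * k.
Proof. by rewrite sumr_const card_ord mulr_natl. Qed.

Lemma depth_mean_cst n k : depth_mean n (fun=> k) = k.
Proof.
elim: n => [//|n IH] /=; rewrite (eq_bigr (fun=> k)) => [|i _]; last exact: IH.
by rewrite sum_ord_cst mulrA mulVf ?mul1r// pnatr_eq0.
Qed.

Lemma depth_mean_sum n m (H : nat -> seq nat -> R) :
  depth_mean n (fun ds => \sum_(i < m) H i ds) = \sum_(i < m) depth_mean n (H i).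
Proof.
elim: m => [|m IH].
  by rewrite big_ord0 -[RHS](depth_mean_cst n 0); apply: eq_depth_mean => ds _; rewrite big_ord0.
rewrite big_ord_recr/= -IH -depth_meanD; apply: eq_depth_mean => ds _; by rewrite big_ord_recr.
Qed.

(** The form used for recurrences: the inner average is over the last insertion,
    given the depths before it. *)
Lemma depth_meanS n h : depth_mean n.+1 h =
    depth_mean n (fun ds => n.+1%:R^-1 * \sum_(i < n.+1) h (insert_depth ds i)).
Proof. by rewrite depth_meanZ (depth_mean_sum n n.+1 (fun i ds => h (insert_depth ds i))). Qed.

Definition dsum ds : R := (sumn ds)%:R.
Definition dsumsq ds : R := (sumn [seq k ^ 2 | k <- ds])%N%:R.

Lemma dsum_nth ds : \sum_(i < size ds) (nth 0%N ds i)%:R = dsum ds.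
Proof.
elim: ds => [|k ds IH]; first by rewrite big_ord0.
by rewrite /= big_ord_recl /dsum/= natrD; congr (_ + _).
Qed.

Lemma dsumsq_nth ds : \sum_(i < size ds) (nth 0%N ds i)%:R ^+ 2 = dsumsq ds.
Proof.
elim: ds => [|k ds IH]; first by rewrite big_ord0.
by rewrite /= big_ord_recl /dsumsq/= natrD natrX; congr (_ + _).
Qed.

Lemma dsum_insert_depth ds i : (i < size ds)%N ->
  dsum (insert_depth ds i) = dsum ds + (nth 0%N ds i)%:R + 2.
Proof.
rewrite /dsum; move=> lt; rewrite -natrD -(natrD _ _ 2); congr (_%:R).
by elim: ds i lt => [//|k ds IH] [|i] /= lt; [lia|rewrite IH//; lia].
Qed.

Lemma dsumsq_insert_depth ds i : (i < size ds)%N ->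
  dsumsq (insert_depth ds i) = dsumsq ds + (nth 0%N ds i)%:R ^+ 2 + 4 * (nth 0%N ds i)%:R + 2.
Proof.
rewrite /dsumsq; move=> lt; rewrite -natrX -natrM -!natrD; congr (_%:R).
by elim: ds i lt => [//|k ds IH] [|i] /= lt; [lia|rewrite IH//; lia].
Qed.

Definition H1 n : R := \sum_(i < n) i.+1%:R^-1.

Lemma H1S n : H1 n.+1 = H1 n + n.+1%:R^-1. Proof. by rewrite /H1 big_ord_recr. Qed.
Lemma H2S n : H2 n.+1 = H2 n + n.+1%:R ^- 2 :> R. Proof. by rewrite /H2 big_ord_recr. Qed.

Lemma depth_mean_dsum n : depth_mean n dsum = 2 * n.+1%:R * (H1 n.+1 - 1).
Proof.
elim: n => [|n IH]; first by rewrite /= /dsum /H1 big_ord1 invr1 subrr mulr0.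
rewrite depth_meanS (eq_depth_mean (h' := fun ds => (1 + n.+1%:R^-1) * dsum ds + 2)).
  rewrite depth_meanD depth_meanZ depth_mean_cst IH !H1S.
  have n0 : 0 <= n%:R :> R by [].
  rewrite -(natr1 n.+1) -(natr1 n).
  move: (n%:R : R) (H1 n) n0 => x a x0; field.
  by rewrite !gt_eqF//; lra.
move=> ds sds; rewrite -sds.
under eq_bigr => i _ do rewrite dsum_insert_depth//.
rewrite 2!big_split/= dsum_nth !sum_ord_cst.
have s0 : (size ds)%:R != 0 :> R by rewrite sds pnatr_eq0.
by move: s0; move: ((size ds)%:R : R) => m m0; field.
Qed.

Lemma depth_mean_dsumsq n :
  depth_mean n dsumsq = n.+1%:R * (4 * (H1 n.+1 ^+ 2 - H2 n.+1) - 6 * (H1 n.+1 - 1)).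
Proof.
elim: n => [|n IH].
  by rewrite /= /dsumsq /H1 /H2 !big_ord1/=; field.
rewrite depth_meanS (eq_depth_mean (h' :=
    fun ds => (1 + n.+1%:R^-1) * dsumsq ds + 4 * n.+1%:R^-1 * dsum ds + 2)).
  rewrite !depth_meanD !depth_meanZ depth_mean_cst IH depth_mean_dsum !H1S !H2S.
  have n0 : 0 <= n%:R :> R by [].
  rewrite -(natr1 n.+1) -(natr1 n).
  move: (n%:R : R) (H1 n) (H2 n) n0 => x a a2 x0; field.
  by rewrite !gt_eqF//; lra.
move=> ds sds; rewrite -sds.
under eq_bigr => i _ do rewrite dsumsq_insert_depth//.
rewrite 3!big_split/= dsumsq_nth -mulr_sumr dsum_nth !sum_ord_cst.
have s0 : (size ds)%:R != 0 :> R by rewrite sds pnatr_eq0.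
by move: s0; move: ((size ds)%:R : R) => m m0; field.
Qed.

(** The classical variance of the number of comparisons of QuickSort. *)
Definition qs_var n : R :=
  7 * n%:R ^+ 2 - 4 * n.+1%:R ^+ 2 * H2 n - 2 * n.+1%:R * H1 n + 13 * n%:R.

(** Choosing gap i raises the sum D of the depths by d_i + 2; averaging
    (D + d_i + 2)^2 over i involves only D^2, D and the sum of the d_i^2, which
    closes the recurrence. *)
Lemma depth_mean_dsum_sqr n : depth_mean n (fun ds => dsum ds ^+ 2) =
    (depth_mean n dsum) ^+ 2 + qs_var n.
Proof.
elim: n => [|n IH].
  by rewrite /= /dsum /qs_var /H1 /H2 !big_ord0/=; ring.
rewrite [LHS]depth_meanS (eq_depth_mean (h' := fun ds => (1 + 2 * n.+1%:R^-1) * dsum ds ^+ 2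
    + (4 + 4 * n.+1%:R^-1) * dsum ds + n.+1%:R^-1 * dsumsq ds + 4)).
  rewrite !depth_meanD !depth_meanZ depth_mean_cst IH depth_mean_dsumsq !depth_mean_dsum /qs_var
      !H1S !H2S.
  have n0 : 0 <= n%:R :> R by [].
  rewrite -(natr1 n.+1) -(natr1 n).
  move: (n%:R : R) (H1 n) (H2 n) n0 => x a a2 x0; field.
  by rewrite !gt_eqF//; lra.
move=> ds sds; rewrite -sds.
under eq_bigr => i _.
  rewrite dsum_insert_depth// (_ : _ ^+ 2 = (dsum ds ^+ 2 + 4 * dsum ds + 4) +
    (2 * dsum ds + 4) * (nth 0%N ds i)%:R + (nth 0%N ds i)%:R ^+ 2); last by ring.
  over.
rewrite 2!big_split/= dsumsq_nth -mulr_sumr dsum_nth !sum_ord_cst.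
have s0 : (size ds)%:R != 0 :> R by rewrite sds pnatr_eq0.
by move: s0; move: ((size ds)%:R : R) => m m0; field.
Qed.

End DepthAverage.

(** * The joint law of depths and gap lengths *)
Section Process.
Context {R : realType}.
Implicit Types (u : nat -> R) (s : seq (nat * R)) (h : seq nat -> R) (l : R) (b : seq nat).

Fixpoint gaps u n : seq (nat * R) :=
  if n is m.+1 then insert (gaps u m) (u m) else [:: (0%N, 1)].

Definition depths u n := unzip1 (gaps u n).

Definition in01 u := forall i, 0 <= u i < 1.

Lemma gaps_wf u n : in01 u -> wf 0 (gaps u n) /\ right_end 0 (gaps u n) = 1.
Proof.
move=> u01; elim: n => [|n [w e]]; first by rewrite /wf /right_end/= ler01.
have [|w' e'] := insert_wf (x := u n) w; first by rewrite e.
by rewrite [gaps _ _]/= e'.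
Qed.

Lemma size_gaps u n : in01 u -> size (gaps u n) = n.+1.
Proof.
move=> u01; elim: n => [//|n IH] /=; have [_ e] := gaps_wf n u01.
by rewrite (size_insert (l := 0)) ?IH// ?e; have /andP[] := u01 n.
Qed.

(** Only finitely many depth lists occur at a given time, so every function of
    the depth list is a bounded random variable. *)
Fixpoint reachable n : seq (seq nat) :=
  if n is m.+1 then [seq insert_depth ds i | ds <- reachable m, i <- iota 0 m.+1]
  else [:: [:: 0%N]].

Lemma depths_reachable u n : in01 u -> depths u n \in reachable n.
Proof.
move=> u01; elim: n => [//|n IH]; have [w e] := gaps_wf n u01.
rewrite /depths [gaps _ _]/=.
have [|i ilt ->] := unzip1_insert (l := 0) (s := gaps u n) (x := u n); first by rewrite e.
apply: allpairs_f => //; rewrite mem_iota add0n /=.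
by rewrite size_gaps in ilt.
Qed.

Lemma depths_bounded h n : exists c, forall u, in01 u -> `|h (depths u n)| <= c.
Proof.
exists (\sum_(ds <- reachable n) `|h ds|) => u u01.
by rewrite (big_rem _ (depths_reachable n u01)) lerDl sumr_ge0.
Qed.

Lemma eq_ler1 (x y : R) : x = y -> x <= y.
Proof. by move=> ->. Qed.

Lemma gap_monomial_bounds l s b : wf l s -> 0 <= l -> right_end l s <= 1 ->
    0 <= gap_monomial l s b <= 1.
Proof.
elim: s l b => [|[k r] s IH] l [|b0 b] //=; rewrite ?lexx ?ler01//.
rewrite wf_cons => /andP[lr ws] l0 e1.
have /andP[d0 d1] := IH r b ws (le_trans l0 lr) e1.
have r1 : r <= 1 := le_trans (wf_le_right_end ws) e1.
have f1 : 1 <= b0`!%:R :> R by rewrite ler1n fact_gt0.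
have f0 : 0 <= (r - l) ^+ b0 by rewrite exprn_ge0 ?subr_ge0.
apply/andP; split; first by rewrite mulr_ge0// divr_ge0.
rewrite mulr_ile1// ?divr_ge0// ler_pdivrMr ?(lt_le_trans ltr01)// mul1r.
by rewrite (le_trans _ f1)// exprn_ile1 ?subr_ge0//; lra.
Qed.

Lemma gap_monomial0 l s : gap_monomial l s (nseq (size s) 0%N) = 1.
Proof. by elim: s l => [//|[k r] s IH] l /=; rewrite IH expr0 fact0 divr1 mulr1. Qed.

Fixpoint gaplen l s i : R :=
  match s, i with
  | (_, r) :: s', 0%N => r - l
  | (_, r) :: s', i'.+1 => gaplen r s' i'
  | [::], _ => 0
  end.

Lemma gaplen_bounds l s i : wf l s -> 0 <= gaplen l s i <= right_end l s - l.
Proof.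
elim: s l i => [|[k r] s IH] l i; first by rewrite /right_end subrr lexx.
rewrite wf_cons => /andP[lr ws]; have re := wf_le_right_end ws.
have e : right_end l ((k, r) :: s) = right_end r s by [].
case: i => [|i] /=; rewrite e; first by apply/andP; split; lra.
by have /andP[g0 g1] := IH r i ws; apply/andP; split; lra.
Qed.

Lemma gapsum_sum (g : nat -> R -> R -> R) (f : nat -> R -> R) l s :
  (forall k a c, g k a c = f k (c - a)) ->
  gapsum g l s = \sum_(i < size s) f (nth 0%N (unzip1 s) i) (gaplen l s i).
Proof.
move=> gf; elim: s l => [|[k r] s IH] l; first by rewrite big_ord0.
by rewrite /= big_ord_recl IH gf.
Qed.

Fixpoint single_exp m i k : seq nat :=
  match m, i with
  | 0%N, _ => [::]
  | m'.+1, 0%N => k :: nseq m' 0%N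
  | m'.+1, i'.+1 => 0%N :: single_exp m' i' k
  end.

Lemma size_single_exp m i k : size (single_exp m i k) = m.
Proof. by elim: m i => [//|m IH] [|i] /=; rewrite ?size_nseq ?IH. Qed.

Lemma sumn_single_exp m i k : (i < m)%N -> sumn (single_exp m i k) = k.
Proof.
elim: m i => [//|m IH] [|i] /= lt; first by rewrite sumn_nseq mul0n addn0.
by rewrite IH.
Qed.

Lemma gap_monomial_single_exp l s i k : (i < size s)%N ->
  gap_monomial l s (single_exp (size s) i k) = gaplen l s i ^+ k / k`!%:R.
Proof.
elim: s l i => [//|[d r] s IH] l [|i] /= lt; first by rewrite gap_monomial0 mulr1.
by rewrite IH// expr0 fact0 divr1 mul1r.
Qed.

End Process.

Section ProcessLaw.
Context {R : realType} {d : measure_display} {T : measurableType d}.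
Variables (P : probability T R) (U : nat -> {RV P >-> R}).
Hypothesis iid : iid_uniform01 U.
Implicit Types (h : seq nat -> R) (b : seq nat).

Definition keys w i : R := key U i w.

Lemma keys01 w : in01 (keys w).
Proof. by move=> i; exact: half_open01. Qed.

Lemma measurable_key n i : (i < n)%N -> measurable_fun setT (fun w : past U n => keys w i).
Proof.
move=> ltin; have : measurable_fun setT (half_open \o (U i : past U n -> R)).
  by apply: measurableT_comp; [exact: measurable_half_open|exact: measurable_past_RV].
by move=> h; exact: h.
Qed.

Lemma mprofile_gaps n m : (m <= n)%N -> mprofile (fun w : past U n => gaps (keys w) m).
Proof.
elim: m => [_|m IH lt] /=.
  by apply: mprofile_cons => //; exact: mprofile_nil.
by apply: mprofile_insert; [apply: IH; exact: ltnW|exact: measurable_key].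
Qed.

Lemma mprofile_gaps_next n :
  mprofile (fun z : past U n * R => insert (gaps (keys z.1) n) z.2).
Proof.
apply: mprofile_insert; last exact: measurable_snd.
have m1 : measurable_fun setT (@fst (past U n) R) by exact: measurable_fst.
exact: (mprofile_comp m1 (mprofile_gaps (leqnn n))).
Qed.

Lemma bddmeas_depths_gap_monomial n m h b : (m <= n)%N ->
  bddmeas (fun w : past U n => h (depths (keys w) m) * gap_monomial 0 (gaps (keys w) m) b).
Proof.
move=> mn; split.
  by apply: measurable_depths_gap_monomial => //; exact: mprofile_gaps.
have [c hc] := depths_bounded h m; exists c => w.
have [wfp e] := gaps_wf m (keys01 w).
have /andP[d0 d1] := gap_monomial_bounds b wfp (lexx 0) (eq_ler1 e).
rewrite normrM (ger0_norm d0) -[leRHS]mulr1 ler_pM//.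
by apply: hc; exact: keys01.
Qed.

(** The depth list is independent of the gap lengths, which are jointly Dirichlet:
    integrating out the last key merges the exponents of the two gaps it
    creates, by the Beta integral, and averages h over the insertion point. *)
Lemma mean_depths_gap_monomial n h b : size b = n.+1 ->
  mean P (fun w => h (depths (keys w) n) * gap_monomial 0 (gaps (keys w) n) b) =
  depth_mean n h * (n`!%:R / (n + sumn b)`!%:R).
Proof.
elim: n h b => [|n IH] h b sb.
  case: b sb => [//|b0 [|//]] _.
  rewrite /= subr0 expr1n fact0 add0n addn0 mulr1 -[RHS](mean_cst P).
  by apply: eq_mean => w.
pose f w x := h (unzip1 (insert (gaps (keys w) n) x)) *
    gap_monomial 0 (insert (gaps (keys w) n) x) b.
pose V w := \sum_(i < n.+1) h (insert_depth (depths (keys w) n) i) *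
    gap_monomial 0 (gaps (keys w) n) (merge_exps b i).
pose Vi i w := h (insert_depth (depths (keys w) n) i) *
    gap_monomial 0 (gaps (keys w) n) (merge_exps b i).
have bVi i : bddmeas (Vi i).
  exact: (bddmeas_past (bddmeas_depths_gap_monomial (fun ds =>
      h (insert_depth ds i)) (merge_exps b i) (leqnn n))).
have [c hc] := depths_bounded h n.+1.
have [_ E] : bddmeas (fun w => f w (key U n w)) /\ mean P (fun w => f w (key U n w)) = mean P V.
  apply: (mean_last_key iid (c := c)).
  - have := measurable_depths_gap_monomial h b (measurable_cst (0 : R)) (mprofile_gaps_next n).
    by move=> H; exact: H.
  - move=> w x x01.
    (* Replacing the n-th key by x gives a sequence of keys with the wanted profile. *)
    pose u := fun i => if i == n then x else keys w i.
    have u01 : in01 u by move=> i; rewrite /u; case: ifP => _ //; exact: keys01.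
    have pu m : (m <= n)%N -> gaps u m = gaps (keys w) m.
      elim: m => [//|m IHm] mn /=; rewrite IHm ?(ltnW mn)// /u ltn_eqF//.
    have pn : gaps u n.+1 = insert (gaps (keys w) n) x by rewrite /= pu// /u eqxx.
    have [wfp e] := gaps_wf n.+1 u01.
    have /andP[d0 d1] := gap_monomial_bounds b wfp (lexx 0) (eq_ler1 e).
    rewrite /f -pn normrM (ger0_norm d0) -[leRHS]mulr1 ler_pM//.
    exact: hc.
  - exact: (@bddmeas_sum _ _ _ n.+1 Vi (fun i _ => bVi i)).
  - move=> w; have [wfp e] := gaps_wf n (keys01 w).
    have := has_int_gap_monomial h wfp (b := b).
    by rewrite size_gaps ?e//; [apply|exact: keys01].
rewrite [LHS]E (@mean_sum _ _ _ P n.+1 Vi); last by move=> i _; exact: bVi.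
rewrite (eq_bigr (fun i : 'I_n.+1 => depth_mean n (fun ds => h (insert_depth ds i)) *
    (n`!%:R / (n.+1 + sumn b)`!%:R))).
  rewrite -mulr_suml /= factS natrM.
  have n0 : n.+1%:R != 0 :> R by rewrite pnatr_eq0.
  have N0 : (n.+1 + sumn b)`!%:R != 0 :> R by rewrite pnatr_eq0 -lt0n fact_gt0.
  move: n0 N0; set x := n.+1%:R; set N := _`!%:R; set S := \sum_(i < _) _.
  by move: x N S (n`!%:R : R) => x N S m x0 N0; field; rewrite x0 N0.
move=> i _; have ib : (i.+1 < size b)%N by rewrite sb ltnS; exact: ltn_ord.
rewrite (IH (fun ds => h (insert_depth ds i))); last by rewrite size_merge_exps// sb.
by rewrite sumn_merge_exps// addnS addSn.
Qed.

End ProcessLaw.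

(** * Gap lengths weighted by functions of the depths *)
Lemma le0_of_le_divn {R : archiRealFieldType} (x c : R) :
  (forall N, x <= c / N.+1%:R) -> x <= 0.
Proof.
move=> xc; rewrite leNgt; apply/negP => x0.
have := xc (Num.truncn (c / x)).
by rewrite ler_pdivlMr ?ltr0n// mulrC -ler_pdivlMr// leNgt truncnS_gt.
Qed.

Section Martingale.
Context {R : realType} {d : measure_display} {T : measurableType d}.
Variables (P : probability T R) (U : nat -> {RV P >-> R}).
Hypothesis iid : iid_uniform01 U.
Implicit Types (h : seq nat -> R) (n J : nat).
Local Notation key := (keys U).
Local Notation E := (mean P).

Lemma measurable_invr : measurable_fun setT (@GRing.inv R).
Proof.
rewrite (_ : GRing.inv = fun x : R => if 0 < x then expR (- ln x)
    else if x < 0 then - expR (- ln (- x)) else 0); last first.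
  apply/funext => x; case: ltgtP => [x0|x0|<-]; last by rewrite invr0.
  - by rewrite expRN lnK// posrE.
  - by rewrite expRN lnK ?posrE ?oppr_gt0// invrN opprK.
have mexp : measurable_fun setT (@expR R) by exact: measurable_expR.
have mln : measurable_fun setT (@ln R) by exact: measurable_ln.
have mN : measurable_fun setT (-%R : R -> R) by exact: oppr_measurable.
apply: measurable_fun_ifT; first exact: measurable_fun_ltr.
  exact: (measurableT_comp mexp (measurableT_comp mN mln)).
apply: measurable_fun_ifT; first exact: measurable_fun_ltr; last exact: measurable_cst.
exact: (measurableT_comp mN (measurableT_comp mexp
    (measurableT_comp mN (measurableT_comp mln mN)))).
Qed.

Lemma measurable_Cfun : measurable_fun setT (@Cfun R).
Proof. exact: continuous_measurable_fun continuous_Cfun. Qed.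

Lemma measurable_xlnx : measurable_fun setT (@xlnx R).
Proof. exact: continuous_measurable_fun continuous_xlnx. Qed.

Lemma bddmeas_depths n m h : (m <= n)%N -> bddmeas (fun w : past U n => h (depths (key w) m)).
Proof.
move=> mn; have := bddmeas_depths_gap_monomial U h [::] mn.
rewrite (_ : (fun _ => _) = fun w : past U n => h (depths (key w) m))//.
by apply/funext => w; case: (gaps (key w) m) => [|[? ?] ?] /=; rewrite mulr1.
Qed.

Lemma mean_depths n h : E (fun w => h (depths (key w) n)) = depth_mean n h.
Proof.
have := mean_depths_gap_monomial iid h (n := n) (size_nseq n.+1 0%N).
rewrite sumn_nseq mul0n addn0 divff ?pnatr_eq0 -?lt0n ?fact_gt0// mulr1 => <-.
apply: eq_mean => w; rewrite -[in RHS](size_gaps n (keys01 U w)).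
by rewrite gap_monomial0 mulr1.
Qed.

Lemma gaplen_gap_monomial n i k w : (i < n.+1)%N ->
  gaplen 0 (gaps (key w) n) i ^+ k =
  k`!%:R * gap_monomial 0 (gaps (key w) n) (single_exp n.+1 i k).
Proof.
move=> ilt; have sz := size_gaps n (keys01 U w).
by rewrite -[X in single_exp X]sz gap_monomial_single_exp ?sz// mulrCA divff ?mulr1.
Qed.

Lemma bddmeas_depths_gaplen n m h i k : (m <= n)%N -> (i < m.+1)%N ->
  bddmeas (fun w : past U n => h (depths (key w) m) * gaplen 0 (gaps (key w) m) i ^+ k).
Proof.
move=> mn ilt.
have := bddmeasZ k`!%:R (bddmeas_depths_gap_monomial U h (single_exp m.+1 i k) mn).
rewrite (_ : (fun _ => _) = fun w : past U n =>
  h (depths (key w) m) * gaplen 0 (gaps (key w) m) i ^+ k)//.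
by apply/funext => w; rewrite gaplen_gap_monomial// mulrCA.
Qed.

Lemma mean_depths_gaplen n h i k : (i < n.+1)%N ->
  E (fun w => h (depths (key w) n) * gaplen 0 (gaps (key w) n) i ^+ k) =
  depth_mean n h * (k`!%:R * n`!%:R / (n + k)`!%:R).
Proof.
move=> ilt; rewrite -mulrA mulrCA.
rewrite -[X in (n + X)%N](sumn_single_exp (m := n.+1) (i := i) k ilt).
rewrite -(mean_depths_gap_monomial iid); last exact: size_single_exp.
rewrite -meanZ; last exact: (bddmeas_past (bddmeas_depths_gap_monomial U _ _ (leqnn n))).
by apply: eq_mean => w; rewrite gaplen_gap_monomial// mulrCA.
Qed.

Lemma bddmeas_gapsum n m (g : nat -> R -> R -> R) c : (m <= n)%N ->
  (forall k, measurable_fun setT (fun z : R * R => g k z.1 z.2)) ->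
  (forall w, `|gapsum g 0 (gaps (key w) m)| <= c) ->
  bddmeas (fun w : past U n => gapsum g 0 (gaps (key w) m)).
Proof.
move=> mn mg gc; split; last by exists c.
by apply: measurable_gapsum => //; exact: mprofile_gaps.
Qed.

(** Each gap has mean length 1/(n+1), independently of the depths. *)
Lemma mean_dsum_weighted n h :
  bddmeas (fun w => h (depths (key w) n) *
      gapsum (fun k a c => k%:R * (c - a)) 0 (gaps (key w) n)) /\
  E (fun w => h (depths (key w) n) *
      gapsum (fun k a c => k%:R * (c - a)) 0 (gaps (key w) n))
  = depth_mean n (fun ds => h ds * dsum ds) / n.+1%:R.
Proof.
pose F i w := h (depths (key w) n) * (nth 0%N (depths (key w) n) i)%:R
   * gaplen 0 (gaps (key w) n) i ^+ 1.
have -> : (fun w => h (depths (key w) n) *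
      gapsum (fun k a c => k%:R * (c - a)) 0 (gaps (key w) n))
    = (fun w => \sum_(i < n.+1) F i w).
  apply/funext => w.
  rewrite (gapsum_sum (f := fun k x => k%:R * x))// size_gaps; last exact: keys01.
  by rewrite mulr_sumr; apply: eq_bigr => i _; rewrite /F expr1 mulrA.
have bF i : (i < n.+1)%N -> bddmeas (F i).
  move=> ilt; apply: (@bddmeas_past _ _ _ _ U n).
  exact: (bddmeas_depths_gaplen (fun ds => h ds * (nth 0%N ds i)%:R) 1 (leqnn n) ilt).
split; first exact: (@bddmeas_sum _ _ _ n.+1 F).
rewrite (@mean_sum _ _ _ P n.+1 F)//.
rewrite (eq_bigr (fun i : 'I_n.+1 => depth_mean n (fun ds => h ds * (nth 0%N ds i)%:R) *
    n.+1%:R^-1)).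
  rewrite -mulr_suml -(depth_mean_sum n n.+1 (fun i ds => h ds * (nth 0%N ds i)%:R)).
  by congr (_ / _); apply: eq_depth_mean => ds sds; rewrite -mulr_sumr -sds dsum_nth.
move=> i _.
rewrite (mean_depths_gaplen (fun ds => h ds * (nth 0%N ds i)%:R) 1 (ltn_ord i)).
have n0 : n`!%:R != 0 :> R by rewrite pnatr_eq0 -lt0n fact_gt0.
have n1 : n.+1%:R != 0 :> R by rewrite pnatr_eq0.
rewrite (_ : 1`!%:R = 1 :> R)// addn1 factS natrM; move: n0 n1.
by move: (n`!%:R : R) (n.+1%:R : R) => f x f0 x0; congr (_ * _); field; rewrite f0 x0.
Qed.

(** The third moment of each of the n+1 gaps is 3! n!/(n+3)!. *)
Lemma mean_gap_cubes n :
  E (fun w => gapsum (fun _ a c => (c - a) ^+ 3) 0 (gaps (key w) n)) =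
  6 / (n.+2%:R * n.+3%:R).
Proof.
pose F i w := (1 : R) * gaplen 0 (gaps (key w) n) i ^+ 3.
transitivity (E (fun w => \sum_(i < n.+1) F i w)).
  apply: eq_mean => w.
  rewrite (gapsum_sum (f := fun _ x => x ^+ 3))// size_gaps; last exact: keys01.
  by apply: eq_bigr => i _; rewrite /F mul1r.
rewrite (@mean_sum _ _ _ P n.+1 F); last first.
  move=> i ilt; apply: (@bddmeas_past _ _ _ _ U n).
  exact: (bddmeas_depths_gaplen (fun=> 1) 3 (leqnn n) ilt).
rewrite (eq_bigr (fun=> 6 * n`!%:R / (n + 3)`!%:R)); last first.
  by move=> i _; rewrite (mean_depths_gaplen (fun=> 1) 3 (ltn_ord i)) depth_mean_cst mul1r.
rewrite sum_ord_cst addn3 !factS !natrM.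
have n0 : n`!%:R != 0 :> R by rewrite pnatr_eq0 -lt0n fact_gt0.
have n1 : n.+1%:R != 0 :> R by rewrite pnatr_eq0.
have n2 : n.+2%:R != 0 :> R by rewrite pnatr_eq0.
have n3 : n.+3%:R != 0 :> R by rewrite pnatr_eq0.
move: n0 n1 n2 n3; move: (n`!%:R : R) (n.+1%:R : R) (n.+2%:R : R) (n.+3%:R : R).
by move=> f x y z f0 x0 y0 z0; field; rewrite f0 x0 y0 z0.
Qed.

Lemma gaplen01 n i w : 0 <= gaplen 0 (gaps (key w) n) i <= 1.
Proof.
have [wfp e] := gaps_wf n (keys01 U w).
by have := gaplen_bounds i wfp; rewrite e subr0.
Qed.

(** Given the depths, the gap lengths have a fixed law, so a centred function of
    the depths is orthogonal to every polynomial in a gap length. This form is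
    adapted to the series of ln around 1. *)
Lemma mean_depths_poly n h i a m : (i < n.+1)%N -> depth_mean n h = 0 ->
  E (fun w => h (depths (key w) n) *
     (gaplen 0 (gaps (key w) n) i ^+ a * (1 - gaplen 0 (gaps (key w) n) i) ^+ m)) = 0 /\
  bddmeas (fun w => h (depths (key w) n) *
     (gaplen 0 (gaps (key w) n) i ^+ a * (1 - gaplen 0 (gaps (key w) n) i) ^+ m)).
Proof.
move=> ilt h0; elim: m a => [|m IH] a.
  have e : (fun w => h (depths (key w) n) * (gaplen 0 (gaps (key w) n) i ^+ a *
      (1 - gaplen 0 (gaps (key w) n) i) ^+ 0)) =
      (fun w => h (depths (key w) n) * gaplen 0 (gaps (key w) n) i ^+ a).
    by apply/funext => w; rewrite expr0 mulr1.
  rewrite e mean_depths_gaplen// h0 mul0r; split => //.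
  exact: (bddmeas_past (bddmeas_depths_gaplen h a (leqnn n) ilt)).
have [e1 b1] := IH a; have [e2 b2] := IH a.+1.
have e : (fun w => h (depths (key w) n) * (gaplen 0 (gaps (key w) n) i ^+ a *
    (1 - gaplen 0 (gaps (key w) n) i) ^+ m.+1)) =
    (fun w => h (depths (key w) n) * (gaplen 0 (gaps (key w) n) i ^+ a *
    (1 - gaplen 0 (gaps (key w) n) i) ^+ m) -
    h (depths (key w) n) * (gaplen 0 (gaps (key w) n) i ^+ a.+1 *
    (1 - gaplen 0 (gaps (key w) n) i) ^+ m)).
  by apply/funext => w; rewrite !exprS; ring.
by rewrite e meanB// e1 e2 subr0; split => //; exact: bddmeasB.
Qed.

(** Polynomials approximate x ln x uniformly, so orthogonality to them implies
    orthogonality to the entropy of a gap. *)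
Lemma mean_depths_xlnx n h i : (i < n.+1)%N -> depth_mean n h = 0 ->
  bddmeas (fun w => h (depths (key w) n) * xlnx (gaplen 0 (gaps (key w) n) i)) /\
  E (fun w => h (depths (key w) n) * xlnx (gaplen 0 (gaps (key w) n) i)) = 0.
Proof.
move=> ilt h0.
have [c hc] := depths_bounded h n.
have mg : measurable_fun setT (fun w => gaplen 0 (gaps (key w) n) i : R).
  have [+ _] := bddmeas_past (bddmeas_depths_gaplen (fun=> 1) 1 (leqnn n) ilt).
  by under eq_fun do rewrite mul1r expr1.
have bx : bddmeas (fun w => h (depths (key w) n) * xlnx (gaplen 0 (gaps (key w) n) i)).
  split.
    apply: measurable_funM.
      by have [] := bddmeas_past (bddmeas_depths h (leqnn n)).
    exact: (measurableT_comp measurable_xlnx mg).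
  exists c => w; rewrite normrM -[leRHS]mulr1 ler_pM// ?hc ?xlnx_bound ?gaplen01//.
  exact: keys01.
split => //.
pose Q N w := h (depths (key w) n) *
  (gaplen 0 (gaps (key w) n) i * log_poly N (1 - gaplen 0 (gaps (key w) n) i)).
have Q0 N : E (Q N) = 0 /\ bddmeas (Q N).
  pose F j w := j.+1%:R^-1 * (h (depths (key w) n) * (gaplen 0 (gaps (key w) n) i ^+ 1 *
      (1 - gaplen 0 (gaps (key w) n) i) ^+ j.+1)).
  have e : Q N = (fun w => \sum_(j < N) F j w).
    apply/funext => w; rewrite /Q /log_poly !mulr_sumr; apply: eq_bigr => j _.
    by rewrite /F expr1; ring.
  have bF j : bddmeas (F j) by apply: bddmeasZ; have [] := mean_depths_poly 1 j.+1 ilt h0.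
  rewrite e (@mean_sum _ _ _ P N F)//; split;
      last exact: (@bddmeas_sum _ _ _ N F (fun j _ => bF j)).
  rewrite big1// => j _; have [e1 b1] := mean_depths_poly 1 j.+1 ilt h0.
  by rewrite meanZ// e1 mulr0.
have c0 : 0 <= c.
  by apply: le_trans (hc (fun=> 0) _) => // j; rewrite lexx ltr01.
have bnd N : `|E (fun w => h (depths (key w) n) * xlnx (gaplen 0 (gaps (key w) n) i))| <=
    c / N.+1%:R.
  have [e1 b1] := Q0 N.
  have eE : E (fun w => h (depths (key w) n) * xlnx (gaplen 0 (gaps (key w) n) i)) =
      E (fun w => h (depths (key w) n) * xlnx (gaplen 0 (gaps (key w) n) i) + Q N w).
    by rewrite meanD// e1 addr0.
  have err w : `|h (depths (key w) n) * xlnx (gaplen 0 (gaps (key w) n) i) + Q N w| <= c / N.+1%:R.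
    rewrite /Q -mulrDr normrM ler_pM// ?hc//; first exact: keys01.
    exact/xlnx_poly_error/gaplen01.
  have bs := bddmeasD bx b1.
  rewrite eE ler_norml; apply/andP; split.
    rewrite -[leLHS](mean_cst P); apply: le_mean => //; first exact: bddmeas_cst.
    by move=> w; have := err w; rewrite ler_norml => /andP[].
  rewrite -[leRHS](mean_cst P); apply: le_mean => //; first exact: bddmeas_cst.
  by move=> w; have := err w; rewrite ler_norml => /andP[].
by apply/eqP; rewrite -normr_le0; exact: (le0_of_le_divn bnd).
Qed.

End Martingale.

(** * Orthogonality of the increments *)
Section Increments.
Context {R : realType}.
Implicit Types (s : seq (nat * R)) (l x a c : R) (u : nat -> R) (J n k : nat).

(** The value of G at a node that receives the key x and whose interval runs
    from a to c. *)
Definition gap_G a c x : R := (c - a) * Cfun ((x - a) / (c - a)).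

Definition gap_G_below J k a c x : R := if (k < J)%N then gap_G a c x else 0.

Definition C_sqr : R := \int[lebesgue_measure]_(x in `[0, 1]) (Cfun x ^+ 2).

Lemma continuous_Cfun_sqr : continuous (fun x : R => Cfun x ^+ 2).
Proof.
move=> x; apply: (@continuous_comp _ _ _ (@Cfun R) (fun y => y ^+ 2)).
  exact: continuous_Cfun.
exact: exprn_continuous.
Qed.

Lemma has_int_C_sqr : has_int (fun x => Cfun x ^+ 2) 0 1 C_sqr.
Proof. exact: has_int_within_continuous (continuous_subspaceT continuous_Cfun_sqr). Qed.

Lemma C_sqr_ge0 : 0 <= C_sqr.
Proof. by apply: Rintegral_ge0 => x _; exact: sqr_ge0. Qed.

Lemma int01_Cfun : \int[lebesgue_measure]_(x in `[0, 1]) Cfun x = 0 :> R.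
Proof.
exact: has_int_unique (has_int_within_continuous (continuous_subspaceT (@continuous_Cfun R)))
  has_int_Cfun.
Qed.

Lemma has_int_gap_G_below J k a c : a <= c -> has_int (gap_G_below J k a c) a c 0.
Proof.
move=> ac; rewrite /gap_G_below; case: (k < J)%N.
  have := has_int_scale (c - a) (has_int_affine ac (@continuous_Cfun R)).
  by rewrite int01_Cfun !mulr0.
by have := has_int_cst 0 ac; rewrite mul0r.
Qed.

Definition cube_below J k a c : R := if (k < J)%N then (c - a) ^+ 3 else 0.

Lemma has_int_gap_G_below_sqr J k a c : a <= c ->
  has_int (fun x => gap_G_below J k a c x ^+ 2) a c (C_sqr * cube_below J k a c).
Proof.
move=> ac; rewrite /gap_G_below /cube_below; case: (k < J)%N.
  have := has_int_scale ((c - a) ^+ 2) (has_int_affine ac continuous_Cfun_sqr).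
  rewrite mulrA -/C_sqr mulrC -exprSr.
  by apply: has_int_eq => x _; rewrite /gap_G exprMn.
by rewrite mulr0 expr0n; have := has_int_cst 0 ac; rewrite mul0r.
Qed.

Lemma gap_G_bound a c x : a <= x <= c -> `|gap_G a c x| <= 5 * (c - a).
Proof.
move=> /andP[ax xc]; have := le_trans ax xc; rewrite le_eqVlt => /orP[/eqP<-|ac].
  by rewrite /gap_G subrr mul0r normr0 mulr0.
have ca : 0 < c - a by lra.
rewrite /gap_G normrM (gtr0_norm ca) mulrC ler_wpM2r ?(ltW ca)// Cfun_bound//.
rewrite divr_ge0 ?(ltW ca)//=; last by lra.
by rewrite ler_pdivrMr// mul1r; lra.
Qed.

Lemma gapval_bound (g : nat -> R -> R -> R -> R) B l s x :
  0 <= B -> (forall k a c, a <= x < c -> `|g k a c x| <= B * (c - a)) ->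
  wf l s -> l <= x -> `|gapval g l s x| <= B * (right_end l s - l).
Proof.
move=> B0 gB; elim: s l => [|[k r] s IH] l; first by rewrite /= normr0 subrr mulr0.
rewrite wf_cons => /andP[lr ws] lx; have re := wf_le_right_end ws.
have -> : right_end l ((k, r) :: s) = right_end r s by [].
rewrite /=; case: ltP => xr.
  rewrite (le_trans (gB k l r _)) ?lx// ler_wpM2l//; lra.
rewrite (le_trans (IH r ws xr))// ler_wpM2l//; lra.
Qed.

Lemma gapval_sqr (g : nat -> R -> R -> R -> R) l s x :
  gapval g l s x ^+ 2 = gapval (fun k a c y => g k a c y ^+ 2) l s x.
Proof.
by elim: s l => [|[k r] s IH] l /=; [rewrite expr0n|case: ifP].
Qed.

Lemma gapsumZ K (g : nat -> R -> R -> R) l s :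
  gapsum (fun k a c => K * g k a c) l s = K * gapsum g l s.
Proof. by elim: s l => [|[k r] s IH] l /=; rewrite ?mulr0// IH mulrDr. Qed.

Lemma gapsumD (g g' : nat -> R -> R -> R) l s :
  gapsum (fun k a c => g k a c + g' k a c) l s = gapsum g l s + gapsum g' l s.
Proof. by elim: s l => [|[k r] s IH] l /=; rewrite ?addr0// IH addrACA. Qed.

Lemma gapsum0 l s : gapsum (fun _ _ _ => 0) l s = 0.
Proof. by elim: s l => [//|[k r] s IH] l /=; rewrite IH addr0. Qed.

Lemma gapsum_ge0 (g : nat -> R -> R -> R) l s :
  (forall k a c, a <= c -> 0 <= g k a c) -> wf l s -> 0 <= gapsum g l s.
Proof.
move=> g0; elim: s l => [//|[k r] s IH] l; rewrite wf_cons => /andP[lr ws] /=.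
by rewrite addr_ge0 ?g0 ?IH.
Qed.

Lemma le_gapsum (g g' : nat -> R -> R -> R) l s :
  (forall k a c, a <= c -> g k a c <= g' k a c) -> wf l s -> gapsum g l s <= gapsum g' l s.
Proof.
move=> gg; elim: s l => [//|[k r] s IH] l; rewrite wf_cons => /andP[lr ws] /=.
by rewrite lerD ?gg ?IH.
Qed.

(** After n insertions all depths are at most n, so that up to time J truncation
    at level J has no effect. *)
Lemma eq_gapsum_below J (g g' : nat -> R -> R -> R) l s :
  (forall k a c, (k < J)%N -> g k a c = g' k a c) -> all (fun k => k < J)%N (unzip1 s) ->
  gapsum g l s = gapsum g' l s.
Proof.
by move=> gg; elim: s l => [//|[k r] s IH] l /= /andP[kJ aJ]; rewrite gg// IH.
Qed.

Lemma eq_gapval_below J (g g' : nat -> R -> R -> R -> R) l s x :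
  (forall k a c, (k < J)%N -> g k a c x = g' k a c x) -> all (fun k => k < J)%N (unzip1 s) ->
  gapval g l s x = gapval g' l s x.
Proof.
by move=> gg; elim: s l => [//|[k r] s IH] l /= /andP[kJ aJ]; rewrite gg// IH.
Qed.

Lemma all_depths_le u n : all (fun k => k < n.+1)%N (depths u n).
Proof.
elim: n => [//|n]; rewrite /depths /=.
elim: (gaps u n) => [//|[k r] s IH] /= /andP[kn sn].
case: ifP => _ /=; first by rewrite !(ltnS k.+1) kn /=; apply: sub_all sn => j; exact: ltnW.
by rewrite IH// (ltn_trans kn).
Qed.

(** Summed over the gaps, this is the sum of G over all keys inserted so far: the
    two logarithmic terms of C turn the entropy of a gap into those of its two
    parts, and the constant term 1 raises both depths by one. *)
Definition gap_pot k a c : R := k%:R * (c - a) + 2 * xlnx (c - a).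

Lemma xlnx_scale x a : 0 <= x -> 0 < a -> a * xlnx (x / a) = xlnx x - x * ln a.
Proof.
rewrite le_eqVlt => /orP[/eqP<- _|x0 a0]; first by rewrite mul0r xlnx0 mulr0 mul0r subrr.
rewrite /xlnx ln_div ?posrE// mulrA mulrCA divff ?gt_eqF// mulr1; ring.
Qed.

Lemma gap_pot_split k a c x : a <= x < c ->
  gap_pot k.+1 a x + gap_pot k.+1 x c = gap_pot k a c + gap_G a c x.
Proof.
move=> /andP[ax xc]; have ca : 0 < c - a by lra.
rewrite /gap_pot /gap_G CfunE.
have -> : 1 - (x - a) / (c - a) = (c - x) / (c - a) by field; rewrite gt_eqF.
have e1 : (c - a) * xlnx ((x - a) / (c - a)) = xlnx (x - a) - (x - a) * ln (c - a).
  by apply: xlnx_scale => //; lra.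
have e2 : (c - a) * xlnx ((c - x) / (c - a)) = xlnx (c - x) - (c - x) * ln (c - a).
  by apply: xlnx_scale => //; lra.
rewrite (_ : (c - a) * (1 + _ + _) = (c - a) + 2 * ((c - a) * xlnx ((x - a) / (c - a)))
  + 2 * ((c - a) * xlnx ((c - x) / (c - a)))); last by ring.
rewrite e1 e2 -[k.+1%:R]natr1 [xlnx (c - a)]/xlnx; ring.
Qed.

Lemma gap_pot_insert l s x : wf l s -> l <= x < right_end l s ->
  gapsum gap_pot l (insert s x) = gapsum gap_pot l s + gapval (fun _ => gap_G) l s x.
Proof.
elim: s l => [|[k r] s IH] l; first by
  move=> _ /andP[lx xl]; have := le_lt_trans lx xl; rewrite ltxx.
rewrite wf_cons => /andP[lr ws] /andP[lx xe] /=; case: ltP => xr /=.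
  by rewrite addrA gap_pot_split ?lx// addrAC.
by rewrite IH ?xr// addrA.
Qed.

End Increments.

Section IncrementMoments.
Context {R : realType} {d : measure_display} {T : measurableType d}.
Variables (P : probability T R) (U : nat -> {RV P >-> R}).
Hypothesis iid : iid_uniform01 U.
Implicit Types (n J : nat).
Local Notation key := (keys U).
Local Notation E := (mean P).

(** The truncation makes the sum of the increments over all times a sum over the
    levels below J of the tree. *)
Definition incr J n w : R := gapval (gap_G_below J) 0 (gaps (key w) n) (key w n).
Definition trunc_sum J n w : R := \sum_(k < n) incr J k w.
Definition cube_mass J n : R := E (fun w => gapsum (cube_below J) 0 (gaps (key w) n)).

Lemma measurable_gap_G_below J k :
  measurable_fun setT (fun z : R * R * R => gap_G_below J k z.1.1 z.1.2 z.2).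
Proof.
rewrite /gap_G_below; case: (k < J)%N; last exact: measurable_cst.
have m1 : measurable_fun setT (fun z : R * R * R => z.1.1).
  exact: (measurableT_comp (measurable_fst) measurable_fst).
have m2 : measurable_fun setT (fun z : R * R * R => z.1.2).
  exact: (measurableT_comp (measurable_snd) measurable_fst).
have m3 : measurable_fun setT (fun z : R * R * R => z.2) by exact: measurable_snd.
apply: measurable_funM; first exact: measurable_funB.
apply: (measurableT_comp measurable_Cfun); apply: measurable_funM; first exact: measurable_funB.
by apply: (measurableT_comp measurable_invr); exact: measurable_funB.
Qed.

Lemma gapval_gap_G_below_bound J n w x : 0 <= x < 1 ->
  `|gapval (gap_G_below J) 0 (gaps (key w) n) x| <= 5.
Proof.
move=> /andP[x0 x1]; have [wfp e] := gaps_wf n (keys01 U w).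
have := gapval_bound (g := gap_G_below J) (B := 5) (x := x) _ _ wfp x0.
rewrite e subr0 mulr1; apply => // k a c axc.
rewrite /gap_G_below; case: ifP => _.
  by apply: gap_G_bound; case/andP: axc => -> /ltW.
by rewrite normr0 mulr_ge0//; move: axc => /andP[? ?]; lra.
Qed.

Lemma bddmeas_incr J n m : (m < n)%N -> bddmeas (incr J m : past U n -> R).
Proof.
move=> mn; split.
  apply: measurable_gapval => //; first exact: measurable_gap_G_below.
    exact: measurable_key.
  by apply: mprofile_gaps; exact: ltnW.
by exists 5 => w; apply: gapval_gap_G_below_bound; exact: keys01.
Qed.

Lemma bddmeas_trunc_sum J n m : (m <= n)%N -> bddmeas (trunc_sum J m : past U n -> R).
Proof.
move=> mn; apply: (@bddmeas_sum _ _ (past U n) m (fun k => incr J k)) => k km.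
by apply: bddmeas_incr; exact: leq_trans mn.
Qed.

Lemma measurable_cube_below J k :
  measurable_fun setT (fun z : R * R => cube_below J k z.1 z.2).
Proof.
rewrite /cube_below; case: (k < J)%N; last exact: measurable_cst.
apply: measurable_funX; apply: measurable_funB; [exact: measurable_snd|exact: measurable_fst].
Qed.

Lemma cube_below_ge0 J k (a c : R) : a <= c -> 0 <= cube_below J k a c.
Proof. by move=> ac; rewrite /cube_below; case: ifP => // _; rewrite exprn_ge0// subr_ge0. Qed.

Lemma gapsum_cube_below_bound J n w :
  `|gapsum (cube_below J) 0 (gaps (key w) n)| <= (n.+1)%:R.
Proof.
have [wfp e] := gaps_wf n (keys01 U w).
rewrite ger0_norm; last by apply: gapsum_ge0 => // *; exact: cube_below_ge0.
rewrite (gapsum_sum (f := fun k x => if (k < J)%N then x ^+ 3 else 0)); last first.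
  by move=> *.
rewrite size_gaps; last exact: keys01.
rewrite -[leRHS]mulr1 -(sum_ord_cst n.+1 1); apply: ler_sum => i _.
have /andP[g0 g1] := gaplen01 U n i w.
by case: ifP => // _; exact: exprn_ile1.
Qed.

Lemma bddmeas_cubes J n : bddmeas (fun w => gapsum (cube_below J) 0 (gaps (key w) n)).
Proof.
apply: (@bddmeas_past _ _ _ _ U n); apply: (bddmeas_gapsum (leqnn n)).
  exact: measurable_cube_below.
exact: gapsum_cube_below_bound.
Qed.

(** The increment has mean 0 given the past, by integration over each gap, so it
    is orthogonal to Z; its second moment over a gap of length g is c g^3. *)
Lemma mean_add_incr_sqr J n (Z : T -> R) : bddmeas (Z : past U n -> R) ->
  E (fun w => (Z w + incr J n w) ^+ 2) = E (fun w => Z w ^+ 2) + C_sqr * cube_mass J n.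
Proof.
move=> bZ; have bZT := bddmeas_past bZ.
rewrite /cube_mass -meanZ; last exact: bddmeas_cubes.
rewrite -meanD; [|exact: bddmeasX|by apply: bddmeasZ; exact: bddmeas_cubes].
pose f w x := (Z w + gapval (gap_G_below J) 0 (gaps (key w) n) x) ^+ 2.
have [c cZ] := bZ.2.
have [||||_ ->//] := @mean_last_key _ _ _ P U iid n f
  (fun w => Z w ^+ 2 + C_sqr * gapsum (cube_below J) 0 (gaps (key w) n)) ((c + 5) ^+ 2) _ _ _ _.
- apply: measurable_funX; apply: measurable_funD.
    exact: (measurableT_comp bZ.1 measurable_fst).
  have m1 : measurable_fun setT (@fst (past U n) R) by exact: measurable_fst.
  have m2 : measurable_fun setT (@snd (past U n) R) by exact: measurable_snd.
  have := measurable_gapval (@measurable_gap_G_below J) (measurable_cst (0 : R)) m2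
    (mprofile_comp m1 (mprofile_gaps U (leqnn n))).
  by move=> H; exact: H.
- move=> w x x01; rewrite /f normrX lerXn2r ?nnegrE//.
    by rewrite addr_ge0// (le_trans (normr_ge0 _) (cZ w)).
  by rewrite (le_trans (ler_normD _ _))// lerD// gapval_gap_G_below_bound.
- by apply: bddmeasD; [exact: bddmeasX|apply: bddmeasZ; exact: bddmeas_cubes].
- move=> w; have [wfp e] := gaps_wf n (keys01 U w).
  have h1 := has_int_gapval (@has_int_gap_G_below _ J) wfp.
  have h2 := has_int_gapval (@has_int_gap_G_below_sqr _ J) wfp.
  rewrite e in h1 h2.
  have h0 := has_int_cst (Z w ^+ 2) (ler01 : (0:R) <= 1).
  have := has_int_add (has_int_add h0 (has_int_scale (2 * Z w) h1)) h2.
  rewrite subr0 mulr1 gapsumZ gapsum0.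
  rewrite mulr0 addr0; apply: has_int_eq => x _.
  by rewrite /f -gapval_sqr; ring.
Qed.

Definition cubes n : R := 6 / (n.+2%:R * n.+3%:R).

Lemma cube_mass_le J n : 0 <= cube_mass J n <= cubes n.
Proof.
have b := bddmeas_cubes J n.
apply/andP; split.
  rewrite -(mean_cst P 0); apply: le_mean => //; first exact: bddmeas_cst.
  move=> w; have [wfp e] := gaps_wf n (keys01 U w).
  by apply: gapsum_ge0 => // *; exact: cube_below_ge0.
have b' := bddmeas_cubes n.+1 n.
rewrite /cubes -(mean_gap_cubes iid n).
have -> : E (fun w => gapsum (fun _ a c => (c - a) ^+ 3) 0 (gaps (key w) n)) = cube_mass n.+1 n.
  apply: eq_mean => w; apply/esym/(@eq_gapsum_below _ n.+1); last exact: all_depths_le.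
  by move=> k a c' kn; rewrite /cube_below kn.
apply: le_mean => // w; have [wfp e] := gaps_wf n (keys01 U w).
rewrite (@eq_gapsum_below _ n.+1 (cube_below n.+1) (fun _ a c => (c - a) ^+ 3)).
- apply: le_gapsum => // k a c' ac; rewrite /cube_below; case: ifP => // _.
  by rewrite exprn_ge0// subr_ge0.
- by move=> k a c' kn; rewrite /cube_below kn.
- exact: all_depths_le.
Qed.

Lemma cube_mass_eq J n : (n < J)%N -> cube_mass J n = cubes n.
Proof.
move=> nJ; rewrite /cubes -(mean_gap_cubes iid n); apply: eq_mean => w.
apply: (@eq_gapsum_below _ n.+1); last exact: all_depths_le.
by move=> k a c kn; rewrite /cube_below (leq_trans _ nJ).
Qed.

(** The terms are differences of consecutive values of -6/(k+2). *)
Lemma sum_cubes n : \sum_(k < n) cubes k = 3 - 6 / n.+2%:R.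
Proof.
elim: n => [|n IH]; first by rewrite big_ord0; field.
rewrite big_ord_recr/= IH /cubes.
have n0 : 0 <= n%:R :> R by [].
rewrite -(natr1 n.+2) -(natr1 n.+1) -(natr1 n).
by move: (n%:R : R) n0 => x x0; field; rewrite !gt_eqF//; lra.
Qed.

Lemma mean_trunc_sum_sub_sqr J n m (Z : T -> R) : (n <= m)%N ->
  (forall k, (n <= k)%N -> bddmeas (Z : past U k -> R)) ->
  E (fun w => (trunc_sum J m w - Z w) ^+ 2) =
  E (fun w => (trunc_sum J n w - Z w) ^+ 2) + C_sqr * \sum_(n <= k < m) cube_mass J k.
Proof.
elim: m => [|m IH].
  by rewrite leqn0 => /eqP -> _; rewrite big_geq// mulr0 addr0.
rewrite leq_eqVlt => /orP[/eqP <- _|nm bZ].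
  by rewrite big_geq// mulr0 addr0.
rewrite big_nat_recr//= mulrDr addrA -IH//.
have bZ' : bddmeas ((fun w => trunc_sum J m w - Z w) : past U m -> R).
  by apply: bddmeasB; [exact: bddmeas_trunc_sum|exact: bZ].
rewrite -(mean_add_incr_sqr J bZ'); apply: eq_mean => w.
by rewrite /trunc_sum big_ord_recr/=; congr (_ ^+ 2); ring.
Qed.

Lemma trunc_sum_pot J n w : (n <= J)%N ->
  trunc_sum J n w = gapsum gap_pot 0 (gaps (key w) n).
Proof.
elim: n => [|n IH] nJ.
  by rewrite /trunc_sum big_ord0 /= /gap_pot subr0 mul0r xlnx1 mulr0 !addr0.
have [wfp e] := gaps_wf n (keys01 U w).
rewrite /trunc_sum big_ord_recr/= -/(trunc_sum J n w) IH ?(ltnW nJ)//.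
rewrite gap_pot_insert ?e//; last exact: keys01.
congr (_ + _); apply: (@eq_gapval_below _ n.+1); last exact: all_depths_le.
by move=> k a c kn; rewrite /gap_G_below (leq_trans _ nJ).
Qed.

(** Almost surely equal to Y_n: the difference 2 n between D_n and K_n cancels by
    centring. *)
Definition Yrank n w : R := (dsum (depths (key w) n) - depth_mean n (@dsum R)) / n.+1%:R.

Definition qs_norm n : R := qs_var n / n.+1%:R ^+ 2.

Let centred_dsum n ds : R := (dsum ds - depth_mean n (@dsum R)) / n.+1%:R.

Let depth_mean_centred_dsum n : depth_mean n (centred_dsum n) = 0.
Proof.
rewrite (eq_depth_mean (h' := fun ds => n.+1%:R^-1 * dsum ds +
    (- (depth_mean n (@dsum R) / n.+1%:R)))).
  by rewrite depth_meanD depth_meanZ depth_mean_cst mulrC subrr.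
by move=> ds _; rewrite /centred_dsum mulrBl mulrC.
Qed.

Let depth_mean_centred_dsum_dsum n : depth_mean n (fun ds => centred_dsum n ds * dsum ds) =
  qs_var n / n.+1%:R.
Proof.
rewrite (eq_depth_mean (h' := fun ds => n.+1%:R^-1 * dsum ds ^+ 2 +
    (- (depth_mean n (@dsum R) / n.+1%:R)) * dsum ds)).
  by rewrite depth_meanD !depth_meanZ depth_mean_dsum_sqr; ring.
by move=> ds _; rewrite /centred_dsum; ring.
Qed.

Lemma mean_Yrank_sqr n : E (fun w => Yrank n w ^+ 2) = qs_norm n.
Proof.
rewrite (mean_depths iid n (fun ds => centred_dsum n ds ^+ 2)).
rewrite (eq_depth_mean (h' := fun ds => n.+1%:R^-1 * (centred_dsum n ds * dsum ds) +
    (- (depth_mean n (@dsum R) / n.+1%:R)) * centred_dsum n ds)).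
  rewrite depth_meanD !depth_meanZ depth_mean_centred_dsum depth_mean_centred_dsum_dsum /qs_norm
      mulr0 addr0.
  have n0 : n.+1%:R != 0 :> R by rewrite pnatr_eq0.
  by move: n0; move: (n.+1%:R : R) => x x0; field.
by move=> ds _; rewrite /centred_dsum; ring.
Qed.

Lemma bddmeas_Yrank n k : (n <= k)%N -> bddmeas (Yrank n : past U k -> R).
Proof. exact: (bddmeas_depths U (centred_dsum n)). Qed.

(** Y_n is a centred function of the depths. Hence the entropies drop out, and the
    lengths may be replaced by their mean 1/(n+1), which turns the potential into
    D_n/(n+1). *)
Lemma mean_Yrank_pot n :
  E (fun w => Yrank n w * gapsum gap_pot 0 (gaps (key w) n)) = qs_norm n.
Proof.
pose A w := centred_dsum n (depths (key w) n) *
      gapsum (fun k a c => k%:R * (c - a)) 0 (gaps (key w) n).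
pose F i w := centred_dsum n (depths (key w) n) * xlnx (gaplen 0 (gaps (key w) n) i).
have bF i : (i < n.+1)%N -> bddmeas (F i) /\ E (F i) = 0.
  by move=> ilt; have [] := mean_depths_xlnx iid ilt (depth_mean_centred_dsum n).
have bA : bddmeas A.
  by have [] := mean_dsum_weighted iid n (centred_dsum n).
have -> : E (fun w => Yrank n w * gapsum gap_pot 0 (gaps (key w) n)) =
    E (fun w => A w + 2 * \sum_(i < n.+1) F i w).
  apply: eq_mean => w; rewrite /A /F -!mulr_sumr mulrCA -mulrDr; congr (_ * _).
  rewrite /gap_pot gapsumD gapsumZ; congr (_ + _ * _).
  by rewrite (gapsum_sum (f := fun _ x => xlnx x))// size_gaps//; exact: keys01.
have bS : bddmeas (fun w => \sum_(i < n.+1) F i w).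
  by apply: (@bddmeas_sum _ _ _ n.+1 F) => i /bF[].
rewrite meanD//; last exact: bddmeasZ.
rewrite meanZ// (@mean_sum _ _ _ P n.+1 F); last by move=> i /bF[].
rewrite (big1 _ _ _ (fun (i : 'I_n.+1) _ => (bF i (ltn_ord i)).2)) mulr0 addr0.
have [_ ->] := mean_dsum_weighted iid n (centred_dsum n).
rewrite depth_mean_centred_dsum_dsum /qs_norm.
have n0 : n.+1%:R != 0 :> R by rewrite pnatr_eq0.
by move: n0; move: (n.+1%:R : R) => x x0; field.
Qed.

(** Pythagoras: with X the truncated sum at time n, <Y_n, X> = ||Y_n||^2 gives
    ||X - Y_n||^2 = ||X||^2 - ||Y_n||^2, and each further increment adds its own
    second moment. *)
Lemma mean_trunc_sum_Yrank_sqr J n m : (n <= J)%N -> (n <= m)%N ->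
  E (fun w => (trunc_sum J m w - Yrank n w) ^+ 2) =
  C_sqr * \sum_(k < m) cube_mass J k - qs_norm n.
Proof.
move=> nJ nm; rewrite (mean_trunc_sum_sub_sqr J nm) => [|k nk]; last exact: bddmeas_Yrank.
have bX : bddmeas (trunc_sum J n) by exact: (bddmeas_past (bddmeas_trunc_sum J (leqnn n))).
have bY : bddmeas (Yrank n) by exact: (bddmeas_past (bddmeas_Yrank (leqnn n))).
have -> : E (fun w => (trunc_sum J n w - Yrank n w) ^+ 2) =
  E (fun w => trunc_sum J n w ^+ 2) - 2 * E (fun w => Yrank n w * trunc_sum J n w)
  + E (fun w => Yrank n w ^+ 2).
  rewrite -meanZ; last exact: bddmeasM.
  rewrite -meanB; [|exact: bddmeasX|by apply: bddmeasZ; exact: bddmeasM].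
  rewrite -meanD;
    [|by apply: bddmeasB; [exact: bddmeasX|apply: bddmeasZ; exact: bddmeasM]|exact: bddmeasX].
  by apply: eq_mean => w; ring.
rewrite mean_Yrank_sqr.
have -> : E (fun w => Yrank n w * trunc_sum J n w) = qs_norm n.
  by rewrite -mean_Yrank_pot; apply: eq_mean => w; rewrite trunc_sum_pot.
have -> : E (fun w => trunc_sum J n w ^+ 2) = C_sqr * \sum_(0 <= k < n) cube_mass J k.
  transitivity (E (fun w => (trunc_sum J n w - 0) ^+ 2)).
    by apply: eq_mean => w; rewrite subr0.
  rewrite (@mean_trunc_sum_sub_sqr J 0 n (fun=> 0))// => [|k _]; last exact: bddmeas_cst.
  rewrite (_ : E _ = 0) ?add0r// -[RHS](mean_cst P).
  by apply: eq_mean => w; rewrite /trunc_sum big_ord0 subr0 expr0n.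
rewrite -(big_mkord xpredT (cube_mass J)) (big_cat_nat (leq0n n) nm)/=; ring.
Qed.

(** The sums of cubes are complete up to time J, whence the lower bound; over all
    times they amount to 3. *)
Lemma mean_trunc_sum_Yrank_bounds J n m : (n <= J)%N -> (J <= m)%N ->
  C_sqr * (3 - 6 / J.+2%:R) - qs_norm n
    <= E (fun w => (trunc_sum J m w - Yrank n w) ^+ 2) <= C_sqr * 3 - qs_norm n.
Proof.
move=> nJ Jm; rewrite mean_trunc_sum_Yrank_sqr ?(leq_trans nJ)// !lerD2r.
apply/andP; split; apply: ler_wpM2l; rewrite ?C_sqr_ge0//.
  rewrite -sum_cubes -!(big_mkord xpredT) (big_cat_nat (leq0n J) Jm)/= ler_wpDr//.
    by apply: sumr_ge0 => k _; have /andP[] := cube_mass_le J k.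
  rewrite !big_nat; apply: ler_sum => k kJ.
  by rewrite cube_mass_eq.
apply: (@le_trans _ _ (\sum_(k < m) cubes k)).
  by apply: ler_sum => k _; have /andP[] := cube_mass_le J k.
by rewrite sum_cubes gerBl divr_ge0.
Qed.

End IncrementMoments.

(** * Search trees, their profiles and QuickSort *)
Section TreeProfile.
Context {R : realType}.
Implicit Types (t : @bst R) (s : seq (nat * R)) (u : nat -> R) (x y l r : R).

(** The profile of a tree: its external nodes from left to right. *)
Fixpoint leaves t k r : seq (nat * R) :=
  if t is Node a y b then leaves a k.+1 y ++ leaves b k.+1 r else [:: (k, r)].

Fixpoint ordered l r t : bool :=
  if t is Node a y b then ordered l y a && ordered y r b else l <= r.

Lemma right_end_cat l s1 s2 : right_end l (s1 ++ s2) = right_end (right_end l s1) s2.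
Proof. by rewrite /right_end /unzip2 map_cat last_cat. Qed.

Lemma wf_cat l s1 s2 : wf l (s1 ++ s2) = wf l s1 && wf (right_end l s1) s2.
Proof. by rewrite /wf /right_end /unzip2 map_cat cat_path. Qed.

Lemma leaves_wf t k l r : ordered l r t ->
  wf l (leaves t k r) /\ right_end l (leaves t k r) = r.
Proof.
elim: t k l r => [|a IHa y b IHb] k l r /=; first by rewrite /wf /right_end /= andbT.
move=> /andP[/(IHa k.+1)[wa ea] /(IHb k.+1)[wb eb]].
by rewrite wf_cat right_end_cat ea wa.
Qed.

Lemma ordered_insert t l r x : ordered l r t -> l <= x -> x < r ->
  ordered l r (bst_insert t x).
Proof.
elim: t l r => [|a IHa y b IHb] l r /=; first by move=> _ -> /ltW.
move=> /andP[oa ob] lx xr; case: ltP => xy /=; first by rewrite IHa.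
by rewrite oa IHb.
Qed.

Lemma insert_cat_left l s1 s2 x : l <= x -> x < right_end l s1 ->
  insert (s1 ++ s2) x = insert s1 x ++ s2.
Proof.
elim: s1 l => [|[k r] s1 IH] l lx /= xe; first by rewrite ltNge lx in xe.
by case: ltP => // rx; rewrite (IH r).
Qed.

Lemma insert_cat_right l s1 s2 x : wf l s1 -> right_end l s1 <= x ->
  insert (s1 ++ s2) x = s1 ++ insert s2 x.
Proof.
elim: s1 l => [//|[k r] s1 IH] l; rewrite wf_cons => /andP[lr ws] ex /=.
by rewrite ltNge (le_trans (wf_le_right_end ws) ex)/= (IH r).
Qed.

Lemma gapval_cat_left g l s1 s2 x : l <= x -> x < right_end l s1 ->
  gapval g l (s1 ++ s2) x = gapval g l s1 x.
Proof.
elim: s1 l => [|[k r] s1 IH] l lx /= xe; first by rewrite ltNge lx in xe.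
by case: ltP => // rx; rewrite (IH r).
Qed.

Lemma gapval_cat_right g l s1 s2 x : wf l s1 -> right_end l s1 <= x ->
  gapval g l (s1 ++ s2) x = gapval g (right_end l s1) s2 x.
Proof.
elim: s1 l => [//|[k r] s1 IH] l; rewrite wf_cons => /andP[lr ws] ex /=.
by rewrite ltNge (le_trans (wf_le_right_end ws) ex)/= (IH r).
Qed.

Lemma insert_leaves t k l r x : ordered l r t -> l <= x -> x < r ->
  insert (leaves t k r) x = leaves (bst_insert t x) k r.
Proof.
elim: t k l r => [|a IHa y b IHb] k l r /=; first by move=> _ _ ->.
move=> /andP[oa ob] lx xr; have [wa ea] := leaves_wf k.+1 oa.
case: ltP => xy /=.
  by rewrite (insert_cat_left _ lx) ?ea// (IHa _ l).
by rewrite (insert_cat_right _ wa) ?ea// (IHb _ y).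
Qed.

Lemma bst_ofS u n : bst_of u n.+1 = bst_insert (bst_of u n) (u n).
Proof. by rewrite /bst_of mkseqS foldl_rcons. Qed.

Lemma bst_of_ordered u n : in01 u -> ordered 0 1 (bst_of u n).
Proof.
move=> u01; elim: n => [|n IH]; first by rewrite /bst_of/= ler01.
by rewrite bst_ofS; have /andP[? ?] := u01 n; exact: ordered_insert.
Qed.

Lemma gaps_leaves u n : in01 u -> gaps u n = leaves (bst_of u n) 0 1.
Proof.
move=> u01; elim: n => [//|n IH] /=; rewrite IH bst_ofS.
by have /andP[? ?] := u01 n; apply: (@insert_leaves _ _ 0) => //; exact: bst_of_ordered.
Qed.

Fixpoint ext_length t k : nat :=
    if t is Node a _ b then (ext_length a k.+1 + ext_length b k.+1)%N else k.
Fixpoint leaf_count t : nat := if t is Node a _ b then (leaf_count a + leaf_count b)%N else 1.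

Lemma ext_length_leaves t k r : sumn (unzip1 (leaves t k r)) = ext_length t k.
Proof.
elim: t k r => [|a IHa y b IHb] k r /=; first by rewrite addn0.
by rewrite /unzip1 map_cat sumn_cat IHa IHb.
Qed.

Lemma ext_lengthS t k : ext_length t k.+1 = (ext_length t k + leaf_count t)%N.
Proof. by elim: t k => [|a IHa y b IHb] k /=; rewrite ?addn1// IHa IHb addnACA. Qed.

Lemma leaf_count_insert t x : leaf_count (bst_insert t x) = (leaf_count t).+1.
Proof.
by elim: t => [//|a IHa y b IHb] /=; case: ifP => _ /=; rewrite ?IHa ?IHb ?addnS.
Qed.

Lemma leaf_count_foldl t (v : seq R) : leaf_count (foldl bst_insert t v) =
    (leaf_count t + size v)%N.
Proof. by elim: v t => [|x v IH] t /=; rewrite ?addn0// IH leaf_count_insert addSnnS. Qed.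

Lemma foldl_insert_Node a y b (v : seq R) : foldl bst_insert (Node a y b) v =
  Node (foldl bst_insert a [seq x <- v | x < y]) y (foldl bst_insert b [seq x <- v | ~~ (x < y)]).
Proof. by elim: v a b => [//|x v IH] a b /=; case: ifP => _ /=; rewrite IH. Qed.

(** QuickSort compares each key with its proper ancestors in the search tree, so
    the number of comparisons is the internal path length, which is smaller than
    the external one by twice the number of keys. *)
Lemma qs_comps_ext_length (v : seq R) : uniq v ->
  ext_length (foldl bst_insert (Leaf) v) 0 = (qs_comps v + 2 * size v)%N.
Proof.
move: {2}(size v) (leqnn (size v)) => m; elim: m v => [|m IH] [//|x v] //= vm /andP[xv uv].
rewrite foldl_insert_Node /= qs_comps_cons !ext_lengthS !leaf_count_foldl.
have -> : [seq z <- v | ~~ (z < x)%R] = [seq z <- v | (x < z)%R].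
  apply: eq_in_filter => z zv; rewrite -leNgt lt_neqAle; case: eqVneq => // xz.
  by rewrite xz zv in xv.
have le_filter (p : pred R) : (size [seq z <- v | p z] <= m)%N.
  by rewrite size_filter (leq_trans (count_size _ _)).
rewrite !IH ?filter_uniq ?le_filter//.
have sz : (size [seq z <- v | (z < x)%R] + size [seq z <- v | (x < z)%R])%N = size v.
  rewrite !size_filter -(count_predC (fun z : R => z < x)); congr (_ + _)%N.
  apply: eq_in_count => z zv /=; rewrite -leNgt lt_neqAle; case: eqVneq => // xz.
  by rewrite xz zv in xv.
rewrite -sz (_ : leaf_count Leaf = 1%N)//.
by move: (qs_comps _) (qs_comps _) (size _) (size _) => p q i j; lia.
Qed.

Lemma dsum_depths u n : in01 u -> uniq (mkseq u n) ->
  dsum (depths u n) = (qs_comps (mkseq u n))%:R + 2 * n%:R :> R.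
Proof.
move=> u01 un; rewrite /dsum /depths gaps_leaves// ext_length_leaves /bst_of.
by rewrite qs_comps_ext_length// size_mkseq natrD natrM.
Qed.

(** The sum of G over the nodes of a subtree rooted at depth k, with interval from
    l to r, truncated at level J. *)
Fixpoint tree_sum J t k l r : R :=
  if t is Node a y b then
    gap_G_below J k l r y + (tree_sum J a k.+1 l y + tree_sum J b k.+1 y r)
  else 0.

Lemma tree_sum_insert J t k l r x : ordered l r t -> l <= x -> x < r ->
  tree_sum J (bst_insert t x) k l r =
      tree_sum J t k l r + gapval (gap_G_below J) l (leaves t k r) x.
Proof.
elim: t k l r => [|a IHa y b IHb] k l r /=; first by move=> _ _ ->; rewrite !addr0 add0r.
move=> /andP[oa ob] lx xr; have [wa ea] := leaves_wf k.+1 oa.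
case: ltP => xy /=.
  by rewrite (gapval_cat_left _ _ lx) ?ea// IHa//; ring.
by rewrite (gapval_cat_right _ _ wa) ?ea// IHb//; ring.
Qed.

(** Each of the J - k levels contributes at most 5 times the total length r - l,
    uniformly in the number of keys. *)
Lemma tree_sum_bound J t k l r : ordered l r t ->
  `|tree_sum J t k l r| <= 5 * (r - l) * (J - k)%:R.
Proof.
elim: t k l r => [|a IHa y b IHb] k l r /=.
  by move=> lr; rewrite normr0 !mulr_ge0// subr_ge0.
move=> /andP[oa ob].
have ordle t' l' r' : ordered l' r' t' -> l' <= r'.
  move=> o; have [w e] := leaves_wf 0 o; by have := wf_le_right_end w; rewrite e.
have ly := ordle _ _ _ oa; have yr := ordle _ _ _ ob.
have ha := IHa k.+1 _ _ oa; have hb := IHb k.+1 _ _ ob.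
rewrite (le_trans (ler_normD _ _))//; have hab := le_trans (ler_normD _ _) (lerD ha hb).
rewrite /gap_G_below; case: ltnP => kJ.
  have hg := @gap_G_bound _ l r y; rewrite ly yr in hg.
  apply: (le_trans (lerD (hg isT) hab)).
  have -> : (J - k)%:R = (J - k.+1)%:R + 1 :> R by rewrite natr1 subnSK.
  by rewrite le_eqVlt; apply/orP; left; apply/eqP; ring.
rewrite normr0 add0r (le_trans hab)//.
have -> : (J - k.+1)%N = 0%N by apply/eqP; rewrite subn_eq0 leqW.
by rewrite !mulr0 addr0 !mulr_ge0// subr_ge0 (le_trans ly).
Qed.

End TreeProfile.

(** * The infinite search tree of a generic sequence of keys *)
Section InfiniteTree.
Context {R : realType}.
Implicit Types (t : @bst R) (u : nat -> R) (x y l r v : R) (theta : seq bool).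

Fixpoint strictly_ordered l r t : bool :=
  if t is Node a y b then strictly_ordered l y a && strictly_ordered y r b else l < r.

Fixpoint tree_keys t : seq R := if t is Node a y b then y :: tree_keys a ++ tree_keys b else [::].

(** For a node theta of t or one of its external nodes, the interval of the keys
    routed to theta; below that, the interval where the descent stopped. *)
Fixpoint node_itv l r t theta : R * R :=
  match t, theta with
  | Node a y b, c :: theta' => if c then node_itv y r b theta' else node_itv l y a theta'
  | _, _ => (l, r)
  end.

(** Holds when theta is an external node of t. *)
Fixpoint vacant t theta : bool :=
  match t, theta with
  | Leaf, [::] => true
  | Node a _ b, c :: theta' => vacant (if c then b else a) theta'
  | _, _ => false
  end.

Definition key_at t theta : R := odflt 0 (bst_key t theta).

Lemma strictly_ordered_lt l r t : strictly_ordered l r t -> l < r.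
Proof.
elim: t l r => [//|a IHa y b IHb] l r /= /andP[/IHa ly /IHb yr]; exact: lt_trans yr.
Qed.

Lemma strictly_ordered_key l r t theta v : strictly_ordered l r t -> bst_key t theta = Some v ->
    l < v < r.
Proof.
elim: t l r theta => [//|a IHa y b IHb] l r [|[] theta] /= /andP[oa ob].
- by case=> <-; rewrite (strictly_ordered_lt oa) (strictly_ordered_lt ob).
- by move=> /(IHb _ _ _ ob)/andP[yv ->]; rewrite (lt_trans (strictly_ordered_lt oa) yv).
- by move=> /(IHa _ _ _ oa)/andP[-> vy]; rewrite (lt_trans vy (strictly_ordered_lt ob)).
Qed.

Lemma tree_keys_insert t x z : z \in tree_keys (bst_insert t x) -> z \in x :: tree_keys t.
Proof.
elim: t => [//|a IHa y b IHb] /=; case: ifP => _ /=; rewrite !inE !mem_cat.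
- by move=> /orP[->|/orP[/IHa|->]]; rewrite ?inE ?orbT// => /orP[->|->]; rewrite ?orbT.
- by move=> /orP[->|/orP[->|/IHb]]; rewrite ?inE ?orbT// => /orP[->|->]; rewrite ?orbT.
Qed.

Lemma tree_keys_bst_of u n z : z \in tree_keys (bst_of u n) -> exists2 i, (i < n)%N & z = u i.
Proof.
elim: n => [//|n IH]; rewrite bst_ofS => /tree_keys_insert;
    rewrite inE => /orP[/eqP->|/IH[i lt ->]].
  by exists n.
by exists i => //; exact: ltnW.
Qed.

Lemma strictly_ordered_insert l r t x : strictly_ordered l r t -> l < x < r ->
    x \notin tree_keys t ->
  strictly_ordered l r (bst_insert t x).
Proof.
elim: t l r => [|a IHa y b IHb] l r /=; first by move=> _ /andP[-> ->].
move=> /andP[oa ob] /andP[lx xr]; rewrite inE mem_cat !negb_or => /and3P[xy xa xb].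
case: ltP => xy' /=; first by rewrite IHa ?lx ?ob.
by rewrite oa IHb ?xr// andbT lt_neqAle eq_sym xy.
Qed.

Lemma bst_key_insert t x theta v : bst_key t theta = Some v ->
  bst_key (bst_insert t x) theta = Some v.
Proof.
elim: t theta => [//|a IHa y b IHb] [|[] theta] /=; case: ifP => _ //=; [exact: IHb|exact: IHa].
Qed.

Lemma bst_key_mono u m n theta v : (m <= n)%N ->
  bst_key (bst_of u m) theta = Some v -> bst_key (bst_of u n) theta = Some v.
Proof.
move=> /subnK <-; elim: (n - m)%N => [//|k IH] /IH h.
by rewrite addSn bst_ofS; exact: bst_key_insert.
Qed.

Lemma node_keyE u n theta v : bst_key (bst_of u n) theta = Some v -> node_key u theta = v.
Proof.
move=> h; rewrite /node_key; case: xgetP => [v' -> [m hm]|/(_ v) []]; last by exists n.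
have := bst_key_mono (leq_maxl m n) hm; have := bst_key_mono (leq_maxr m n) h.
by move=> -> [].
Qed.

Lemma node_itv_sub l r t theta : strictly_ordered l r t ->
  l <= (node_itv l r t theta).1 /\ (node_itv l r t theta).2 <= r.
Proof.
elim: t l r theta => [|a IHa y b IHb] l r [|c theta] //= /andP[oa ob]; case: c.
  have [h1 h2] := IHb _ _ theta ob; split => //.
  by rewrite (le_trans (ltW (strictly_ordered_lt oa))).
have [h1 h2] := IHa _ _ theta oa; split => //.
by rewrite (le_trans h2)// ltW// (strictly_ordered_lt ob).
Qed.

(** A key inside the interval of an external node is stored there; any other key
    leaves that node external with the same interval. *)
Lemma vacant_insert t l r theta x : strictly_ordered l r t -> vacant t theta -> l < x < r ->
  x \notin tree_keys t ->
  if (node_itv l r t theta).1 < x < (node_itv l r t theta).2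
  then bst_key (bst_insert t x) theta = Some x
  else vacant (bst_insert t x) theta /\
       node_itv l r (bst_insert t x) theta = node_itv l r t theta.
Proof.
elim: t l r theta => [|a IHa y b IHb] l r [|c theta] //=; first by move=> _ _ ->.
move=> /andP[oa ob] vac /andP[lx xr]; rewrite inE mem_cat !negb_or => /and3P[xy xa xb].
case: (ltP x y) => xy'; case: c vac => vac /=.
- have [h1 _] := node_itv_sub theta ob.
  by rewrite ltNge (le_trans (ltW xy') h1).
- by apply: IHa => //; rewrite lx.
- by apply: IHb => //; rewrite xr andbT lt_neqAle eq_sym xy.
- have [_ h2] := node_itv_sub theta oa.
  by rewrite [X in _ && X]ltNge (le_trans h2 xy') andbF.
Qed.

Lemma vacant_itv_lt l r t theta : strictly_ordered l r t ->
  (node_itv l r t theta).1 < (node_itv l r t theta).2.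
Proof.
by elim: t l r theta => [|a IHa y b IHb] l r [|[] theta] //= /andP[oa ob];
  [exact: lt_trans (strictly_ordered_lt oa) (strictly_ordered_lt ob)|exact: IHb|exact: IHa].
Qed.

Lemma vacant_child t theta v c : bst_key t theta = Some v ->
  vacant t (rcons theta c) \/ exists v', bst_key t (rcons theta c) = Some v'.
Proof.
elim: t theta => [//|a IHa y b IHb] [|c' theta] /=.
  move=> _; have vac t : vacant t [::] \/ exists v', bst_key t [::] = Some v'.
    by case: t => [|a' y' b'] /=; [left|right; exists y'].
  exact: vac.
by case: c' => h; [exact: IHb|exact: IHa].
Qed.

(** The almost sure properties of the keys on which the identification of the
    tree rests. Density is required at arbitrarily late times, and only for the
    cells of uniform grids, which form a countable family. *)
Record generic u : Prop := Generic {
  generic01 : forall i, 0 < u i < 1;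
  generic_inj : injective u;
  generic_dense : forall n m i : nat, (i < m.+1)%N -> exists2 k, (n <= k)%N &
     i%:R / m.+1%:R < u k < i.+1%:R / m.+1%:R }.

Variable u : nat -> R.
Hypothesis gu : generic u.

Lemma generic_notin n : u n \notin tree_keys (bst_of u n).
Proof.
apply/negP => /tree_keys_bst_of[i lt /(generic_inj gu) e].
by rewrite e ltnn in lt.
Qed.

Lemma generic_sordered n : strictly_ordered 0 1 (bst_of u n).
Proof.
elim: n => [|n IH]; first by rewrite /bst_of/= ltr01.
by rewrite bst_ofS strictly_ordered_insert// ?generic01// generic_notin.
Qed.

(** A grid whose mesh is less than half of r - l has a cell strictly between l
    and r. *)
Lemma generic_hits n l r : 0 <= l -> l < r -> r <= 1 ->
  exists2 k, (n <= k)%N & l < u k < r.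
Proof.
move=> l0 lr r1; have rl : 0 < r - l by rewrite subr_gt0.
pose m := Num.truncn (2 / (r - l)).
have m0 : 0 < m.+1%:R :> R by [].
have hm : 2 / m.+1%:R < r - l.
  by rewrite ltr_pdivrMr// mulrC -ltr_pdivrMr// truncnS_gt.
pose i := (Num.truncn (l * m.+1%:R)).+1.
have lm0 : 0 <= l * m.+1%:R by rewrite mulr_ge0.
have i1 : l < i%:R / m.+1%:R by rewrite ltr_pdivlMr// truncnS_gt.
have i2 : i.+1%:R / m.+1%:R < r.
  have : i.+1%:R / m.+1%:R <= l + 2 / m.+1%:R.
    rewrite ler_pdivrMr// mulrDl divfK ?gt_eqF// -[i.+1]addn2 natrD lerD2r.
    by rewrite truncn_le.
  by move=> /le_lt_trans; apply; rewrite addrC -ltrBrDr.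
have im : (i < m.+1)%N.
  have : i.+1%:R < m.+1%:R :> R.
    by have := lt_le_trans i2 r1; rewrite ltr_pdivrMr// mul1r.
  by rewrite ltr_nat; exact: ltnW.
have [k nk /andP[k1 k2]] := generic_dense gu n im.
by exists k => //; rewrite (lt_trans i1)// (lt_trans k2).
Qed.

(** By induction on the label: once its parent is filled, an external node keeps
    its interval until a key hits it, which happens by density. *)
Lemma generic_filled theta : exists n v, bst_key (bst_of u n) theta = Some v.
Proof.
elim/last_ind: theta => [|theta c [n [v h]]]; first by exists 1%N, (u 0%N); rewrite bst_ofS.
have [vac|[v' h']] := vacant_child c h; last by exists n, v'.
have [l0 r1] := node_itv_sub (rcons theta c) (generic_sordered n).
have lr := vacant_itv_lt (rcons theta c) (generic_sordered n).
have [k nk hk] := generic_hits n l0 lr r1.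
have step m : (n <= m)%N -> (exists n' v', bst_key (bst_of u n') (rcons theta c) = Some v') \/
    (vacant (bst_of u m) (rcons theta c) /\
     node_itv 0 1 (bst_of u m) (rcons theta c) = node_itv 0 1 (bst_of u n) (rcons theta c)).
  move=> /subnK <-; elim: (m - n)%N => [|j [IH|[vacj ej]]]; [by right|by left|].
  have := vacant_insert (generic_sordered (j + n)) vacj (generic01 gu _) (generic_notin _).
  rewrite -bst_ofS addSn; case: ifP => _ => [hj|[vj ->]]; last by right.
  by left; exists (j + n).+1, (u (j + n)%N).
have [//|[vack ek]] := step k nk.
have := vacant_insert (generic_sordered k) vack (generic01 gu _) (generic_notin _).
rewrite ek hk -bst_ofS => hk'.
by exists k.+1, (u k).
Qed.

Lemma generic_level J : exists N, forall n theta, (N <= n)%N -> (size theta < J)%N ->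
  exists v, bst_key (bst_of u n) theta = Some v.
Proof.
have /choice[N hN] : forall theta, exists n, exists v, bst_key (bst_of u n) theta = Some v.
  by move=> theta; have [n [v h]] := generic_filled theta; exists n, v.
exists (\max_(j < J) \max_(theta : j.-tuple bool) N theta) => n theta nN sJ.
have [v hv] := hN theta; exists v; apply: bst_key_mono hv; apply: leq_trans nN.
apply: (@leq_trans (\max_(th : (size theta).-tuple bool) N th)).
  exact: (@leq_bigmax _ (fun th : (size theta).-tuple bool => N th) (in_tuple theta)).
exact: (@leq_bigmax _ (fun j : 'I_J => \max_(th : j.-tuple bool) N th) (Ordinal sJ)).
Qed.

End InfiniteTree.

(** * Sums over levels of the infinite tree *)
Section LevelSums.
Context {R : realType}.
Implicit Types (t : @bst R) (u : nat -> R) (x y l r v : R) (theta : seq bool).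

Lemma bigmax_start (I : Type) (s : seq I) (Q : pred I) (F : I -> R) x y :
  \big[Num.max/Num.max x y]_(i <- s | Q i) F i =
  Num.max x (\big[Num.max/y]_(i <- s | Q i) F i).
Proof.
elim: s => [|i s IH]; first by rewrite !big_nil.
by rewrite !big_cons; case: ifP => _ //; rewrite IH maxCA.
Qed.

Lemma bigmin_start (I : Type) (s : seq I) (Q : pred I) (F : I -> R) x y :
  \big[Num.min/Num.min x y]_(i <- s | Q i) F i =
  Num.min x (\big[Num.min/y]_(i <- s | Q i) F i).
Proof.
elim: s => [|i s IH]; first by rewrite !big_nil.
by rewrite !big_cons; case: ifP => _ //; rewrite IH minCA.
Qed.

Lemma big_ord_cons (op : R -> R -> R) (x0 : R) m (Q : pred nat) (F : nat -> R) :
  \big[op/x0]_(k < m.+1 | Q k) F k =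
  let z := \big[op/x0]_(k < m | Q k.+1) F k.+1 in if Q 0%N then op (F 0%N) z else z.
Proof.
by rewrite -(big_mkord Q F) big_ltn_cond// big_add1/= (big_mkord (fun k => Q k.+1)).
Qed.

(** Descending to theta, the left end of the interval is replaced by the key at
    each right turn; these keys increase and are the ancestors smaller than v, so
    the last one is their maximum. *)
Lemma node_itv_left l r t theta v : strictly_ordered l r t -> bst_key t theta = Some v ->
  \big[Num.max/l]_(k < size theta | key_at t (take k theta) < v) key_at t (take k theta) =
  (node_itv l r t theta).1.
Proof.
elim: t l r theta => [//|a IHa y b IHb] l r [|c theta] /=; first by rewrite big_ord0.
move=> /andP[oa ob] hv.
rewrite (big_ord_cons _ _ _ (fun k => key_at (Node a y b) (take k (c :: theta)) < v)
  (fun k => key_at (Node a y b) (take k (c :: theta)))) /= {2 4}/key_at/=.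
case: c hv => hv.
  have /andP[yv _] := strictly_ordered_key ob hv.
  by rewrite yv -bigmax_start max_l ?(ltW (strictly_ordered_lt oa))// -(IHb y r).
have /andP[_ vy] := strictly_ordered_key oa hv.
by rewrite ltNge (ltW vy)/= -(IHa l y).
Qed.

Lemma node_itv_right l r t theta v : strictly_ordered l r t -> bst_key t theta = Some v ->
  \big[Num.min/r]_(k < size theta | v < key_at t (take k theta)) key_at t (take k theta) =
  (node_itv l r t theta).2.
Proof.
elim: t l r theta => [//|a IHa y b IHb] l r [|c theta] /=; first by rewrite big_ord0.
move=> /andP[oa ob] hv.
rewrite (big_ord_cons _ _ _ (fun k => v < key_at (Node a y b) (take k (c :: theta)))
  (fun k => key_at (Node a y b) (take k (c :: theta)))) /= {2 4}/key_at/=.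
case: c hv => hv.
  have /andP[yv _] := strictly_ordered_key ob hv.
  by rewrite ltNge (ltW yv)/= -(IHb y r).
have /andP[_ vy] := strictly_ordered_key oa hv.
by rewrite vy -bigmin_start min_l ?(ltW (strictly_ordered_lt ob))// -(IHa l y).
Qed.

Lemma node_itv_rcons l r t theta v : bst_key t theta = Some v ->
  node_itv l r t (rcons theta false) = ((node_itv l r t theta).1, v).
Proof.
elim: t l r theta => [//|a IHa y b IHb] l r [|c theta] /=.
  by case=> <-; case: a {IHa}.
by case: c; [exact: IHb|exact: IHa].
Qed.

Lemma bst_key_prefix t theta v k : bst_key t theta = Some v ->
  exists v', bst_key t (take k theta) = Some v'.
Proof.
elim: t theta k => [//|a IHa y b IHb] [|c theta] [|k] /=; try by exists y.
by case: c; [exact: IHb|exact: IHa].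
Qed.

Lemma node_phiE u n theta v : strictly_ordered 0 1 (bst_of u n) ->
    bst_key (bst_of u n) theta = Some v ->
  node_phi u theta = (node_itv 0 1 (bst_of u n) theta).2 - (node_itv 0 1 (bst_of u n) theta).1.
Proof.
move=> so hv; rewrite /node_phi /node_left /node_right.
have kvE k : node_key u (take k theta) = key_at (bst_of u n) (take k theta).
  by have [v' h'] := bst_key_prefix k hv; rewrite (node_keyE h') /key_at h'.
rewrite (node_keyE hv) -(node_itv_left so hv) -(node_itv_right so hv).
by congr (_ - _); apply: eq_big => k; rewrite kvE.
Qed.

Definition itv_G l r t theta : R :=
  gap_G (node_itv l r t theta).1 (node_itv l r t theta).2 (key_at t theta).

Lemma node_GE u n theta v v' : strictly_ordered 0 1 (bst_of u n) ->
  bst_key (bst_of u n) theta = Some v -> bst_key (bst_of u n) (rcons theta false) = Some v' ->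
  node_G u theta = itv_G 0 1 (bst_of u n) theta.
Proof.
move=> so hv hv'; rewrite /node_G (node_phiE so hv) (node_phiE so hv').
by rewrite (node_itv_rcons _ _ hv) /itv_G /gap_G /key_at hv.
Qed.

Lemma sum_tupleS (F : seq bool -> R) j :
  \sum_(theta : j.+1.-tuple bool) F theta =
  \sum_(theta : j.-tuple bool) (F (false :: theta) + F (true :: theta)).
Proof.
rewrite (reindex (fun p : bool * j.-tuple bool => [tuple of p.1 :: p.2])) /=; last first.
  exists (fun th : j.+1.-tuple bool => (thead th, [tuple of behead th])) => [[c th] _|th _] /=.
    by congr pair; apply: val_inj.
  by rewrite [RHS]tuple_eta; apply: val_inj.
rewrite -(pair_bigA _ (fun (c : bool) (th : j.-tuple bool) => F (c :: th)))/=.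
rewrite exchange_big/=; apply: eq_bigr => th _.
by rewrite big_bool/= addrC.
Qed.

Lemma tree_sum_deep J t k l r : (J <= k)%N -> tree_sum J t k l r = 0.
Proof.
elim: t k l r => [//|a IHa y b IHb] k l r Jk /=.
by rewrite /gap_G_below ltnNge Jk/= IHa ?IHb ?addr0// leqW.
Qed.

(** When all levels below J are full, summing along the recursion of the tree is
    summing level by level. *)
Lemma tree_sum_levels J t k l r :
  (forall theta, (size theta < J)%N -> exists v, bst_key t theta = Some v) ->
  tree_sum (k + J) t k l r = \sum_(0 <= j < J) \sum_(theta : j.-tuple bool) itv_G l r t theta.
Proof.
elim: J t k l r => [|J IH] t k l r full; first by rewrite big_geq// tree_sum_deep// addn0.
rewrite big_ltn// big_add1/=.
case: t full => [/(_ [::] isT)[//]|a y b full].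
under [X in _ = _ + X]eq_bigr => j _ do rewrite (sum_tupleS (itv_G l r (Node a y b))) big_split/=.
rewrite big_split/= -addSnnS -(IH a k.+1 l y) => [|th sth]; last exact: (full (false :: th)).
rewrite -(IH b k.+1 y r) => [|th sth]; last exact: (full (true :: th)).
rewrite /gap_G_below addSn ltnS leq_addr; congr (_ + _).
rewrite (bigD1 [tuple])//= big1 ?addr0// => th; rewrite tuple0.
by move=> /eqP[]; apply: val_inj.
Qed.

(** Level J has to be filled too, since G at a node of level J - 1 is defined
    through its left child. *)
Lemma G_partial_sumE u J : generic u ->
  exists N, forall n, (N <= n)%N -> tree_sum J (bst_of u n) 0 0 1 = G_partial_sum u J.
Proof.
move=> gu; have [N hN] := generic_level gu J.+1; exists N => n Nn.
rewrite -[J in tree_sum J]add0n tree_sum_levels => [|theta sth]; last first.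
  by apply: hN => //; exact: ltnW.
rewrite /G_partial_sum !big_nat; apply: eq_bigr => j /andP[_ jJ].
apply: eq_bigr => theta _.
have [|v hv] := hN n theta Nn; first by rewrite size_tuple ltnW.
have [|v' hv'] := hN n (rcons theta false) Nn; first by rewrite size_rcons size_tuple.
by rewrite (node_GE (generic_sordered gu n) hv hv').
Qed.

End LevelSums.

(** * Measurability of the level sums *)
Section MeasurableTree.
Context {R : realType} {d : measure_display} {X : measurableType d}.
Implicit Types (t : X -> @bst R) (x : X -> R) (theta : seq bool).

(** The analogue of [mprofile] for trees. *)
Inductive mtree : (X -> @bst R) -> Prop :=
| mtree_leaf : mtree (fun=> Leaf)
| mtree_node a (y : X -> R) b : measurable_fun setT y -> mtree a -> mtree b ->
    mtree (fun w => Node (a w) (y w) (b w))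
| mtree_if (p : X -> bool) a b : measurable_fun setT p -> mtree a -> mtree b ->
    mtree (fun w => if p w then a w else b w).

Lemma mtree_insert t x : mtree t -> measurable_fun setT x ->
  mtree (fun w => bst_insert (t w) (x w)).
Proof.
move=> mt mx; elim: mt => [|a y b my ma IHa mb IHb|p a b mp _ IHa _ IHb] /=.
- by apply: mtree_node; [exact: mx|exact: mtree_leaf|exact: mtree_leaf].
- by apply: mtree_if; [exact: measurable_fun_ltr|exact: mtree_node|exact: mtree_node].
- rewrite (_ : (fun _ => _) = fun w => if p w then bst_insert (a w) (x w)
      else bst_insert (b w) (x w)).
    exact: mtree_if.
  by apply/funext => w; case: (p w).
Qed.

Lemma measurable_key_at t theta : mtree t -> measurable_fun setT (fun w => key_at (t w) theta).
Proof.
move=> mt; elim: mt theta => [|a y b my ma IHa mb IHb|p a b mp _ IHa _ IHb] theta.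
- exact: measurable_cst.
- by case: theta => [|[] theta]; [exact: my|exact: IHb|exact: IHa].
- rewrite (_ : (fun _ => _) = fun w => if p w then key_at (a w) theta else key_at (b w) theta).
    exact: measurable_fun_ifT.
  by apply/funext => w; case: (p w).
Qed.

Variable u : X -> nat -> R.
Hypothesis mu_ : forall i, measurable_fun setT (fun w => u w i).

Lemma mtree_bst_of n : mtree (fun w => bst_of (u w) n).
Proof.
elim: n => [|n IH]; first exact: mtree_leaf.
by under eq_fun do rewrite bst_ofS; exact: mtree_insert.
Qed.

(** Keys never move, so the key at a node is a pointwise limit of measurable
    functions. *)
Lemma key_at_cvg (v : nat -> R) theta : key_at (bst_of v n) theta @[n --> \oo] --> node_key v theta.
Proof.
have [[n [z h]]|no] := pselect (exists n z, bst_key (bst_of v n) theta = Some z).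
  rewrite (node_keyE h); apply: cvg_near_cst; exists n => // m /= nm.
  by rewrite /key_at (bst_key_mono nm h).
have -> : node_key v theta = 0.
  rewrite /node_key; case: xgetP => // z _ [n h]; exfalso; apply: no; by exists n, z.
apply: cvg_near_cst; exists 0%N => // m _ /=; rewrite /key_at.
by case h: bst_key => [z|//]; exfalso; apply: no; exists m, z.
Qed.

Lemma measurable_node_key theta : measurable_fun setT (fun w => node_key (u w) theta).
Proof.
apply: (measurable_fun_cvg (h := fun n w => key_at (bst_of (u w) n) theta)).
  by move=> n; apply: measurable_key_at; exact: mtree_bst_of.
by move=> w _; exact: key_at_cvg.
Qed.

Lemma measurable_big_if (I : Type) (s : seq I) (op : R -> R -> R) (x0 : R)
    (Q : X -> I -> bool) (F : X -> I -> R) :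
  (forall f g : X -> R, measurable_fun setT f -> measurable_fun setT g ->
     measurable_fun setT (fun w => op (f w) (g w))) ->
  (forall i, measurable_fun setT (fun w => Q w i)) ->
  (forall i, measurable_fun setT (fun w => F w i)) ->
  measurable_fun setT (fun w => \big[op/x0]_(i <- s | Q w i) F w i).
Proof.
move=> mop mQ mF; elim: s => [|i s IH].
  by under eq_fun do rewrite big_nil; exact: measurable_cst.
under eq_fun do rewrite big_cons.
by apply: measurable_fun_ifT; [exact: mQ|exact: mop|].
Qed.

Lemma measurable_node_phi theta : measurable_fun setT (fun w => node_phi (u w) theta).
Proof.
apply: measurable_funB; apply: measurable_big_if.
- by move=> f g mf mg; exact: measurable_minr.
- by move=> k; apply: measurable_fun_ltr; exact: measurable_node_key.
- by move=> k; exact: measurable_node_key.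
- by move=> f g mf mg; exact: measurable_maxr.
- by move=> k; apply: measurable_fun_ltr; exact: measurable_node_key.
- by move=> k; exact: measurable_node_key.
Qed.

Lemma measurable_node_G theta : measurable_fun setT (fun w => node_G (u w) theta).
Proof.
apply: measurable_funM; first exact: measurable_node_phi.
apply: (measurableT_comp measurable_Cfun); apply: measurable_funM.
  exact: measurable_node_phi.
by apply: (measurableT_comp measurable_invr); exact: measurable_node_phi.
Qed.

Lemma measurable_G_partial_sum J : measurable_fun setT (fun w => G_partial_sum (u w) J).
Proof.
have madd (f g : X -> R) : measurable_fun setT f -> measurable_fun setT g ->
    measurable_fun setT (fun w => f w + g w) by exact: measurable_funD.
apply: (@measurable_big_if nat _ +%R 0 (fun _ _ => true)) => // j.
apply: (@measurable_big_if _ _ +%R 0 (fun _ _ => true)) => // th.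
exact: measurable_node_G.
Qed.

End MeasurableTree.

(** * The keys are almost surely generic *)
Section AlmostSurely.
Context {R : realType} {d : measure_display} {T : measurableType d}.
Variables (P : probability T R) (U : nat -> {RV P >-> R}).
Hypothesis iid : iid_uniform01 U.
Local Notation leb := (@lebesgue_measure R).

Lemma P_preimage i (A : set R) : measurable A -> P (U i @^-1` A) = leb (A `&` `[0, 1]).
Proof.
move=> mA; have mUA := measurable_preimage_RV U i mA.
transitivity (\int[P]_w (\1_(U i @^-1` A) w)%:E)%E; first by rewrite integral_indic// setIT.
transitivity (\int[leb]_(x in `[0%R, 1%R]) (\1_A x)%:E)%E; last by rewrite integral_indic.
rewrite -(ge0_integral_uniform_RV iid i (h := fun x => (\1_A x)%:E))//.
  by apply/measurable_EFinP; exact: measurable_indic.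
Qed.

Lemma ae_in01 i : {ae P, forall w, 0 < U i w < 1}.
Proof.
pose A : set R := ~` `]0, 1[.
have mA : measurable A by apply: measurableC; exact: measurable_itv.
apply: (@negligibleS _ _ _ P (U i @^-1` A)).
  by move=> w /= h; rewrite /A/= in_itv/=; exact: h.
apply/negligibleP; first exact: measurable_preimage_RV.
apply: (eq_trans (P_preimage i mA)).
apply: (@subset_measure0 _ _ _ leb _ [set 0; 1]).
- by apply: measurableI => //; exact: measurable_itv.
- exact: measurableU.
- move=> x [] /=; rewrite !in_itv/= => /negP; rewrite negb_and -!leNgt => h /andP[x0 x1].
  case/orP: h => h; [left|right]; apply/eqP; rewrite eq_le.
    by rewrite h.
  by rewrite x1.
- by apply: countable_lebesgue_measure0; exact: finite_set_countable.
Qed.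

(** Given the past, the j-th key hits the i-th one with probability the Lebesgue
    measure of a point. *)
Lemma ae_neq i j : (i < j)%N -> {ae P, forall w, U i w <> U j w}.
Proof.
move=> ij.
pose f (z : past U j * R) : \bar R := (if U i z.1 == z.2 then 1 else 0)%:E.
have mUi : measurable_fun setT (fun z : past U j * R => U i z.1).
  have : measurable_fun setT ((U i : past U j -> R) \o (@fst (past U j) R)).
    by apply: measurableT_comp => //; exact: measurable_past_RV.
  by move=> h; exact: h.
have mf : measurable_fun setT f.
  apply/measurable_EFinP; apply: measurable_fun_ifT => //.
  by apply: measurable_fun_eqr => //; exact: measurable_snd.
have f0 z : (0 <= f z)%E by rewrite /f; case: ifP.
have E := ge0_integral_last_key iid mf f0.
have E0 : (\int[P]_w f (w, U j w) = 0)%E.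
  rewrite E; apply: integral0_eq => w _ /=.
  transitivity (\int[leb]_(x in `[0%R, 1%R]) (\1_[set U i w] x)%:E)%E.
    apply: eq_integral; by move=> x _; rewrite /f /= indicE in_set1 eq_sym; case: eqP.
  rewrite integral_indic//; apply: (@subset_measure0 _ _ _ leb _ [set U i w]) => //.
    by apply: measurableI => //; exact: measurable_itv.
  exact: lebesgue_measure_set1.
have := E0.
have -> : (\int[P]_w f (w, U j w) = \int[P]_w (\1_[set w | U i w = U j w] w)%:E)%E.
  apply: eq_integral => w _; rewrite /f/= indicE; case: eqP => h.
    by rewrite mem_set.
  by rewrite memNset.
have mE : measurable [set w | U i w = U j w].
  rewrite (_ : [set w | _] = (fun w => U i w == U j w) @^-1` [set true]).
    rewrite -[X in measurable X]setTI.
    by apply: measurable_fun_eqr => //; exact: measurable_funP.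
  by apply/seteqP; split => w /= /eqP.
rewrite integral_indic// setIT => h0.
apply: (@negligibleS _ _ _ P [set w | U i w = U j w]); last exact/negligibleP.
by move=> w /=; exact: contrapT.
Qed.

Lemma ae_dense n m i : (i < m.+1)%N ->
  {ae P, forall w, exists2 k, (n <= k)%N & i%:R / m.+1%:R < U k w < i.+1%:R / m.+1%:R}.
Proof.
move=> im.
have m0 : 0 < m.+1%:R :> R by [].
pose a : R := i%:R / m.+1%:R; pose b : R := i.+1%:R / m.+1%:R.
have ab : a < b by rewrite ltr_pM2r ?invr_gt0// ltr_nat.
have a0 : 0 <= a by rewrite divr_ge0.
have b1 : b <= 1 by rewrite ler_pdivrMr// mul1r ler_nat.
pose A : set R := ~` `]a, b[.
have mA : measurable A by apply: measurableC; exact: measurable_itv.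
(* M independent keys all miss the cell with probability q^M, which tends to 0. *)
pose q : R := 1 - m.+1%:R^-1.
have q01 : 0 <= q < 1.
  by rewrite subr_ge0 invf_le1// ler1n ltrBlDr ltrDl invr_gt0 m0.
have PA k : P (U k @^-1` A) = q%:E.
  rewrite /A preimage_setC probability_setC;
      last exact: (measurable_preimage_RV U k (measurable_itv `]a, b[)).
  have sub : `]a, b[ `<=` (`[0, 1] : set R).
    move=> x /=; rewrite !in_itv/= => /andP[ax xb].
    by rewrite (le_trans a0 (ltW ax)) (le_trans (ltW xb)).
  have E : P (U k @^-1` `]a, b[) = (m.+1%:R^-1)%:E.
    rewrite (P_preimage k (measurable_itv `]a, b[)) setIidl//.
    rewrite lebesgue_measure_itv/= lte_fin ab -EFinB; congr EFin.
    by rewrite /a /b -mulrBl -natr1 addrAC subrr add0r mul1r.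
  by rewrite [X in (1 - X)%E]E.
pose B M := \big[setI/setT]_(k <- iota n M) (U k @^-1` A).
have PB M : P (B M) = (q ^+ M)%:E.
  have [indep _] := iid.
  rewrite /B (indep _ (fun=> A) (iota_uniq _ _) (fun=> mA)).
  rewrite (eq_bigr (fun=> q%:E)) => [|k _]; last exact: PA.
  by rewrite prodEFin big_const_seq count_predT size_iota iter_mulr mulr1.
pose Bad := \bigcap_(k in [set k | (n <= k)%N]) (U k @^-1` A).
have mBad : measurable Bad.
  by apply: bigcap_measurable => [|k _]; [exists n => /=|exact: measurable_preimage_RV].
have BadB M : Bad `<=` B M.
  move=> w bad; rewrite /B -bigcap_seq => k /=; rewrite mem_iota => /andP[nk _].
  exact: bad.
have mB M : measurable (B M).
  by apply: big_ind => //; [exact: measurableI|move=> k _; exact: measurable_preimage_RV].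
have Bad0 : P Bad = 0%E.
  apply/eqP; rewrite eq_le measure_ge0 andbT.
  have Pfin : P Bad \is a fin_num by exact: fin_num_measure.
  rewrite -(fineK Pfin) lee_fin.
  have cq : q ^+ M @[M --> \oo] --> 0.
    by apply: cvg_expr; rewrite ger0_norm; case/andP: q01.
  apply: (cvgr_to_ge cq); near=> M.
  by rewrite -lee_fin -PB fineK// le_measure ?inE.
apply: (@negligibleS _ _ _ P Bad); last exact/negligibleP.
move=> w /= h k nk; rewrite /A /= in_itv/= => hk; apply: h.
by exists k.
Unshelve. all: by end_near. Qed.

Lemma ae_generic : {ae P, forall w, generic (fun i => U i w)}.
Proof.
have h1 : {ae P, forall w, forall i, 0 < U i w < 1} by apply/ae_foralln => i; exact: ae_in01.
have h2 : {ae P, forall w, forall i j, (i < j)%N -> U i w <> U j w}.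
  apply/ae_foralln => i; apply/ae_foralln => j; case: (ltnP i j) => ij.
    by apply: filterS (ae_neq ij).
  by apply: aeW => w.
have h3 : {ae P, forall w, forall n m i, (i < m.+1)%N ->
    exists2 k, (n <= k)%N & i%:R / m.+1%:R < U k w < i.+1%:R / m.+1%:R}.
  apply/ae_foralln => n; apply/ae_foralln => m; apply/ae_foralln => i.
  case: (ltnP i m.+1) => im; last by apply: aeW => w.
  by apply: filterS (ae_dense n im).
apply: filterS3 h1 h2 h3 => w h1 h2 h3; split => // i j e.
by apply/eqP; case: ltngtP => // /h2; [move=> /(_ e)|rewrite e].
Qed.

End AlmostSurely.

(** * Measurability of the number of comparisons *)
Section MeasurableQuickSort.
Context {R : realType} {d : measure_display} {X : measurableType d}.
Implicit Types (s : X -> seq R) (x : X -> R).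

(** The analogue of [mprofile] for lists of keys. *)
Inductive mseq : (X -> seq R) -> Prop :=
| mseq_nil : mseq (fun=> [::])
| mseq_cons x s : measurable_fun setT x -> mseq s -> mseq (fun w => x w :: s w)
| mseq_if (p : X -> bool) s s' : measurable_fun setT p -> mseq s -> mseq s' ->
    mseq (fun w => if p w then s w else s' w).

Lemma mseq_filter s (p : X -> R -> bool) : mseq s ->
  (forall x, measurable_fun setT x -> measurable_fun setT (fun w => p w (x w))) ->
  mseq (fun w => [seq y <- s w | p w y]).
Proof.
move=> ms mp; elim: ms => [|x {}s mx _ IH|q {}s s' mq _ IH _ IH'] /=.
- exact: mseq_nil.
- by apply: mseq_if; [exact: mp|exact: mseq_cons|].
- rewrite (_ : (fun _ => _) = fun w => if q w then [seq y <- s w | p w y]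
      else [seq y <- s' w | p w y]).
    exact: mseq_if.
  by apply/funext => w; case: (q w).
Qed.

Lemma measurable_size s : mseq s -> measurable_fun setT (fun w => (size (s w))%:R : R).
Proof.
elim=> [|x {}s mx _ IH|q {}s s' mq _ IH _ IH'] /=.
- exact: measurable_cst.
- by under eq_fun do rewrite -natr1; apply: measurable_funD.
- rewrite (_ : (fun _ => _) = fun w => if q w then (size (s w))%:R : R else (size (s' w))%:R).
    exact: measurable_fun_ifT.
  by apply/funext => w; case: (q w).
Qed.

Lemma measurable_qs_comps_rec fuel s : mseq s ->
  measurable_fun setT (fun w => (qs_comps_rec fuel (s w))%:R : R).
Proof.
elim: fuel s => [|fuel IHf] s ms; first exact: measurable_cst.
elim: ms => [|x {}s mx ms IH|q {}s s' mq _ IH _ IH'].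
- exact: measurable_cst.
- under eq_fun do rewrite /= !natrD; apply: measurable_funD; first apply: measurable_funD.
  + exact: measurable_size.
  + by apply/IHf/mseq_filter => // y my; exact: measurable_fun_ltr.
  + by apply/IHf/mseq_filter => // y my; exact: measurable_fun_ltr.
- rewrite (_ : (fun _ => _) = fun w => if q w then (qs_comps_rec fuel.+1 (s w))%:R : R
      else (qs_comps_rec fuel.+1 (s' w))%:R).
    exact: measurable_fun_ifT.
  by apply/funext => w; case: (q w).
Qed.

End MeasurableQuickSort.

(** * Distances in L2 *)
Section L2.
Context {R : realType} {d : measure_display} {T : measurableType d}.
Variable P : probability T R.
Implicit Types (X Y Z W : T -> R).

Lemma L2norm_ge0 X : (0 <= L2norm P X)%E.
Proof. exact: Lnorm_ge0. Qed.

Lemma L2norm_sqr X : (L2norm P X ^+ 2 = \int[P]_w (X w ^+ 2)%:E)%E.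
Proof.
have h : ((2%:R : R) != 0)%R by rewrite pnatr_eq0.
have := poweR_Lnorm P (EFin \o X) h.
rewrite -/(L2norm P X) => E.
have -> : (L2norm P X ^+ 2 = L2norm P X `^ 2%:R)%E.
  have := L2norm_ge0 X; case: (L2norm P X) => [r|//|//] r0.
    by rewrite poweR_EFin powR_mulrn// -lee_fin.
  by rewrite poweRyr//.
rewrite E; apply: eq_integral => w _ /=.
by rewrite powR_mulrn// real_normK// num_real.
Qed.

Lemma L2norm_sub_le X Z W : measurable_fun setT X -> measurable_fun setT Z ->
  measurable_fun setT W ->
  (L2norm P (fun w => X w - W w)%R <=
   L2norm P (fun w => X w - Z w)%R + L2norm P (fun w => Z w - W w)%R)%E.
Proof.
move=> mX mZ mW.
have := @minkowski_EFin _ _ _ P (fun w => X w - Z w) (fun w => Z w - W w) 2.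
move=> /(_ (measurable_funB mX mZ) (measurable_funB mZ mW) (ler1n R 2)).
rewrite /L2norm; congr (_ <= _)%E; apply: eq_Lnorm => w /=.
by rewrite addrA subrK.
Qed.

Lemma L2norm_subC X Z : L2norm P (fun w => X w - Z w) = L2norm P (fun w => Z w - X w).
Proof.
rewrite /L2norm -oppe_Lnorm; apply: eq_Lnorm => w /=.
by rewrite opprB.
Qed.

(** If S_J tends to Y in L2, the distance of X to S_J tends to the distance of X
    to Y, by the triangle inequality. *)
Lemma L2norm_sqr_limit X Y (S : nat -> T -> R) (L : R) (b : nat -> R) :
  measurable_fun setT X -> measurable_fun setT Y -> (forall J, measurable_fun setT (S J)) ->
  L2norm P (fun w => S J w - Y w)%R @[J --> \oo] --> 0%E ->
  (\forall J \near \oo, \int[P]_w ((X w - S J w) ^+ 2)%:E = (b J)%:E)%E ->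
  b J @[J --> \oo] --> L ->
  (L2norm P (fun w => X w - Y w)%R ^+ 2 = L%:E)%E.
Proof.
move=> mX mY mS SY Xb bL.
have /fine_cvgP[Sfin Scvg] := SY.
have Xfin : \forall J \near \oo, L2norm P (fun w => X w - S J w)%R \is a fin_num.
  near=> J; have : (L2norm P (fun w => X w - S J w)%R ^+ 2 = (b J)%:E)%E.
    by rewrite L2norm_sqr; near: J.
  by have := L2norm_ge0 (fun w => X w - S J w); case: L2norm.
have Yfin : L2norm P (fun w => X w - Y w)%R \is a fin_num.
  have [J [sJ xJ]] : exists J, L2norm P (fun w => S J w - Y w)%R \is a fin_num /\
      L2norm P (fun w => X w - S J w)%R \is a fin_num.
    have [J0 _ hJ0] : \forall J \near \oo, L2norm P (fun w => S J w - Y w)%R \is a fin_num /\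
      L2norm P (fun w => X w - S J w)%R \is a fin_num by near=> J; split; near: J.
    by exists J0; apply: hJ0 => /=.
  rewrite ge0_fin_numE ?L2norm_ge0//.
  apply: (le_lt_trans (L2norm_sub_le mX (mS J) mY)).
  by rewrite lte_add_pinfty// -ge0_fin_numE ?L2norm_ge0.
set al := fine (L2norm P (fun w => X w - Y w)%R).
pose be J := fine (L2norm P (fun w => X w - S J w)%R).
pose de J := fine (L2norm P (fun w => S J w - Y w)%R).
have close : \forall J \near \oo, `|al - be J| <= de J.
  near=> J.
  have xf : L2norm P (fun w => X w - S J w)%R \is a fin_num by near: J.
  have sf : L2norm P (fun w => S J w - Y w)%R \is a fin_num by near: J.
  rewrite ler_distl; apply/andP; split.
    have := L2norm_sub_le mX mY (mS J).
    rewrite (L2norm_subC Y) -(fineK xf) -(fineK sf) -(fineK Yfin) -EFinD lee_fin.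
    by rewrite -lerBlDr.
  have := L2norm_sub_le mX (mS J) mY.
  by rewrite -(fineK xf) -(fineK sf) -(fineK Yfin) -EFinD lee_fin.
have beal : be J @[J --> \oo] --> al.
  apply/cvgrPdist_le => e e0; near=> J.
  have h1 : `|al - be J| <= de J by near: J.
  apply: (le_trans h1); have : `|0 - de J| <= e.
    by near: J; move/cvgrPdist_le : Scvg; apply.
  by rewrite sub0r normrN; apply: le_trans; exact: ler_norm.
have be2 : be J ^+ 2 @[J --> \oo] --> al ^+ 2.
  by rewrite !expr2; under eq_fun do rewrite expr2; exact: cvgM.
have bbe : \forall J \near \oo, b J = be J ^+ 2.
  near=> J; have xf : L2norm P (fun w => X w - S J w)%R \is a fin_num by near: J.
  have : (L2norm P (fun w => X w - S J w)%R ^+ 2 = (b J)%:E)%E.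
    by rewrite L2norm_sqr; near: J.
  by rewrite -(fineK xf) => -[].
have -> : L = al ^+ 2.
  have be2' : b J @[J --> \oo] --> al ^+ 2.
    apply: cvg_trans be2; apply: near_eq_cvg.
    by apply: filterS bbe => J ->.
  exact: (cvg_unique _ bL be2').
by rewrite EFin_expe /al fineK.
Unshelve. all: by end_near. Qed.

End L2.

(** * The distance to the limit as a difference of second moments *)
Section Distance.
Context {R : realType} {d : measure_display} {T : measurableType d}.
Variables (P : probability T R) (U : nat -> {RV P >-> R}).
Hypothesis iid : iid_uniform01 U.
Implicit Types (n J : nat).
Local Notation uw w := (fun i => U i w).

Lemma ae_keys : {ae P, forall w, generic (uw w) /\ keys U w = uw w}.
Proof.
apply: filterS (ae_generic iid) => w gw; split => //.
apply/funext => i; rewrite /keys /key /half_open.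
by have /andP[/ltW-> ->] := generic01 gw i.
Qed.

Lemma trunc_sum_tree_sum J n w : trunc_sum U J n w = tree_sum J (bst_of (keys U w) n) 0 0 1.
Proof.
elim: n => [|n IH]; first by rewrite /trunc_sum big_ord0.
have k01 := keys01 U w; have /andP[k0 k1] := k01 n.
rewrite /trunc_sum big_ord_recr/= -/(trunc_sum U J n w) IH bst_ofS.
by rewrite tree_sum_insert ?bst_of_ordered// /incr gaps_leaves.
Qed.

Lemma trunc_sum_bound J n w : `|trunc_sum U J n w| <= 5 * J%:R.
Proof.
rewrite trunc_sum_tree_sum; have := tree_sum_bound J 0 (bst_of_ordered n (keys01 U w)).
by rewrite subr0 mulr1 subn0.
Qed.

Lemma ae_trunc_sum_cvg J :
  {ae P, forall w, trunc_sum U J m w @[m --> \oo] --> G_partial_sum (uw w) J}.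
Proof.
apply: filterS ae_keys => w [gw kw].
have [N hN] := G_partial_sumE J gw.
apply: cvg_near_cst; exists N => // m /= Nm.
by rewrite trunc_sum_tree_sum kw hN.
Qed.

Lemma measurable_K n : measurable_fun setT (fun w => (K U n w)%:R : R).
Proof.
have ms (l : seq nat) : mseq (fun w => [seq U i w | i <- l]).
  elim: l => [|i l IH]; first exact: mseq_nil.
  by apply: mseq_cons => //; exact: measurable_funP.
have := measurable_qs_comps_rec n (ms (iota 0 n)).
rewrite (_ : (fun _ => _) = fun w => (K U n w)%:R)//.
by apply/funext => w; rewrite /K /qs_comps size_mkseq.
Qed.

Lemma ae_K n : {ae P, forall w, (K U n w)%:R = dsum (depths (keys U w) n) - 2 * n%:R :> R}.
Proof.
apply: filterS ae_keys => w [gw kw].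
rewrite dsum_depths; last 2 first.
- exact: keys01.
- by rewrite kw; apply: mkseq_uniq; exact: generic_inj.
by rewrite addrK kw.
Qed.

Lemma bddmeas_dsum n : bddmeas (fun w => dsum (depths (keys U w) n) - 2 * n%:R : R).
Proof. exact: (bddmeas_past (bddmeas_depths U (fun ds => dsum ds - 2 * n%:R) (leqnn n))). Qed.

Lemma mu_dsum n : mu U n = depth_mean n (@dsum R) - 2 * n%:R.
Proof.
have -> : mu U n = mean P (fun w => (K U n w)%:R) by rewrite /mu unlock.
rewrite (ae_eq_mean (measurable_K n) (bddmeas_dsum n).1 (ae_K n)).
rewrite (mean_depths iid n (fun ds => dsum ds - 2 * n%:R)).
by rewrite (depth_meanD n (@dsum R) (fun=> - (2 * n%:R))) depth_mean_cst.
Qed.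

Lemma ae_Yn n : {ae P, forall w, Yn U n w = Yrank U n w}.
Proof.
apply: filterS (ae_K n) => w e; rewrite /Yn /Yrank e mu_dsum.
by congr (_ / _); ring.
Qed.

Lemma measurable_Yn n : measurable_fun setT (Yn U n).
Proof. by apply: measurable_funM => //; apply: measurable_funB => //; exact: measurable_K. Qed.

Lemma measurable_G_sum J : measurable_fun setT (fun w => G_partial_sum (uw w) J).
Proof. by apply: measurable_G_partial_sum => i; exact: measurable_funP. Qed.

(** As the number of keys grows with J fixed, the truncated sums converge almost
    surely to the level sum, and they are bounded by 5 J; dominated convergence
    carries the bounds on their distance to Y_n over to the limit. *)
Lemma integral_Yn_G_sum n J : (n <= J)%N -> exists2 b : R,
  (\int[P]_w ((Yn U n w - G_partial_sum (uw w) J) ^+ 2)%:E = b%:E)%E &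
  C_sqr * (3 - 6 / J.+2%:R) - qs_norm n <= b <= C_sqr * 3 - qs_norm n.
Proof.
move=> nJ.
have bY := bddmeas_past (bddmeas_Yrank U (leqnn n)); have [c hc] := bY.2.
pose f_ m w : R := (trunc_sum U J m w - Yrank U n w) ^+ 2.
pose f w : R := (Yn U n w - G_partial_sum (uw w) J) ^+ 2.
pose B : R := (5 * J%:R + c) ^+ 2.
have bf m : bddmeas (f_ m).
  by apply/bddmeasX/bddmeasB => //; exact: (bddmeas_past (bddmeas_trunc_sum U J (leqnn m))).
have mf : measurable_fun setT f.
  apply: measurable_funX; apply: measurable_funB; first exact: measurable_Yn.
  exact: measurable_G_sum.
have cf : {ae P, forall w, f_ m w @[m --> \oo] --> f w}.
  apply: filterS2 (ae_trunc_sum_cvg J) (ae_Yn n) => w cw ew.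
  rewrite /f ew -sqrrN opprB /f_ expr2; under eq_fun do rewrite expr2.
  by apply: cvgM; apply: cvgB => //; exact: cvg_cst.
have B_f m w : `|f_ m w| <= B.
  rewrite /f_ /B normrX lerXn2r ?nnegrE//.
    by rewrite addr_ge0 ?mulr_ge0// (le_trans (normr_ge0 _) (hc w)).
  by rewrite (le_trans (ler_normB _ _))// lerD// trunc_sum_bound.
have [] := @dominated_convergence _ T R P setT measurableT (fun m w => (f_ m w)%:E)
  (fun w => (f w)%:E) (fun=> B%:E).
- by move=> m; apply/measurable_EFinP; have [] := bf m.
- exact/measurable_EFinP.
- by apply: filterS cf => w cw _; apply: cvg_EFin; [exact: nearW|exact: cw].
- exact: (bddmeas_integrable P (bddmeas_cst B)).
- by apply: aeW => w m _; rewrite lee_fin.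
move=> intf _ lim_f.
have ffin := integrable_fin_num measurableT intf.
exists (mean P f); first by rewrite /mean /Rintegral fineK.
have cE : mean P (f_ m) @[m --> \oo] --> mean P f.
  have h : (\int[P]_w (f_ m w)%:E)%E @[m --> \oo] --> (mean P f)%:E.
    by rewrite /mean /Rintegral fineK.
  exact: (fine_cvg h).
have bnd m : (J <= m)%N ->
    C_sqr * (3 - 6 / J.+2%:R) - qs_norm n <= mean P (f_ m) <= C_sqr * 3 - qs_norm n.
  exact: mean_trunc_sum_Yrank_bounds.
apply/andP; split.
  by apply: (cvgr_to_ge cE); exists J => // m /= /bnd/andP[].
by apply: (cvgr_to_le cE); exists J => // m /= /bnd/andP[].
Qed.

(** The bounds for the level sums below J differ by 6 c/(J+2), so they determine
    the limit. *)
Lemma L2norm_sqr_Yn (Y : {RV P >-> R}) n : is_L2_limit_of_G_series U Y ->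
  (L2norm P (fun w => (Yn U n w - Y w)%R) ^+ 2 = (3 * C_sqr - qs_norm n)%:E)%E.
Proof.
move=> SY.
have /choice[b hb] : forall J, exists b : R, (n <= J)%N ->
    (\int[P]_w ((Yn U n w - G_partial_sum (uw w) J) ^+ 2)%:E = b%:E)%E /\
    C_sqr * (3 - 6 / J.+2%:R) - qs_norm n <= b <= C_sqr * 3 - qs_norm n.
  move=> J; case: (leqP n J) => [nJ|_]; last by exists 0.
  by have [b h1 h2] := integral_Yn_G_sum nJ; exists b.
apply: (L2norm_sqr_limit (b := b) (measurable_Yn n) (measurable_funP Y) measurable_G_sum SY).
  by exists n => // J /= nJ; have [] := hb J nJ.
apply: (@squeeze_cvgr _ _ _ _ (fun J => C_sqr * (3 - 6 / J.+2%:R) - qs_norm n)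
  (fun=> 3 * C_sqr - qs_norm n)).
- exists n => // J /= nJ; have [_ /andP[h1 h2]] := hb J nJ.
  by rewrite h1 mulrC h2.
- apply: cvgB; last exact: cvg_cst.
  have h : (J.+2%:R^-1 : R) @[J --> \oo] --> 0.
    by have := @cvg_harmonic R; rewrite -cvg_shiftS.
  rewrite [X in _ --> X](_ : _ = C_sqr * (3 - 6 * 0)); last by rewrite mulr0 subr0 mulrC.
  by apply: cvgM; [exact: cvg_cst|apply: cvgB; [exact: cvg_cst|apply: cvgM => //; exact: cvg_cst]].
- exact: cvg_cst.
Qed.

End Distance.

(** * The closed formula and its asymptotics *)
Section Formula.
Context {R : realType}.
Implicit Types n N : nat.

(** The value zeta(2), in the form in which the integral of C^2 provides it. *)
Definition zeta2 : R := (7 - 3 * C_sqr) / 4.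

Lemma H2_cvg : (H2 N : R) @[N --> \oo] --> zeta2.
Proof.
have h N : `|zeta2 - H2 N| <= 25 * harmonic N :> R.
  have := int_Cfun_sqr_approx N (@has_int_C_sqr R).
  rewrite /harmonic/= /zeta2 !ler_norml; move: (N.+1%:R^-1 : R) (H2 N) C_sqr => x a c; lra.
apply/cvgrPdist_le => e e0.
have hc : 25 * harmonic N @[N --> \oo] --> (25 * 0 : R).
  by apply: cvgM; [exact: cvg_cst|exact: cvg_harmonic].
rewrite mulr0 in hc; move/cvgrPdist_le : hc => /(_ _ e0) hc.
near=> N; apply: (le_trans (h N)).
have : `|0 - 25 * harmonic N| <= e :> R by near: N.
by rewrite sub0r normrN; apply: le_trans; exact: ler_norm.
Unshelve. all: by end_near. Qed.

Lemma H2_mono (m n : nat) : (m <= n)%N -> H2 m <= H2 n :> R.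
Proof.
move=> /subnK <-; elim: (n - m)%N => [//|k IH].
by rewrite addSn H2S (le_trans IH)// lerDl invr_ge0 exprn_ge0.
Qed.

(** The sequence H2 m + 1/m decreases, because 1/m - 1/(m+1) > 1/(m+1)^2. *)
Lemma H2_tail n k : H2 (n.+1 + k) + (n.+1 + k)%:R^-1 <= H2 n.+1 + n.+1%:R^-1 :> R.
Proof.
elim: k => [|k IH]; first by rewrite addn0.
apply: le_trans IH; rewrite addnS H2S -addrA lerD2l.
have m0 : 0 < (n.+1 + k)%:R :> R by rewrite ltr0n addSn.
rewrite -natr1; move: ((n.+1 + k)%:R : R) m0 => x x0.
rewrite -subr_ge0 (_ : _ - _ = (x * (x + 1) ^+ 2)^-1); last first.
  by field; rewrite !gt_eqF//; lra.
by rewrite invr_ge0 mulr_ge0 ?exprn_ge0 ?ltW//; lra.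
Qed.

Lemma zeta2_bounds n : H2 n.+1 <= zeta2 <= H2 n.+1 + n.+1%:R^-1.
Proof.
apply/andP; split.
  by apply: (cvgr_to_ge H2_cvg); exists n.+1 => // N /= nN; exact: H2_mono.
apply: (cvgr_to_le H2_cvg); exists n.+1 => // N /= nN.
have := H2_tail n (N - n.+1); rewrite subnKC//; apply: le_trans.
by rewrite lerDl invr_ge0.
Qed.

Lemma nneseries_inv_sqr n :
  (\sum_(n.+1 <= k <oo) ((k%:R : R) ^- 2)%R%:E = (zeta2 - H2 n)%:E)%E.
Proof.
apply/cvg_lim => //.
rewrite -(cvg_shiftn n.+1)/=.
have e N : (\sum_(n.+1 <= k < N + n.+1) ((k%:R : R) ^- 2)%R%:E = (H2 (N + n) - H2 n)%:E)%E.
  rewrite sumEFin; congr EFin; elim: N => [|N IH].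
    by rewrite !add0n big_geq// subrr.
  rewrite addSn big_nat_recr ?leq_addl//= IH addSn H2S addnS; ring.
under eq_fun do rewrite e.
apply: cvg_EFin; first exact: nearW.
apply: cvgB; last exact: cvg_cst.
by have := H2_cvg; rewrite -(cvg_shiftn n).
Qed.

Lemma harmonic_numberE n : harmonic_number n = H1 n :> R.
Proof. by rewrite /harmonic_number big_add1/= big_mkord. Qed.

Lemma distance_formula n : 3 * C_sqr - qs_norm n =
  n.+1%:R^-1 * (2 * harmonic_number n + 1 + 6 / n.+1%:R) - 4 * (zeta2 - H2 n) :> R.
Proof.
rewrite harmonic_numberE /zeta2 /qs_norm /qs_var.
have n0 : 0 <= n%:R :> R by [].
rewrite -(natr1 n); move: (n%:R : R) (H1 n) (H2 n) C_sqr n0 => x a b c x0.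
by field; rewrite gt_eqF//; lra.
Qed.

Lemma ln_succ_bounds n : n.+2%:R^-1 <= ln (n.+2%:R : R) - ln n.+1%:R <= n.+1%:R^-1.
Proof.
have p1 : (n.+1%:R : R) \is Num.pos by rewrite posrE ltr0n.
have p2 : (n.+2%:R : R) \is Num.pos by rewrite posrE ltr0n.
have n1 : 0 < n.+1%:R :> R by rewrite ltr0n.
have n2 : 0 < n.+2%:R :> R by rewrite ltr0n.
have e2 : n.+2%:R = n.+1%:R + 1 :> R by rewrite natr1.
apply/andP; split.
  rewrite -opprB -ln_div// lerNr.
  have -> : n.+1%:R / n.+2%:R = 1 + - n.+2%:R^-1 :> R.
    by rewrite e2; field; rewrite gt_eqF//; lra.
  by apply: le_ln1Dx; rewrite ltrN2 invf_lt1// ltr1n.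
rewrite -ln_div//.
have -> : n.+2%:R / n.+1%:R = 1 + n.+1%:R^-1 :> R.
  by rewrite e2; field; rewrite gt_eqF.
by apply: le_ln1Dx; rewrite (lt_le_trans (ltrN10 _))// invr_ge0 ltW.
Qed.

Lemma H1_ln_bounds n : ln (n.+1%:R : R) <= (H1 n.+1 : R) <= 1 + ln n.+1%:R.
Proof.
suff /andP[h1 h2] : ln (n.+1%:R : R) <= (H1 n : R) <= ln n.+1%:R + 1 - n.+1%:R^-1.
  rewrite H1S; have : 0 < (n.+1%:R : R)^-1 by rewrite invr_gt0 ltr0n.
  move: (ln n.+1%:R) (n.+1%:R^-1 : R) (H1 n) h1 h2 => l x a h1 h2 x0; apply/andP; split; lra.
elim: n => [|n /andP[IH1 IH2]]; first by rewrite /H1 big_ord0 ln1 invr1 add0r subrr lexx.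
have /andP[l1 l2] := ln_succ_bounds n.
rewrite H1S; move: (ln _) (ln _) (H1 n) (_^-1) (_^-1) l1 l2 IH1 IH2 => a b c e f.
by move=> *; apply/andP; split; lra.
Qed.

(** As H_n = ln n + O(1) and the tail of zeta(2) is O(1/n), only 2 H_n/(n+1)
    contributes more than O(1/n). The constant 20 is generous: with x = n + 1, the
    summands of the decomposition below are at most 2/x, 1/x, 6/x, 4/x and 2/x in
    absolute value. *)
Lemma distance_asymptotics n :
  `|n.+2%:R^-1 * (2 * harmonic_number n.+1 + 1 + 6 / n.+2%:R) - 4 * (zeta2 - H2 n.+1) -
    2 * (ln n.+1%:R / n.+1%:R)| <= 20 * n.+1%:R^-1 :> R.
Proof.
rewrite harmonic_numberE.
have /andP[h1 h2] := H1_ln_bounds n; have /andP[z1 z2] := zeta2_bounds n.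
have n1 : 1 <= n.+1%:R :> R by rewrite ler1n.
have l0 : 0 <= ln n.+1%:R :> R by exact: ln_ge0.
have l1 : ln n.+1%:R <= n.+1%:R :> R by apply/ltW/ln_sublinear; rewrite ltr0n.
have e2 : n.+2%:R = n.+1%:R + 1 :> R by rewrite natr1.
rewrite e2; move: h1 h2 z1 z2 n1 l0 l1.
move: (n.+1%:R : R) (H1 n.+1) (H2 n.+1) zeta2 => x a b z; move: (ln x) => l.
move=> h1 h2 z1 z2 n1 l0 l1.
have x0 : 0 < x by lra.
have y0 : 0 < x + 1 by lra.
have yx : (x + 1)^-1 <= x^-1 by rewrite lef_pV2// ?posrE//; lra.
have y1 : 0 < (x + 1)^-1 by rewrite invr_gt0.
have y2 : (x + 1)^-1 <= 1 by rewrite invf_le1//; lra.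
have -> : (x + 1)^-1 * (2 * a + 1 + 6 / (x + 1)) - 4 * (z - b) - 2 * (l / x) =
  2 * ((x + 1)^-1 * (a - l)) + (x + 1)^-1 + 6 * ((x + 1)^-1 * (x + 1)^-1) - 4 * (z - b)
  - 2 * (l / x * (x + 1)^-1).
  by field; rewrite !gt_eqF.
have lx : 0 <= l / x <= 1 by rewrite divr_ge0 ?(ltW x0)//= ler_pdivrMr// mul1r.
have t1 : 0 <= (x + 1)^-1 * (a - l) <= (x + 1)^-1.
  by rewrite mulr_ge0 ?subr_ge0 ?(ltW y1)//= ger_pMr//; lra.
have t2 : 0 <= (x + 1)^-1 * (x + 1)^-1 <= (x + 1)^-1.
  by rewrite mulr_ge0 ?(ltW y1)//= ger_pMr.
have t3 : 0 <= l / x * (x + 1)^-1 <= (x + 1)^-1.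
  by case/andP: lx => lx0 lx1; rewrite mulr_ge0 ?(ltW y1)//= ger_pMl.
move: yx y1 t1 t2 t3 z1 z2.
move: (_ * (a - l)) => p; move: (l / x * _) => r; move: (_ * (x + 1)^-1) => q.
move: (x^-1) ((x + 1)^-1) => s t; rewrite ler_norml; lra.
Qed.

End Formula.

Theorem theorem1p4 (R : realType) (d : measure_display) (T : measurableType d)
    (P : probability T R) (U : nat -> {RV P >-> R}) (Y : {RV P >-> R}) :
  iid_uniform01 U ->
  is_L2_limit_of_G_series U Y ->
  (forall n : nat,
     (L2norm P (fun w => (Yn U n w - Y w)%R) ^+ 2 =
      (n.+1%:R^-1 * (2 * harmonic_number n + 1 + 6 / n.+1%:R))%R%:E
      - 4%:E * \sum_(n.+1 <= k <oo) ((k%:R : R) ^- 2)%R%:E)%E)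
  /\
  ((fun n : nat => fine (L2norm P (fun w => (Yn U n w - Y w)%R) ^+ 2)%E)
   = (fun n : nat => 2 * (ln (n%:R : R) / n%:R)) +O_\oo (fun n : nat => n%:R^-1 : R)).
Proof.
move=> iid SY.
have E n := L2norm_sqr_Yn iid n SY.
split=> [n|].
  by rewrite E nneseries_inv_sqr distance_formula EFinB EFinM.
apply/eqaddOP; near=> k; near=> n.
have n0 : (0 < n)%N by near: n; exists 1%N.
have k20 : 20 <= k by near: k; exact: nbhs_pinfty_ge.
rewrite !fctE E distance_formula /= -(prednK n0).
apply: (le_trans (distance_asymptotics _)).
by rewrite ler_pM// ger0_norm ?invr_ge0.
Unshelve. all: by end_near. Qed.
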